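(* For each $n$ let $M_0^{(n)}$ be a probability on $(\widetilde{\mathfrak{S}}_n)^\wedge_{\mathrm{spin}}$ with corresponding spin normalized central positive-definite function $f_0^{(n)}$ on $\widetilde{\mathfrak{S}}_n$. Assume $\{f_0^{(n)}\}$ satisfies the approximate factorization property and that $\lim_{n\to\infty}n^{\frac{k-1}{2}}f_0^{(n)}([1\ 2\ \cdots\ k])=r_{k+1}$ exists for every odd $k\ge3$; put $r_1=r_3=\cdots=0$, $r_2=1$. Assume there is $C>0$ such that either $|r_{k+1}|^{1/(k+1)}\le C$ for all odd $k\ge3$, or $|r_{k+1}|^{1/(k+1)}\le C(k+1)$ for all odd $k\ge3$. Let $(X_s^{(n)})_{s\ge0}$ be the continuous time random walk on $(\widetilde{\mathfrak{S}}_n)^\wedge_{\mathrm{spin}}$ with initial distribution $M_0^{(n)}$ and pausing time distribution $\psi$ on $[0,\infty)$ having mean $m$ and characteristic function $\varphi$ with $\int_{\{|u|\ge a\}}|\varphi(u)/u|\,du<\infty$ for some $a>0$. For $t\ge0$ let $\omega_t$ be the limit shape at macroscopic time $t$, i.e. the continuous diagram such that, with $M_{tn}^{(n)}$ the distribution of $X_{tn}^{(n)}$, $M_{tn}^{(n)}(\{(\lambda,\gamma):\sup_{x\in\mathbb{R}}|D(\lambda)^{\sqrt{2n}}(x)-\omega_t(x)|>\epsilon\})\to0$ as $n\to\infty$ for every $\epsilon>0$; its transition measure satisfies $\mathfrak{m}_{\omega_t}=(\mathfrak{m}_{\omega_0})_{e^{-t/m}}\boxplus\gamma_{1-e^{-t/m}}$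 for $t>0$, where $\gamma$ is the centered semicircle distribution of variance $1$. Then the Stieltjes transform $$G(t,z)=\int_{\mathbb{R}}\frac{1}{z-x}\,\mathfrak{m}_{\omega_t}(dx)$$ satisfies the partial differential equation $$m\,\frac{\partial G}{\partial t}=-G\,\frac{\partial G}{\partial z}+G+\frac1G\,\frac{\partial G}{\partial z}\qquad(t>0,\ z\in\mathbb{C}\setminus\mathbb{R}).$$
   Context: (In the Stieltjes transform, $z$ is a complex variable; in the group below, $z$ denotes the central element.) Group. For $n\ge 1$, $\widetilde{\mathfrak{S}}_n$ is the group generated by $z,r_1,\dots,r_{n-1}$ with relations $z^2=e$, $r_iz=zr_i$, $r_i^2=e$, $(r_ir_{i+1})^3=e$, $r_ir_j=zr_jr_i$ for $|i-j|\ge 2$. It is a double cover of $\mathfrak{S}_n$ via $\Phi(z)=e$, $\Phi(r_i)=(i\ i{+}1)$, and $\widetilde{\mathfrak{S}}_n\subset\widetilde{\mathfrak{S}}_{n+1}$ by identifying generators; $\widetilde{\mathfrak{S}}_\infty=\bigcup_n\widetilde{\mathfrak{S}}_n$. For $1\le i<j$ put $[i\ j]=z^{j-i-1}r_{j-1}\cdots r_{i+1}r_ir_{i+1}\cdots r_{j-1}$ and $[j\ i]=z[i\ j]$; for distinct $i_1,\dots,i_p$ put $[i_1\ \cdots\ i_p]=[i_{p-1}\ i_p]\cdots[i_2\ i_p][i_1\ i_p]$ (equal to $e$ if $p=1$). Spin irreducible representations. An irreducible complex representation of $\widetilde{\mathfrak{S}}_n$ is spin if $z$ acts as $-1$; $(\widetilde{\mathfrak{S}}_n)^\wedge_{\mathrm{spin}}$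 is the set of equivalence classes of these. $\mathcal{SP}_n$ is the set of strict partitions of $n$ (distinct parts); $\mathcal{OP}_n$ the set of partitions of $n$ with all parts odd; $l(\cdot)$ is the number of parts; $\epsilon(\lambda)\in\{0,1\}$ is the parity of $n-l(\lambda)$. The elements of $(\widetilde{\mathfrak{S}}_n)^\wedge_{\mathrm{spin}}$ are labelled by pairs $(\lambda,\gamma)$, $\lambda\in\mathcal{SP}_n$, $\gamma\in\{1,-1\}$, where $(\lambda,1)=(\lambda,-1)$ if $\epsilon(\lambda)=0$, and $(\lambda,1)\ne(\lambda,-1)$ with $(\lambda,-1)=\mathrm{sgn}\cdot(\lambda,1)$ if $\epsilon(\lambda)=1$. The character $\chi^{(\lambda,\gamma)}$ is determined on odd-type elements by Schur's formula $Q_\lambda=\sum_{\rho\in\mathcal{OP}_n}2^{(l(\lambda)+l(\rho)+\epsilon(\lambda))/2}z_\rho^{-1}\chi^{(\lambda,\gamma)}([\rho])\,p_\rho$, where $Q_\lambda$ is Schur's $Q$-function, $p_\rho$ the power sum, $z_\rho=\prod_j j^{m_j(\rho)}m_j(\rho)!$ and $[\rho]=[1\cdots\rho_1][\rho_1{+}1\cdots\rho_1{+}\rho_2]\cdots$. Positive-definite functions. A spin normalized central positive-definite function on $\widetilde{\mathfrak{S}}_n$ is a positive-definite $f:\widetilde{\mathfrak{S}}_n\to\mathbb{C}$ with $f(e)=1$, $f(xy)=f(yx)$, $f(zx)=-f(x)$. These correspond bijectively to probabilities $M$ on $(\widetilde{\mathfrak{S}}_n)^\wedge_{\mathrm{spin}}$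 via $f(x)=\sum_{\xi}M(\{\xi\})\chi^\xi(x)/\dim\xi$. Approximate factorization property. For $x\in\widetilde{\mathfrak{S}}_n$, $\mathrm{supp}\,x$ is the set of letters not fixed by $\Phi(x)$, and the type of $x$ is the cycle type of $\Phi(x)$, written $(\rho,1^{n-|\rho|})$ with $\rho$ a partition without parts equal to $1$. The property for $\{f^{(n)}\}$: for all $x,y\in\widetilde{\mathfrak{S}}_\infty\setminus\{e\}$ with $\mathrm{supp}\,x\cap\mathrm{supp}\,y=\varnothing$ and types $(\rho,1^{n-|\rho|})$, $(\sigma,1^{n-|\sigma|})$, where all parts of $\rho,\sigma$ are odd and $\ge3$, one has $f^{(n)}(xy)-f^{(n)}(x)f^{(n)}(y)=o\bigl(n^{-\frac12(|\rho|-l(\rho)+|\sigma|-l(\sigma))}\bigr)$ as $n\to\infty$. Random walk. The Res-Ind chain on $(\widetilde{\mathfrak{S}}_n)^\wedge_{\mathrm{spin}}$ has transition matrix $P^{(n)}_{\xi\eta}=\sum_{\zeta\in(\widetilde{\mathfrak{S}}_{n-1})^\wedge_{\mathrm{spin}}}\frac{c_{\zeta,\xi}\dim\zeta}{\dim\xi}\cdot\frac{c_{\zeta,\eta}\dim\eta}{n\dim\zeta}$, where $c_{\zeta,\xi}$ is the multiplicity of $\zeta$ in the restriction of $\xi$ to $\widetilde{\mathfrak{S}}_{n-1}$. Let $(Z^{(n)}_k)_{k\ge0}$ be the Markov chain with this transition matrix and initial distribution $M^{(n)}_0$, and $(\tau_j)_{j\ge1}$ i.i.d. with distribution $\psi$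 on $[0,\infty)$, $\psi((0,\infty))>0$, independent of $(Z^{(n)}_k)$. Let $N_s=j$ if $\tau_1+\cdots+\tau_j\le s<\tau_1+\cdots+\tau_{j+1}$ and $N_s=0$ if $s<\tau_1$, with $N_0=0$ a.s. Then $X^{(n)}_s=Z^{(n)}_{N_s}$. Limit shapes. Under the hypotheses it is known that $\omega_t$ exists, and that $\mathfrak{m}_{\omega_t}$ is the unique probability on $\mathbb{R}$ with free cumulants $R_1=0$, $R_2=1$, $R_{k+1}=r_{k+1}e^{-kt/m}$ ($k\ge2$), where free cumulants $(R_k)$ and moments $(M_j)$ of a probability are related by $M_j=\sum_\pi\prod_{v\in\pi}R_{|v|}$, $\pi$ running over noncrossing partitions of $\{1,\dots,j\}$ and $v$ over blocks; these identities define the displayed free compression $\mu_c$ ($R_k(\mu_c)=c^{k-1}R_k(\mu)$) and free convolution ($R_k(\mu\boxplus\nu)=R_k(\mu)+R_k(\nu)$). Diagrams. For $\lambda\in\mathcal{SP}_n$, $D(\lambda)$ is the Young diagram with $2n$ boxes whose Frobenius coordinates are $(\lambda_1-1,\dots,\lambda_l-1\,|\,\lambda_1,\dots,\lambda_l)$ (arms $|$ legs). If $x_1<y_1<\cdots<y_{r-1}<x_r$ are its interlacing coordinates ($x_i$: contents, i.e. column minus row, of addable boxes; $y_i$: contents of removable boxes), its profile is $D(\lambda)(x)=\sum_i|x-x_i|-\sum_i|x-y_i|$; $D(\lambda)^{s}(x)=s^{-1}D(\lambda)(sx)$. A continuous diagram is a $1$-Lipschitz $\omega:\mathbb{R}\to\mathbb{R}$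 with $\int_{-\infty}^{-1}(1+\omega'(x))\frac{dx}{|x|}<\infty$, $\int_1^\infty(1-\omega'(x))\frac{dx}{x}<\infty$. With $F=(1+\omega')/2$, its transition measure $\mathfrak{m}_\omega$ is the probability on $\mathbb{R}$ with $\int\frac{\mathfrak{m}_\omega(dx)}{\zeta-x}=\frac1\zeta\exp\bigl(-\int_{-\infty}^0\frac{F(x)}{\zeta-x}dx+\int_0^\infty\frac{1-F(x)}{\zeta-x}dx\bigr)$; the additive constant of $\omega$ is normalized by $\omega(x)-|x|\to0$ as $|x|\to\infty$. *)

(* Defs.v *)
From HB Require Import structures.
From mathcomp Require Import all_boot all_order all_algebra all_fingroup.
From mathcomp Require Import mxrepresentation complex.
From mathcomp Require Import all_classical all_reals all_analysis.
From mathcomp Require Import zify.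

Set Implicit Arguments.
Unset Strict Implicit.
Unset Printing Implicit Defensive.

Import Order.TTheory GRing.Theory Num.Theory.
Import numFieldNormedType.Exports.

(* The group is built as words in the generators modulo the congruence
   generated by the relations; its finiteness follows from the normal forms
   computed in this section. *)
Section NormalForms.
Local Open Scope group_scope.
Variables (G : groupType) (N : nat) (z : G) (r : nat -> G).
Hypothesis zz : z * z = 1.
Hypothesis rz : forall i, r i * z = z * r i.
Hypothesis rr : forall i, 0 < i <= N -> r i * r i = 1.
Hypothesis braid : forall i, 0 < i < N -> (r i * r i.+1) ^+ 3 = 1.
Hypothesis far : forall i j, 0 < i <= N -> 0 < j <= N ->
  (i.+1 < j) || (j.+1 < i) -> r i * r j = z * (r j * r i).

Fixpoint desc (k m : nat) : G :=
  if m is m'.+1 then desc k m' * r (k - m') else 1.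

Fixpoint normal_forms (k : nat) : seq G :=
  if k is k'.+1
  then [seq u * desc k'.+1 m | u <- normal_forms k', m <- iota 0 k'.+2]
  else [:: 1; z].

Let descS k m : desc k m.+1 = desc k m * r (k - m). Proof. by []. Qed.

Let zC m x : z ^+ m * r x = r x * z ^+ m.
Proof.
by elim: m => [|m IH]; rewrite ?expg0 ?mul1g ?mulg1 // expgS -mulgA IH !mulgA rz.
Qed.

Let descz k m : desc k m * z = z * desc k m.
Proof.
by elim: m => [|m IH] /=; rewrite ?mul1g ?mulg1 // -mulgA rz !mulgA IH.
Qed.

Let braid' i : 0 < i < N -> r i.+1 * (r i * r i.+1) = r i * (r i.+1 * r i).
Proof.
move=> iN; have r1 : r i * r i = 1 by apply: rr; lia.
have r2 : r i.+1 * r i.+1 = 1 by apply: rr; lia.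
have e : (r i * r i.+1) * (r i * r i.+1) = r i.+1 * r i.
  apply: (mulIg (r i * r i.+1)).
  have -> : r i.+1 * r i * (r i * r i.+1) = 1.
    by rewrite -mulgA (mulgA (r i)) r1 mul1g r2.
  by rewrite -(braid iN) !expgSr expg0 mul1g.
by rewrite -[LHS]mul1g -{1}r1 -e -!mulgA.
Qed.

Let desc_low k m i : 0 < i -> k <= N -> i + m < k ->
  desc k m * r i = z ^+ m * (r i * desc k m).
Proof.
move=> i0 kN; elim: m => [|m IH] imk; first by rewrite expg0 !mul1g mulg1.
rewrite descS -mulgA far; [|lia|lia|apply/orP; right; lia].
rewrite mulgA descz -mulgA (mulgA (desc k m)) IH; last lia.
by rewrite expgS -!mulgA.
Qed.

Let desc_high k m i : 0 < i -> k <= N -> m <= k -> k < i + m.-1 -> i <= k ->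
  desc k m * r i = z ^+ m * (r i.-1 * desc k m).
Proof.
case: i => // i _ kN; elim: m => [|m IH] mk kim ik; first lia.
rewrite /= in kim.
have [ikm|ikm] := eqVneq i (k - m).
  case: m IH mk kim ikm => [|m] _ mk kim ikm; first lia.
  have ikm' : k - m = i.+1 by lia.
  have -> : z ^+ m.+2 = z ^+ m by rewrite !expgS mulgA zz mul1g.
  rewrite !descS -ikm ikm' -!mulgA braid'; last lia.
  rewrite [LHS]mulgA desc_low; [|lia|lia|lia].
  by rewrite -!mulgA.
rewrite descS -mulgA far; [|lia|lia|apply/orP; left; lia].
rewrite mulgA descz -mulgA (mulgA (desc k m)) IH; [|lia|lia|lia].
by rewrite expgS -!mulgA.
Qed.

Let memP k g : reflect
    (exists2 um, um.1 \in normal_forms k /\ um.2 <= k.+1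
      & g = um.1 * desc k.+1 um.2)
    (g \in normal_forms k.+1).
Proof.
apply: (iffP allpairsP) => [[um [u_in m_in ->]]|[um [u_in m_in] ->]].
  by exists um => //; split=> //; move: m_in; rewrite mem_iota.
by exists um; split=> //; rewrite mem_iota.
Qed.

Lemma normal_forms_z k g : g \in normal_forms k -> g * z \in normal_forms k.
Proof.
elim: k g => [|k IH] g.
  by rewrite !inE => /orP[] /eqP->; rewrite ?mul1g ?zz eqxx ?orbT.
case/memP=> -[u m] /= [uL mI] ->; rewrite -mulgA descz mulgA.
by apply/memP; exists (u * z, m) => //; split=> //; apply: IH.
Qed.

Lemma normal_forms_zX k g m :
  g \in normal_forms k -> g * z ^+ m \in normal_forms k.
Proof.
elim: m g => [|m IH] g gL; first by rewrite expg0 mulg1.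
by rewrite expgS mulgA; apply/IH/normal_forms_z.
Qed.

Lemma normal_forms_r k i g : 0 < i <= k -> k <= N ->
  g \in normal_forms k -> g * r i \in normal_forms k.
Proof.
elim: k i g => [|k IH] i g ik kN; first lia.
case/memP => -[u m]; rewrite [_.1]/= [_.2]/= => -[uL mI] ->.
have mem v m' : v \in normal_forms k -> m' <= k.+1 ->
    v * desc k.+1 m' \in normal_forms k.+1.
  by move=> vL m'k; apply/memP; exists (v, m').
rewrite -mulgA.
have [im|im] := eqVneq i (k.+1 - m).
  have -> : desc k.+1 m * r i = desc k.+1 m.+1 by rewrite /= -im.
  by apply: mem => //; lia.
have [im'|im'] := eqVneq i (k.+1 - m).+1.
  case: m mI im im' => [|m] mI im im'; first lia.
  have -> : desc k.+1 m.+1 * r i = desc k.+1 m.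
    have mi : k.+1 - m = i by lia.
    by rewrite /= mi -mulgA rr ?mulg1 //; lia.
  by apply: mem => //; lia.
have [lo|hi] := ltnP i (k.+1 - m).
  rewrite desc_low; [|lia|lia|lia].
  rewrite !mulgA -(mulgA u); apply: mem; last lia.
  rewrite mulgA; apply: IH; [lia|lia|exact: normal_forms_zX].
rewrite desc_high; [|lia|lia|lia|lia|lia].
rewrite !mulgA -(mulgA u); apply: mem; last lia.
rewrite mulgA; apply: IH; [lia|lia|exact: normal_forms_zX].
Qed.

Lemma normal_forms_1 k : 1 \in normal_forms k.
Proof.
elim: k => [|k IH]; first by rewrite !inE eqxx.
by apply/memP; exists (1, 0) => //=; rewrite mulg1.
Qed.

End NormalForms.

(* None is z and Some i is r_(i+1). All generators are involutions, so words
   without inverses suffice. *)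
Definition spin_word n := seq (option 'I_n.-1).

Inductive spin_relator n : spin_word n -> spin_word n -> Prop :=
| Spin_zz : spin_relator [:: None; None] [::]
| Spin_rz i : spin_relator [:: Some i; None] [:: None; Some i]
| Spin_rr i : spin_relator [:: Some i; Some i] [::]
| Spin_braid (i j : 'I_n.-1) : j = i.+1 :> nat ->
    spin_relator [:: Some i; Some j; Some i; Some j; Some i; Some j] [::]
| Spin_far (i j : 'I_n.-1) : (i.+1 < j) || (j.+1 < i) ->
    spin_relator [:: Some i; Some j] [:: None; Some j; Some i].

Inductive spin_cong n : spin_word n -> spin_word n -> Prop :=
| Spin_step u s t v : spin_relator s t -> spin_cong (u ++ s ++ v) (u ++ t ++ v)
| Spin_refl w : spin_cong w w
| Spin_sym v w : spin_cong v w -> spin_cong w v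
| Spin_trans u v w : spin_cong u v -> spin_cong v w -> spin_cong u w.

Definition spin_congb n (v w : spin_word n) : bool := `[< spin_cong v w >].

Lemma spin_congb_refl n : reflexive (@spin_congb n).
Proof. by move=> w; apply/asboolP/Spin_refl. Qed.

Lemma spin_congb_sym n : symmetric (@spin_congb n).
Proof. by move=> v w; apply/asboolP/asboolP => /Spin_sym. Qed.

Lemma spin_congb_trans n : transitive (@spin_congb n).
Proof.
by move=> v u w /asboolP uv /asboolP vw; apply/asboolP/(Spin_trans uv vw).
Qed.

Canonical spin_congb_equiv n :=
  EquivRel (@spin_congb n) (@spin_congb_refl n) (@spin_congb_sym n)
    (@spin_congb_trans n).

Definition spin_sym n : Type := {eq_quot @spin_congb_equiv n}%qT.

Section SpinGroup.
Variable n : nat.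
Local Open Scope quotient_scope.
Implicit Types (u v w : spin_word n).

HB.instance Definition _ := Choice.on (spin_sym n).
HB.instance Definition _ := EqQuotient.on (spin_sym n).

Local Notation repr := generic_quotient.repr.

Definition spin_class w : spin_sym n := \pi_(spin_sym n) w.

Lemma spin_classP v w : spin_cong v w <-> spin_class v = spin_class w.
Proof.
split=> [vw|/eqP]; first by apply/eqP; rewrite eqmodE; apply/asboolP.
by rewrite eqmodE => /asboolP.
Qed.

Lemma spin_class_repr (x : spin_sym n) : spin_class (repr x) = x.
Proof. exact: reprK. Qed.

Lemma spin_cong_catl u v w : spin_cong v w -> spin_cong (u ++ v) (u ++ w).
Proof.
elim=> {v w} [a s t b st|w|v w _|v w x _ vw _ wx].
- by rewrite !(catA u); apply: Spin_step.
- exact: Spin_refl.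
- exact: Spin_sym.
- exact: Spin_trans vw wx.
Qed.

Lemma spin_cong_catr u v w : spin_cong v w -> spin_cong (v ++ u) (w ++ u).
Proof.
elim=> {v w} [a s t b st|w|v w _|v w x _ vw _ wx].
- by rewrite -!catA; apply: Spin_step.
- exact: Spin_refl.
- exact: Spin_sym.
- exact: Spin_trans vw wx.
Qed.

Definition spin_mul (x y : spin_sym n) := spin_class (repr x ++ repr y).
Definition spin_inv (x : spin_sym n) := spin_class (rev (repr x)).

Lemma spin_mulE v w : spin_mul (spin_class v) (spin_class w) = spin_class (v ++ w).
Proof.
apply/spin_classP; apply: (@Spin_trans _ _ (v ++ repr (spin_class w))).
  by apply/spin_cong_catr/spin_classP; rewrite spin_class_repr.
by apply/spin_cong_catl/spin_classP; rewrite spin_class_repr.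
Qed.

Lemma spin_mulA : associative spin_mul.
Proof.
move=> x y t; rewrite -(spin_class_repr x) -(spin_class_repr y).
by rewrite -(spin_class_repr t) !spin_mulE catA.
Qed.

Lemma spin_mul1 : left_id (spin_class [::]) spin_mul.
Proof. by move=> x; rewrite -(spin_class_repr x) spin_mulE. Qed.

Lemma spin_1mul : right_id (spin_class [::]) spin_mul.
Proof. by move=> x; rewrite -(spin_class_repr x) spin_mulE cats0. Qed.

Lemma spin_cancel w : spin_cong (w ++ rev w) [::].
Proof.
elim: w => [|a w IH]; first exact: Spin_refl.
have -> : (a :: w) ++ rev (a :: w) = [:: a] ++ (w ++ rev w) ++ [:: a].
  by rewrite rev_cons -cats1 /= -catA.
apply: (@Spin_trans _ _ ([:: a] ++ [::] ++ [:: a])).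
  by apply/spin_cong_catl/spin_cong_catr.
case: a => [i|].
  exact: (@Spin_step n [::] [:: Some i; Some i] [::] [::] (Spin_rr i)).
exact: (@Spin_step n [::] [:: None; None] [::] [::] (Spin_zz n)).
Qed.

Lemma spin_mulV : right_inverse (spin_class [::]) spin_inv spin_mul.
Proof.
move=> x; rewrite -{1}(spin_class_repr x) spin_mulE.
exact/spin_classP/spin_cancel.
Qed.

Lemma spin_Vmul : left_inverse (spin_class [::]) spin_inv spin_mul.
Proof.
move=> x; rewrite -{2}(spin_class_repr x) spin_mulE.
by apply/spin_classP; rewrite -{2}(revK (repr x)); apply: spin_cancel.
Qed.

HB.instance Definition _ := isGroup.Build (spin_sym n)
  spin_mulA spin_mul1 spin_1mul spin_Vmul spin_mulV.

Local Open Scope group_scope.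

Definition spin_z : spin_sym n := spin_class [:: None].

(* r_k for 1 <= k <= n-1 (one-based, as in the presentation), 1 otherwise *)
Definition spin_r (k : nat) : spin_sym n :=
  if k is k'.+1 then
    if insub k' is Some i then spin_class [:: Some i] else 1
  else 1.

Lemma spin_rS (i : 'I_n.-1) : spin_r i.+1 = spin_class [:: Some i].
Proof. by rewrite /spin_r valK. Qed.

Lemma spin_class_mul v w : spin_class v * spin_class w = spin_class (v ++ w).
Proof. exact: spin_mulE. Qed.

Let rel v w : spin_relator v w -> spin_class v = spin_class w.
Proof.
by move=> vw; apply/spin_classP; rewrite -[v]cats0 -[w]cats0;
   apply: (@Spin_step n [::] _ _ [::]).
Qed.

Lemma spin_r_out k : ~~ (0 < k <= n.-1) -> spin_r k = 1.
Proof. by case: k => // k kn; rewrite /spin_r insubN. Qed.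

Lemma spin_zz : spin_z * spin_z = 1.
Proof. by rewrite spin_class_mul; apply/rel/Spin_zz. Qed.

Let ordP k : 0 < k <= n.-1 -> exists i : 'I_n.-1, k = i.+1.
Proof. by case: k => // k kn; exists (Ordinal (kn : k < n.-1)). Qed.

Lemma spin_rz k : spin_r k * spin_z = spin_z * spin_r k.
Proof.
have [/ordP[i ->]|/spin_r_out->] := boolP (0 < k <= n.-1).
  by rewrite spin_rS !spin_class_mul; apply/rel/Spin_rz.
by rewrite mul1g mulg1.
Qed.

Lemma spin_rr k : 0 < k <= n.-1 -> spin_r k * spin_r k = 1.
Proof. by move=> /ordP[i ->]; rewrite spin_rS spin_class_mul; apply/rel/Spin_rr. Qed.

Lemma spin_braid k : 0 < k < n.-1 -> (spin_r k * spin_r k.+1) ^+ 3 = 1.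
Proof.
move=> kn; have /ordP[i iE] : 0 < k <= n.-1 by lia.
have /ordP[j jE] : 0 < k.+1 <= n.-1 by lia.
have e3 (x : spin_sym n) : x ^+ 3 = x * x * x by rewrite !expgSr expg0 mul1g.
rewrite e3 jE iE !spin_rS !spin_class_mul.
have ij : j = i.+1 :> nat by lia.
exact: (rel (Spin_braid ij)).
Qed.

Lemma spin_far j k : 0 < j <= n.-1 -> 0 < k <= n.-1 ->
  (j.+1 < k) || (k.+1 < j) -> spin_r j * spin_r k = spin_z * (spin_r k * spin_r j).
Proof.
move=> /ordP[i1 ->] /ordP[i2 ->] jk; rewrite !spin_rS !spin_class_mul.
exact: (rel (Spin_far jk)).
Qed.

Definition spin_enum := undup (normal_forms spin_z spin_r n.-1).

Lemma spin_enumP : Finite.axiom spin_enum.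
Proof.
move=> x; rewrite count_uniq_mem ?undup_uniq // mem_undup -[x]spin_class_repr.
elim/last_ind: (repr x) => [|w a]; first by rewrite normal_forms_1.
case wL: (_ \in _) => // _; rewrite -cats1 -spin_class_mul; apply/eqP; rewrite eqb1.
case: a => [i|]; last exact: (normal_forms_z spin_zz spin_rz).
rewrite -spin_rS.
apply: (normal_forms_r spin_zz spin_rz spin_rr spin_braid spin_far) => //.
by rewrite ltn_ord.
Qed.

Let pickleK : pcancel (index^~ spin_enum) (nth None (map Some spin_enum)).
Proof.
move=> x; have xL : x \in spin_enum by rewrite -has_pred1 has_count spin_enumP.
by rewrite (nth_map 1) ?nth_index // index_mem.
Qed.

HB.instance Definition _ := isCountable.Build (spin_sym n) pickleK.
HB.instance Definition _ := fintype.isFinite.Build (spin_sym n) spin_enumP.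

Definition spin_transp_lt (i j : nat) : spin_sym n :=
  spin_z ^+ (j - i.+1) * (\prod_(k <- rev (index_iota i.+1 j)) spin_r k)
  * \prod_(k <- index_iota i j) spin_r k.

Definition spin_transp (i j : nat) : spin_sym n :=
  if i < j then spin_transp_lt i j else spin_z * spin_transp_lt j i.

(* [i_1 ... i_p] = [i_(p-1) i_p] ... [i_1 i_p] *)
Definition spin_cycle (s : seq nat) : spin_sym n :=
  if s is i :: s' then
    \prod_(a <- rev (belast i s')) spin_transp a (last i s')
  else 1.

(* [1 .. rho_1][rho_1+1 .. rho_1+rho_2] ..., the first cycle starting at a *)
Fixpoint spin_of_type_from (a : nat) (rho : seq nat) : spin_sym n :=
  if rho is k :: rho' then
    spin_cycle (iota a k) * spin_of_type_from (a + k) rho'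
  else 1.

Definition spin_of_type := spin_of_type_from 1.

Let ord_lt (i : 'I_n.-1) : i < n. Proof. by case: i => i /=; lia. Qed.
Let ord_succ_lt (i : 'I_n.-1) : i.+1 < n. Proof. by case: i => i /=; lia. Qed.

(* The covering map, with the letters 1, ..., n coded as 0, ..., n-1. *)
Definition spin_perm (x : spin_sym n) : 'S_n :=
  \prod_(a <- repr x)
    if a is Some i then tperm (Ordinal (ord_lt i)) (Ordinal (ord_succ_lt i))
    else 1.

Definition spin_supp (x : spin_sym n) : {set 'I_n} :=
  [set i | spin_perm x i != i].

(* The cycle type without the parts equal to 1 *)
Definition spin_type (x : spin_sym n) : seq nat :=
  [seq k <- [seq #|A| | A : {set 'I_n} <- enum (porbits (spin_perm x))] | 1 < k].

End SpinGroup.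

Section SpinInclusion.
Local Open Scope group_scope.

Lemma spin_eval_cong n (H : groupType) (f : option 'I_n.-1 -> H) :
    (forall v w, spin_relator v w -> \prod_(a <- v) f a = \prod_(a <- w) f a) ->
  forall v w, spin_cong v w -> \prod_(a <- v) f a = \prod_(a <- w) f a.
Proof.
move=> f_rel v w; elim=> {v w} // [u s t v st|u v w _ -> _ ->] //.
by rewrite !big_cat /= (f_rel _ _ st).
Qed.

(* The inclusion of the group on m letters in the group on n >= m letters. *)
Definition spin_incl m n (x : spin_sym m) : spin_sym n :=
  \prod_(a <- generic_quotient.repr x)
    if a is Some i then spin_r n i.+1 else spin_z n.

Lemma spin_inclM m n : m <= n -> {morph @spin_incl m n : x y / x * y}.
Proof.
move=> mn x y; rewrite /spin_incl -big_cat.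
apply: spin_eval_cong; last by apply/spin_classP; rewrite spin_class_repr.
have le (i : 'I_m.-1) : 0 < i.+1 <= n.-1 by case: i => i /=; lia.
move=> v w [|i|i|i j ij|i j ij]; rewrite ?big_cons ?big_nil ?mulg1 ?mulg1.
- exact: spin_zz.
- exact: spin_rz.
- exact: spin_rr.
- rewrite ij -[RHS](@spin_braid n i.+1); last first.
    by have := le j; rewrite ij.
  by rewrite !expgS expg0 mulg1 !mulgA.
- exact: spin_far.
Qed.

Lemma spin_incl1 m n : m <= n -> spin_incl n (1 : spin_sym m) = 1.
Proof.
by move=> mn; apply: (mulgI (spin_incl n (1 : spin_sym m))); rewrite -spin_inclM // !mulg1.
Qed.

End SpinInclusion.

Local Open Scope ring_scope.

(* R[i] as a numClosedFieldType, which carries its topology. *)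
Definition Cplx (R : realType) : numClosedFieldType := R[i]%C.

Section MainDefs.
Variable R : realType.
Local Notation C := (Cplx R).

Definition RtoC (x : R) : C := Complex x 0.
Definition ReC (w : C) : R := complex.Re w.
Definition ImC (w : C) : R := complex.Im w.
Definition absC (w : C) : R := ReC `|w|.
Definition expC (w : C) : C :=
  Complex (expR (ReC w) * cos (ImC w)) (expR (ReC w) * sin (ImC w)).

Section SpinDual.
Variable n : nat.

(* All irreducible complex representations, up to equivalence *)
Definition spin_irr : irrType C [set: spin_sym n]%SET :=
  DecSocleType (regular_repr C [set: spin_sym n]%SET).

Definition spin_dual : Type :=
  {i : spin_irr | irr_repr i (spin_z n) == (-1)%:M}.

HB.instance Definition _ := Finite.on spin_dual.

Definition spin_rep (xi : spin_dual) := irr_repr (val xi).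
Definition spin_dim (xi : spin_dual) : nat := irr_degree (val xi).
Definition spin_char (xi : spin_dual) (x : spin_sym n) : C :=
  \tr (spin_rep xi x).

Definition spin_central_pd (f : spin_sym n -> C) : Prop :=
  [/\ f 1%g = 1,
      forall x y, f (x * y)%g = f (y * x)%g,
      forall x, f (spin_z n * x)%g = - f x
    & forall c : spin_sym n -> C,
        0 <= \sum_x \sum_y (c x)^* * c y * f (x^-1 * y)%g].

Definition is_prob_mass (T : finType) (M : T -> R) : Prop :=
  (forall i, 0 <= M i) /\ \sum_i M i = 1.

Definition spin_mixture (M : spin_dual -> R) (x : spin_sym n) : C :=
  \sum_xi RtoC (M xi) * (spin_char xi x / (spin_dim xi)%:R).

Definition strict_partition (la : seq nat) : bool :=
  [&& sorted gtn la, 0%N \notin la & sumn la == n].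

Definition odd_partition (rho : seq nat) : bool :=
  [&& sorted geq rho, all odd rho & sumn rho == n].

(* Schur's Q-function in N >= l(la) variables, evaluated at a point with
   distinct coordinates: the Hall-Littlewood function at parameter -1. The sum
   over cosets of the stabilizer of x^la is written as an average over 'S_N. *)
Definition schurQ N (la : seq nat) (x : 'I_N -> C) : C :=
  2 ^+ size la / ((N - size la)`!)%:R *
  \sum_(w : 'S_N)
    (\prod_(i < N) x (w i) ^+ nth 0%N la i) *
    \prod_(i < N | (i < size la)%N) \prod_(j < N | (i < j)%N)
      ((x (w i) + x (w j)) / (x (w i) - x (w j))).

Definition power_sum N (k : nat) (x : 'I_N -> C) : C := \sum_(i < N) x i ^+ k.

Definition z_part (rho : seq nat) : nat :=
  (\prod_(1 <= j < n.+1) (j ^ count_mem j rho * (count_mem j rho)`!))%N.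

Definition parity (la : seq nat) : nat := odd (n - size la).

(* Schur's formula; both sides are symmetric functions, and they are compared
   by their values in every large enough number of variables. Partitions of n
   are enumerated as sequences of length at most n with entries at most n. The
   exponent of 2 is an integer, as l(rho), n and l(la) + parity la are congruent
   modulo 2. *)
Definition spin_label (xi : spin_dual) (la : seq nat) : Prop :=
  strict_partition la /\
  forall N (x : 'I_N -> C), (size la <= N)%N -> injective x ->
    schurQ la x =
    \sum_(rho : {bseq n of 'I_n.+1} | odd_partition (map val rho))
      2 ^+ ((size la + size rho + parity la)./2)
      / (z_part (map val rho))%:R
      * spin_char xi (spin_of_type n (map val rho))
      * \prod_(k <- map val rho) power_sum k x.

End SpinDual.

Section Restriction.
Variables (n d : nat) (rG : mx_representation C [set: spin_sym n]%SET d).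

Lemma spin_res_repr : mx_repr [set: spin_sym n.-1]%SET (rG \o @spin_incl n.-1 n).
Proof.
split=> [|x y _ _] /=; first by rewrite spin_incl1 ?leq_pred // repr_mx1.
by rewrite spin_inclM ?leq_pred // repr_mxM ?inE.
Qed.

Definition spin_res : mx_representation C [set: spin_sym n.-1]%SET d :=
  MxRepresentation spin_res_repr.

End Restriction.

(* Multiplicity of zeta in the restriction of xi *)
Definition res_mult n (zeta : spin_dual n.-1) (xi : spin_dual n) : nat :=
  (\sum_(W : DecSocleType (spin_res (spin_rep xi))
         | irr_comp (spin_irr n.-1) (socle_repr W) == val zeta) socle_mult W)%N.

Definition res_ind n (xi eta : spin_dual n) : R :=
  \sum_(zeta : spin_dual n.-1)
    ((res_mult zeta xi * spin_dim zeta)%:R / (spin_dim xi)%:R)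
    * ((res_mult zeta eta * spin_dim eta)%:R / (n * spin_dim zeta)%:R).

Definition odd_type n (x : spin_sym n) : bool :=
  all (fun k => odd k && (2 < k)%N) (spin_type x).

Definition type_length n (x : spin_sym n) : nat :=
  (sumn (spin_type x) - size (spin_type x))%N.

(* Elements of the infinite group are elements of some finite level N. *)
Definition approx_factorization (f : forall n, spin_sym n -> C) : Prop :=
  forall N (x y : spin_sym N), x <> 1%g -> y <> 1%g ->
    spin_supp x :&: spin_supp y = finset.set0 -> odd_type x -> odd_type y ->
    ((fun n => f n (spin_incl n (x * y)%g)
              - f n (spin_incl n x) * f n (spin_incl n y) : C^o)
    =o_\oo (fun n => RtoC (n%:R `^ (- ((type_length x + type_length y)%:R / 2)))
                     : C^o))%classic.

Section Process.
Variables (d : measure_display) (Om : measurableType d) (P : probability Om R).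
Local Open Scope classical_set_scope.

Definition markov_chain (T : finType) (init : T -> R) (Q : T -> T -> R)
    (Z : nat -> Om -> T) : Prop :=
  (forall k i, measurable (Z k @^-1` [set i])) /\
  forall k (p : nat -> T),
    P (\bigcap_(i < k.+1) Z i @^-1` [set p i]) =
    (init (p 0%N) * \prod_(i < k) Q (p i) (p i.+1))%:E.

Definition iid_pauses (psi : probability (measurableTypeR R) R)
    (tau : nat -> Om -> measurableTypeR R) : Prop :=
  [/\ forall j, measurable_fun setT (tau j),
      forall j w, (0 : R) <= tau j w
    & forall J (B : nat -> set (measurableTypeR R)),
        (forall j, measurable (B j)) ->
        P (\bigcap_(j < J) tau j @^-1` B j) = (\prod_(j < J) fine (psi (B j)))%:E].

Definition independent_families (T : finType) (Z : nat -> Om -> T)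
    (tau : nat -> Om -> measurableTypeR R) : Prop :=
  forall k (p : nat -> T) J (B : nat -> set (measurableTypeR R)),
    (forall j, measurable (B j)) ->
    P ((\bigcap_(i < k) Z i @^-1` [set p i])
       `&` (\bigcap_(j < J) tau j @^-1` B j)) =
    (P (\bigcap_(i < k) Z i @^-1` [set p i])
     * P (\bigcap_(j < J) tau j @^-1` B j))%E.

(* tau 0, tau 1, ... are the pausing times tau_1, tau_2, ... *)
Definition arrival (tau : nat -> Om -> R) (j : nat) (w : Om) : R :=
  \sum_(i < j) tau i w.

(* The j with S_j <= s < S_(j+1) is unique when the pausing times are
   nonnegative; 0 when there is none, an event of probability 0. *)
Definition jump_count (tau : nat -> Om -> R) (s : R) (w : Om) : nat :=
  xget 0%N [set j | arrival tau j w <= s < arrival tau j.+1 w].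

Definition walk (T : Type) (Z : nat -> Om -> T) (tau : nat -> Om -> R)
    (s : R) (w : Om) : T :=
  Z (jump_count tau s w) w.

Definition law (T : finType) (X : Om -> T) (i : T) : R :=
  fine (P (X @^-1` [set i])).

End Process.

Definition char_fun (psi : probability (measurableTypeR R) R) (u : R) : C :=
  Complex (\int[psi]_x cos (u * x)) (\int[psi]_x sin (u * x)).

(* Rows and columns are numbered from 0; a are the arms, b the legs. *)
Definition frobenius_diagram (a b : seq nat) (i j : nat) : bool :=
  [&& minn i j < size a, minn i j < size b,
      j - i <= nth 0 a (minn i j) & i - j <= nth 0 b (minn i j)]%N.

Definition addable (Y : nat -> nat -> bool) (i j : nat) : bool :=
  [&& ~~ Y i j, (i == 0%N) || Y i.-1 j & (j == 0%N) || Y i j.-1].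

Definition removable (Y : nat -> nat -> bool) (i j : nat) : bool :=
  [&& Y i j, ~~ Y i.+1 j & ~~ Y i j.+1].

(* m is a strict bound on the coordinates of addable and removable boxes. *)
Definition profile (m : nat) (Y : nat -> nat -> bool) (x : R) : R :=
  \sum_(i < m) \sum_(j < m | addable Y i j) `|x - (j%:R - i%:R)|
  - \sum_(i < m) \sum_(j < m | removable Y i j) `|x - (j%:R - i%:R)|.

Definition double_diagram (la : seq nat) : nat -> nat -> bool :=
  frobenius_diagram (map predn la) la.

Definition double_profile (la : seq nat) : R -> R :=
  profile (sumn la).*2.+1 (double_diagram la).

Definition rescale (s : R) (w : R -> R) (x : R) : R := s^-1 * w (s * x).

Section ContinuousDiagrams.
Local Open Scope classical_set_scope.
Local Notation leb := (@lebesgue_measure R).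

Definition continuous_diagram (w : R -> R) : Prop :=
  [/\ forall x y, `|w x - w y| <= `|x - y|,
      (\int[leb]_(x in `]-oo, (-1)%R]) ((1 + derive1 w x) / `|x|)%:E < +oo)%E
    & (\int[leb]_(x in `[1%R, +oo[) ((1 - derive1 w x) / x)%:E < +oo)%E].

Definition normalized_diagram (w : R -> R) : Prop :=
  w x - `|x| @[x --> +oo] --> 0 /\ w x - `|x| @[x --> -oo] --> 0.

Definition Cintegral d (T : measurableType d) (mu : {measure set T -> \bar R})
    (D : set T) (f : T -> C) : C :=
  Complex (Rintegral mu D (ReC \o f)) (Rintegral mu D (ImC \o f)).

Definition stieltjes (mu : probability (measurableTypeR R) R) (z : C) : C :=
  Cintegral mu setT (fun x => (z - RtoC x)^-1).

Definition is_transition_measure (w : R -> R)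
    (mu : probability (measurableTypeR R) R) : Prop :=
  let F x := (1 + derive1 w x) / 2 in
  forall z : C, ImC z != 0 ->
    stieltjes mu z =
    z^-1 * expC (- Cintegral leb `]-oo, 0%R] (fun x => RtoC (F x) / (z - RtoC x))
                 + Cintegral leb `[0%R, +oo[
                     (fun x => RtoC (1 - F x) / (z - RtoC x))).

Definition noncrossing j (P : {set {set 'I_j}}) : bool :=
  [forall V in P, forall W in P, (V != W) ==>
    ~~ [exists a in V, exists b in W, exists c in V, exists e in W,
         [&& a < b, b < c & c < e]%N]].

Definition moment (mu : probability (measurableTypeR R) R) (j : nat) : R :=
  \int[mu]_x (x ^+ j).

(* K k is the k-th free cumulant of mu for k >= 1; K 0 is irrelevant. *)
Definition free_cumulants (mu : probability (measurableTypeR R) R)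
    (K : nat -> R) : Prop :=
  (forall j, mu.-integrable setT (fun x => (x ^+ j)%:E)) /\
  forall j, (0 < j)%N ->
    moment mu j =
    \sum_(P : {set {set 'I_j}} | finset.partition P [set: 'I_j]%SET
                                 && noncrossing P)
      \prod_(V in P) K #|V|.

Definition free_compression (c : R)
    (mu nu : probability (measurableTypeR R) R) : Prop :=
  exists K K' : nat -> R,
    [/\ free_cumulants mu K, free_cumulants nu K'
      & forall k, (0 < k)%N -> K' k = c ^+ k.-1 * K k].

Definition free_convolution
    (mu nu ka : probability (measurableTypeR R) R) : Prop :=
  exists K K' K'' : nat -> R,
    [/\ free_cumulants mu K, free_cumulants nu K', free_cumulants ka K''
      & forall k, (0 < k)%N -> K'' k = K k + K' k].

(* The density vanishes outside [-2, 2], where Num.sqrt (4 - x ^+ 2) = 0. *)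
Definition is_semicircle (mu : probability (measurableTypeR R) R) : Prop :=
  forall A : set (measurableTypeR R), measurable A ->
    mu A = (\int[leb]_(x in A) (Num.sqrt (4 - x ^+ 2) / (2 * pi))%:E)%E.

End ContinuousDiagrams.

Definition limit_cumulant (r : nat -> R) (m t : R) (j : nat) : R :=
  if j == 1%N then 0 else if j == 2%N then 1
  else r j * expR (- (j.-1%:R * t / m)).

Definition sup_dist (f g : R -> R) : \bar R :=
  ereal_sup (range (fun x => `|f x - g x|%:E)).

(* The mass of the labels (la, gamma) whose rescaled diagram is at uniform
   distance more than eps from w *)
Definition deviation_mass n (M : spin_dual n -> R) (w : R -> R) (eps : R) : R :=
  \sum_(xi : spin_dual n | `[< exists2 la, spin_label xi la &
      (eps%:E < sup_dist (rescale (Num.sqrt (2 * n)%:R) (double_profile la)) w)%E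
    >]) M xi.

Definition concentrates_on (M : forall n, spin_dual n -> R) (w : R -> R) : Prop :=
  forall eps : R, 0 < eps ->
    ((fun n => deviation_mass (M n) w eps) @ \oo --> (0 : R))%classic.

Definition has_time_derivative (f : R -> C) (t : R) (df : C) : Prop :=
  ((RtoC h)^-1 * (f (t + h) - f t) @[h --> 0^'] --> df)%classic.

End MainDefs.

(* Main.v *)
Require Import Defs.
From HB Require Import structures.
From mathcomp Require Import all_boot all_order all_algebra.
From mathcomp Require Import ring lra.

(** The equation is equivalent to the polynomial one
    [(m / 2) d(G^2)/dt = - G^2 G' + G^2 + G'], where [G' = dG/dz].
    The relation between moments and free cumulants gives it coefficientwise
    for the expansions in [1/z], but these diverge in general: the hypothesis
    on [r] only bounds the [j]-th moment by [L^j j!], uniformly in [t].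
    Such Gevrey expansions, valid uniformly on a half-plane [Im z >= eta] or
    [Im z <= - eta], nevertheless determine the function.  If all coefficients
    vanish, the function decays like [exp (- a |z|)]; in the coordinate [w]
    with [Re w >= 0] on the half-plane, multiply it by the rational functions
    [prod_(k < N) (1 + c w / (w + 2^k))^(2^k)], which are bounded by
    [exp (6 c |w|)] on the line [Re w = 0] for all [N] but tend to infinity
    with [N] where [Re w > 0]: the maximum principle makes the function
    vanish.  A quantitative form of this, applied to
    [(m / 2) (G_s^2 - G_t^2)] minus a Riemann sum of the right-hand side and
    to [G_s - G_t], yields the time derivative of [G^2], hence that of [G]. *)

Set Implicit Arguments.
Unset Strict Implicit.
Unset Printing Implicit Defensive.

Import Order.TTheory GRing.Theory Num.Theory.
Local Open Scope ring_scope.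

(** * Noncrossing partitions *)

(** Differentiability of [G] in time is not given: only the moments are known to be smooth in [t],
    as polynomials in the cumulants. Every statement on [G] in time is therefore passed from
    finitely many coefficients to the function, with constants independent of the function. Riemann
    sums fit this scheme: they are finite combinations with total weight [|s - t|], so their class
    constants do not depend on the mesh. Since [1 / G] is unbounded at infinity, it lies outside the
    class; multiplying the equation by [G] removes it and leaves the time derivative of a square.
    Dividing back is possible because [G] has no zero off the real axis. On coefficients the
    equation is the method of characteristics. Formally, with [R(w) = sum_k K_{k+1} w^k], one has
    [z = R(G) + 1 / G] and [m dR/dt = - w R' + w], where the last term keeps the second cumulant at
    1. The composition [R(G)] is never formed: its role is taken by noncrossing partitions with one
    open block, whose recursion is differentiated in time and in [z] modulo a power of [1 / z]. *)

Lemma noncrossingP N (P : {set {set 'I_N}}) :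
  reflect (forall V W, V \in P -> W \in P -> V != W ->
      forall a b c e, a \in V -> b \in W -> c \in V -> e \in W ->
      (a < b)%N -> (b < c)%N -> (c < e)%N -> False)
    (noncrossing P).
Proof.
apply: (iffP forall_inP) => [ncP V W VP WP VW a b c e aV bW cV eW ab bc ce|ncP V VP].
  move/forall_inP: (ncP V VP) => /(_ W WP) /implyP/(_ VW)/negP; apply.
  apply/exists_inP; exists a => //; apply/exists_inP; exists b => //.
  by apply/exists_inP; exists c => //; apply/exists_inP; exists e => //; apply/and3P.
apply/forall_inP => W WP; apply/implyP => VW; apply/negP.
move=> /exists_inP[a aV /exists_inP[b bW /exists_inP[c cV /exists_inP[e eW]]]].
by move=> /and3P[]; apply: ncP VW _ _ _ _ aV bW cV eW.
Qed.

Lemma noncrossing_sub N (P Q : {set {set 'I_N}}) :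
  Q \subset P -> noncrossing P -> noncrossing Q.
Proof.
move=> /subsetP QP /noncrossingP ncP; apply/noncrossingP => V W /QP VP /QP WP.
exact: ncP.
Qed.

Lemma partitionU (T : finType) (P Q : {set {set T}}) (D E : {set T}) :
  partition P D -> partition Q E -> [disjoint D & E] -> partition (P :|: Q) (D :|: E).
Proof.
move=> /and3P[/eqP <- tP P0] /and3P[/eqP <- tQ Q0] DE.
apply/and3P; split; last by rewrite inE negb_or P0.
  by apply/eqP; rewrite /cover bigcup_setU.
by apply: trivIsetU.
Qed.

Lemma partition_part (T : finType) (P : {set {set T}}) (D E : {set T}) :
  partition P D -> E \subset D ->
  (forall V, V \in P -> (V \subset E) || [disjoint V & E]) ->
  partition (P ::&: E) E.
Proof.
move=> pP ED PE; have /and3P[/eqP cP tP P0] := pP.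
apply/and3P; split; [apply/eqP/setP => x | exact: trivIsetI | ].
  apply/bigcupP/idP => [[V]|xE]; first by rewrite inE => /andP[_ /subsetP]; apply.
  have : x \in cover P by rewrite cP (subsetP ED).
  move=> /bigcupP[V VP xV]; exists V => //; rewrite inE VP /=.
  have /orP[//|/disjoint_setI0/setP/(_ x)] := PE V VP.
  by rewrite !inE xV xE.
by rewrite inE (negPf P0).
Qed.

Section NoncrossingSums.
Variables (A : comPzRingType) (K : nat -> A) (N : nat).
Implicit Types (S B V W : {set 'I_N}) (P Q : {set {set 'I_N}}).

Definition nc_sum S : A :=
  \sum_(P | partition P S && noncrossing P) \prod_(V in P) K #|V|.

(** [B] is the initial part of a block that is still open, [S] the set of the points still to be
    distributed. Keeping the open block explicit is what makes the sums recursive. *)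
Definition open_part B S P :=
  [&& partition P (B :|: S), noncrossing P & [exists V in P, B \subset V]].

Definition nc_open_sum B S : A :=
  \sum_(P | open_part B S P) \prod_(V in P) K #|V|.

Lemma nc_sum0 : nc_sum set0 = 1.
Proof.
rewrite /nc_sum (big_pred1 set0) ?big_set0 // => P.
rewrite partition_set0 /=; case: eqP => //= ->.
by apply/noncrossingP => V W; rewrite inE.
Qed.

Lemma nc_sum_min S i : i \in S -> nc_sum S = nc_open_sum [set i] (S :\ i).
Proof.
move=> iS; apply: eq_bigl => P; rewrite /open_part setD1K //.
case pP: (partition P S) => //=; case: (noncrossing P) => //=.
symmetry; apply/exists_inP.
move: iS; rewrite -(cover_partition pP) => /bigcupP[V VP iV].
by exists V => //; rewrite sub1set.
Qed.

Definition below S (i : 'I_N) : {set 'I_N} := [set j in S | (j < i)%N].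
Definition above S (i : 'I_N) : {set 'I_N} := [set j in S | (i < j)%N].

Section OpenBlock.
Variables (B S : {set 'I_N}) (b0 : 'I_N).
Hypotheses (b0B : b0 \in B)
  (BS : forall b s, b \in B -> s \in S -> (b < s)%N).

Let dBS : [disjoint B & S].
Proof.
apply/pred0P => x /=; apply/negP => /andP[xB xS].
by have := BS xB xS; rewrite ltnn.
Qed.

Let b0S : b0 \notin S.
Proof. by apply/negP => /(BS b0B); rewrite ltnn. Qed.

Let first_in (P : {set {set 'I_N}}) (i : 'I_N) :=
  (i |: B \subset pblock P b0) && [disjoint pblock P b0 & below S i].

Let open_block P : open_part B S P -> 
  pblock P b0 \in P /\ B \subset pblock P b0.
Proof.
move=> /and3P[pP _ /exists_inP[V VP BV]].
have tP := partition_trivIset pP.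
by rewrite (def_pblock tP VP (subsetP BV _ b0B)).
Qed.

(** As [B] precedes every point of [S], adding it as a block of its own creates no crossing. *)
Let closed_sum :
  \sum_(P | open_part B S P && (B \in P)) \prod_(V in P) K #|V| = K #|B| * nc_sum S.
Proof.
rewrite /nc_sum big_distrr /=.
rewrite [LHS](reindex_onto (fun Q : {set {set 'I_N}} => B |: Q) (fun P => P :\ B)) /=; last first.
  by move=> P /andP[_ BP]; rewrite setD1K.
have B0 : B != set0 by apply/set0Pn; exists b0.
apply: eq_big => [Q|Q].
  apply/idP/idP => [/andP[/andP[/and3P[pP nc _] BP] /eqP QE]|/andP[pQ nc]].
    rewrite -QE; apply/andP; split.
      have := partitionD1 pP BP; rewrite setDUl setDv set0U.
      by have /setDidPl -> : [disjoint S & B] by rewrite disjoint_sym.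
    by apply: noncrossing_sub nc; apply: subD1set.
  have BQ : B \notin Q.
    apply/negP => BQ; have := partitionS pQ BQ.
    by move/subsetP/(_ _ b0B); apply/negP.
  rewrite setU11 andbT setU1K // eqxx andbT; apply/and3P; split.
  - exact: partitionU1.
  - apply/noncrossingP => V W.
    move=> /setU1P[->|VQ] /setU1P[->|WQ]; rewrite ?eqxx // => VW a b c e.
    + move=> aV bW cV eW ab bc ce.
      have bS := subsetP (partitionS pQ WQ) _ bW.
      by have := BS cV bS; rewrite ltnNge (ltnW bc).
    + move=> aV bW cV eW ab bc ce.
      have aS := subsetP (partitionS pQ VQ) _ aV.
      by have := BS bW aS; rewrite ltnNge (ltnW ab).
    + by move: VW a b c e; apply: (noncrossingP _ nc).
  - by apply/exists_inP; exists B => //; rewrite setU11.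
move=> /andP[/andP[_ _] /eqP QE].
by rewrite big_setU1 //= -QE !inE eqxx.
Qed.

Let below_lt i x : x \in below S i -> (x < i)%N /\ x \in S.
Proof. by rewrite inE => /andP[]. Qed.

(** Here [i] is the first point of [S] in the block of [B]. A block with points on both sides of [i]
    would cross the open block, so the partition splits freely into one of [below S i] and one of
    the rest, where [i |: B] is the new open part. *)
Let joined_sum i : i \in S ->
  \sum_(P | open_part B S P && first_in P i) \prod_(V in P) K #|V|
  = nc_sum (below S i) * nc_open_sum (i |: B) (above S i).
Proof.
move=> iS; rewrite /nc_sum /nc_open_sum big_distrlr /= pair_big_dep /=.
set D1 := below S i; set D2 := (i |: B) :|: above S i.
have D12 x : x \in B :|: S -> (x \in D1) || (x \in D2).
  rewrite !inE; have [->|] /= := eqVneq x i; first by rewrite orbT.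
  rewrite -(inj_eq val_inj) /= neq_ltn; case: (x \in B) => /=; first by rewrite orbT.
  by move=> /orP[->|->] ->; rewrite ?orbT.
have UD : D1 :|: D2 = B :|: S.
  apply/setP=> x; rewrite in_setU; apply/idP/idP; last exact: D12.
  rewrite !inE => /orP[/andP[-> _]|/orP[/orP[/eqP->|->]|/andP[-> _]]] //; rewrite ?orbT //.
  by rewrite iS orbT.
(* Hence no point of [D2] lies between two points of [D1], which excludes crossings when two
   partitions are glued. *)
have D2P x y : x \in D2 -> y \in D1 -> (x < y)%N \/ (i <= x)%N.
  rewrite !inE => /orP[/orP[/eqP->|xB]|/andP[_ ix]] /andP[yS yi].
  - by right.
  - by left; apply: BS.
  - by right; apply: ltnW.
have D1i y : y \in D1 -> (y < i)%N by case/below_lt.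
have dD : [disjoint D1 & D2].
  apply/pred0P => x /=; apply/negP => /andP[x1 x2].
  by have [|] := D2P x x x2 x1; rewrite ?ltnn // leqNgt D1i.
have i0 : i \in pred_of_set D2 by rewrite !inE eqxx.
rewrite [RHS](reindex_onto (fun P => (P ::&: D1, P ::&: D2)) (fun PQ => PQ.1 :|: PQ.2)) /=; last first.
  case=> P Q /= /andP[/andP[pP _] /and3P[pQ _ _]].
  have P0 V : V \in P -> V != set0 by exact: partition_neq0 pP.
  have Q0 V : V \in Q -> V != set0 by exact: partition_neq0 pQ.
  have key (D E V : {set 'I_N}) : [disjoint D & E] -> V != set0 -> V \subset D -> V \subset E -> False.
    move=> dDE /set0Pn[x xV] /subsetP/(_ _ xV) xD /subsetP/(_ _ xV) xE.
    by move/pred0P: dDE => /(_ x) /=; rewrite xD xE.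
  congr (_, _); apply/setP => V; rewrite !inE; apply/idP/idP.
  - case/andP=> /orP[//|VQ] V1; exfalso; apply: key (dD) (Q0 _ VQ) V1 _.
    exact: partitionS pQ VQ.
  - by move=> VP; rewrite VP (partitionS pP).
  - case/andP=> /orP[VP|//] V2; exfalso; apply: key (dD) (P0 _ VP) _ V2.
    exact: partitionS pP VP.
  - by move=> VQ; rewrite VQ orbT (partitionS pQ).
have part P : open_part B S P -> first_in P i -> 
    forall V, V \in P -> (V \subset D1) || (V \subset D2).
  move=> oP /andP[iV0 dV0] W WP.
  have [V0P BV0] := open_block oP; have /and3P[pP nc _] := oP.
  set V0 := pblock P b0 in V0P BV0 dV0 iV0.
  have WD x : x \in W -> x \in B :|: S by apply: subsetP (partitionS pP WP) x.
  have [->|WV0] := eqVneq W V0.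
    apply/orP; right; apply/subsetP => x xV.
    have /orP[x1|//] := D12 x (subsetP (partitionS pP V0P) _ xV).
    by move/pred0P: dV0 => /(_ x) /=; rewrite xV x1.
  have iV : i \in V0 by apply: (subsetP iV0); rewrite setU11.
  have dW : [disjoint W & V0] by apply: (trivIsetP (partition_trivIset pP)).
  have nV x : x \in W -> x \notin V0.
    by move=> xW; apply/negP => xV; move/pred0P: dW => /(_ x) /=; rewrite xW xV.
  case: (boolP (W \subset D2)) => [|/subsetPn[x xW x2]]; first by rewrite orbT.
  have x1 : x \in D1 by have := D12 x (WD x xW); rewrite (negPf x2) orbF.
  rewrite orbF; apply/subsetP => y yW.
  have /orP[//|y2] := D12 y (WD y yW); exfalso.
  have xi := D1i _ x1; have [xS _] := below_lt x1.
  have yV := nV _ yW.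
  have yi : (i < y)%N.
    move: y2; rewrite !inE => /orP[/orP[/eqP yi|yB]|/andP[_ //]].
      by move: yV; rewrite yi iV.
    by move: yV; rewrite (subsetP BV0 _ yB).
  (* The forbidden pattern is [b0 < x < i < y], with [b0], [i] in the open block and [x], [y] in
     [W]. *)
  apply: (noncrossingP _ nc V0 W V0P WP _ b0 x i y) => //.
  - by rewrite eq_sym.
  - exact: (subsetP BV0).
  - by apply: BS => //; have [] := below_lt x1.
have disj (V D E : {set 'I_N}) : [disjoint D & E] -> V \subset D -> [disjoint V & E].
  by move=> dDE VD; apply: disjointWl VD dDE.
have D1S : D1 \subset B :|: S by rewrite -UD subsetUl.
have D2S : D2 \subset B :|: S by rewrite -UD subsetUr.
apply: eq_big => [P|P /andP[oP fP]].
  apply/idP/idP => [/andP[oP fP]|].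
    have /and3P[pP nc _] := oP; have pt := part P oP fP.
    have [V0P BV0] := open_block oP.
    apply/andP; split; last first.
      apply/eqP/setP => V; rewrite !inE -andb_orr.
      by case: (boolP (V \in P)) => //= /pt ->.
    apply/andP; split; [apply/andP; split|apply/and3P; split].
    - apply: (partition_part pP) => // V /pt /orP[->//|V2].
      by rewrite (disj V D2 D1) ?orbT // disjoint_sym.
    - by apply: noncrossing_sub nc; apply/subsetP => V; rewrite inE => /andP[].
    - apply: (partition_part pP) => // V /pt /orP[V1|->//].
      by rewrite (disj V D1 D2) ?orbT.
    - by apply: noncrossing_sub nc; apply/subsetP => V; rewrite inE => /andP[].
    - apply/exists_inP; exists (pblock P b0); last by case/andP: fP.
      rewrite inE V0P /=; have /orP[/subsetP V1|//] := pt _ V0P.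
      have /V1 : b0 \in pblock P b0 by apply: (subsetP BV0).
      by move=> /below_lt[_ b0S']; move: b0S; rewrite b0S'.
  move=> /andP[/andP[/andP[p1 n1] /and3P[p2 n2 /exists_inP[V0]]]].
  rewrite inE => /andP[V0P V0D iV0] /eqP PE.
  have pP : partition P (B :|: S) by rewrite -UD -PE; apply: partitionU.
  have e0 : pblock P b0 = V0.
    apply: def_pblock (partition_trivIset pP) V0P _.
    by apply: (subsetP iV0); rewrite inE b0B orbT.
  apply/andP; split; last first.
    rewrite /first_in e0 iV0 /=; apply: disj V0D.
    by rewrite disjoint_sym.
  apply/and3P; split => //; last first.
    apply/exists_inP; exists V0 => //; apply: subset_trans iV0.
    by apply: subsetUr.
  apply/noncrossingP => V W; rewrite -PE !inE.
  have s1 V' : V' \in P ::&: D1 -> forall x, x \in V' -> x \in D1.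
    by rewrite inE => /andP[_ /subsetP].
  have s2 V' : V' \in P ::&: D2 -> forall x, x \in V' -> x \in D2.
    by rewrite inE => /andP[_ /subsetP].
  move=> /orP[] V12 /orP[] W12 VW a b c e aV bW cV eW ab bc ce.
  - by apply: (noncrossingP _ n1 V W _ _ VW a b c e); rewrite ?inE.
  - case/andP: V12 => _ /subsetP V1; case/andP: W12 => _ /subsetP W2.
    have ci := D1i c (V1 _ cV); have [ba|ib] := D2P b a (W2 _ bW) (V1 _ aV).
      by move: ba; rewrite ltnNge (ltnW ab).
    by move: (leq_ltn_trans ib (ltn_trans bc ci)); rewrite ltnn.
  - case/andP: V12 => _ /subsetP V2; case/andP: W12 => _ /subsetP W1.
    have ei := D1i e (W1 _ eW); have [cb|ic] := D2P c b (V2 _ cV) (W1 _ bW).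
      by move: cb; rewrite ltnNge (ltnW bc).
    by move: (leq_ltn_trans ic (ltn_trans ce ei)); rewrite ltnn.
  - by apply: (noncrossingP _ n2 V W _ _ VW a b c e); rewrite ?inE.
have pt := part P oP fP; have /and3P[pP _ _] := oP.
have {1}<- : (P ::&: D1) :|: (P ::&: D2) = P.
  apply/setP => V; rewrite !inE -andb_orr.
  by case: (boolP (V \in P)) => //= /pt ->.
rewrite (eq_bigl [predU P ::&: D1 & P ::&: D2]) => [|V]; last by rewrite inE.
rewrite bigU //=; apply/pred0P => V /=; rewrite !inE; apply/negP.
move=> /andP[/andP[VP V1] /andP[_ V2]].
have /set0Pn[x xV] := partition_neq0 pP VP.
by move/pred0P: dD => /(_ x) /=; rewrite (subsetP V1 _ xV) (subsetP V2 _ xV).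
Qed.

(** Either the open block is already complete, or it continues at a first point [i] of [S], unique
    for the given partition. *)
Lemma nc_open_sum_rec : nc_open_sum B S =
  K #|B| * nc_sum S
  + \sum_(i in S) nc_sum (below S i) * nc_open_sum (i |: B) (above S i).
Proof.
rewrite -closed_sum; under [X in _ + X]eq_bigr do rewrite -joined_sum //.
rewrite /nc_open_sum (bigID (fun P => B \in P)) /=; congr (_ + _).
rewrite (exchange_big_dep (open_part B S)) /=; last by move=> i P _ /andP[].
have key P : open_part B S P ->
  \sum_(i in S | open_part B S P && first_in P i) \prod_(V in P) K #|V| = 
  if B \in P then 0 else \prod_(V in P) K #|V|.
  move=> oP; rewrite oP /=.
  have [V0P BV0] := open_block oP; have /and3P[pP _ _] := oP.
  case: ifPn => [BP|BP].
    have e0 : pblock P b0 = B by apply: def_pblock (partition_trivIset pP) BP b0B.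
    rewrite big_pred0 // => i; apply/negP => /and3P[iS].
    rewrite e0 subUset sub1set => /andP[iB _] _.
    by have := BS iB iS; rewrite ltnn.
  have /subsetPn[j jV jB] : ~~ (pblock P b0 \subset B).
    apply/negP => VB; move: BP; rewrite (_ : B = pblock P b0) ?V0P //.
    by apply/eqP; rewrite eqEsubset VB BV0.
  have jS : j \in S.
    by have := subsetP (partitionS pP V0P) _ jV; rewrite inE (negPf jB).
  pose p (x : 'I_N) := (x \in S) && (x \in pblock P b0).
  have pj : p j by rewrite /p jS.
  case: (arg_minnP (fun x : 'I_N => val x) pj) => i /andP[iS iV] imin.
  rewrite (big_pred1 i) // => k; apply/idP/eqP => [/and3P[kS kV dk]|->].
    apply/val_inj/eqP; rewrite /= eqn_leq imin; last first.
      by rewrite /p kS (subsetP kV) // setU11.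
    rewrite leqNgt andbT; apply/negP => ik.
    by move/pred0P: dk => /(_ i) /=; rewrite iV inE iS ik.
  rewrite iS /first_in subUset sub1set iV BV0 /=.
  apply/pred0P => x /=; apply/negP => /andP[xV].
  rewrite inE => /andP[xS xi]; have : p x by rewrite /p xS xV.
  by move/imin; rewrite leqNgt xi.
rewrite [RHS](bigID (fun P => B \in P)) /= [X in X + _]big1 ?add0r.
  by apply: eq_bigr => P /andP[oP BP]; rewrite key // (negPf BP).
by move=> P /andP[oP BP]; rewrite key // BP.
Qed.

End OpenBlock.
End NoncrossingSums.

(** The rank [#|below S i|] is strictly increasing in [i], hence a bijection from [S] onto the
    numbers below [#|S|]. A sum over points becomes a sum over sizes. *)
Lemma sum_rank (A : nmodType) N (S : {set 'I_N}) (F : nat -> A) :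
  \sum_(i in S) F #|below S i| = \sum_(j < #|S|) F j.
Proof.
rewrite -big_enum -(big_map (fun i => #|below S i|) xpredT F) -[RHS](big_mkord xpredT).
apply: perm_big; rewrite /index_iota subn0.
have ltS i : i \in S -> (#|below S i| < #|S|)%N.
  move=> iS; apply: proper_card; apply/properP; split.
    by apply/subsetP => x; rewrite inE => /andP[].
  by exists i => //; rewrite inE ltnn andbF.
have lt2 (i j : 'I_N) : i \in S -> (i < j)%N -> (#|below S i| < #|below S j|)%N.
  move=> iS ij; apply: proper_card; apply/properP; split.
    by apply/subsetP => x; rewrite !inE => /andP[-> /ltn_trans]; apply.
  by exists i; rewrite inE ?iS ?ltnn ?andbF.
have sub : {subset [seq #|below S i| | i <- enum S] <= iota 0 #|S|}.
  by move=> y /mapP[i]; rewrite mem_enum => iS ->; rewrite mem_iota add0n ltS.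
have un : uniq [seq #|below S i| | i <- enum S].
  rewrite map_inj_in_uniq ?enum_uniq // => i j; rewrite !mem_enum => iS jS.
  move=> e; case: (ltngtP (val i) (val j)) => [ij|ji|/val_inj //].
    by have := lt2 _ _ iS ij; rewrite e ltnn.
  by have := lt2 _ _ jS ji; rewrite e ltnn.
apply: uniq_perm => //; first exact: iota_uniq.
by apply: (uniq_min_size un sub _).2; rewrite size_map size_iota cardE.
Qed.

Lemma card_above N (S : {set 'I_N}) i :
  i \in S -> #|above S i| = (#|S| - #|below S i|.+1)%N.
Proof.
move=> iS; rewrite [in RHS](cardsD1 i) iS add1n subSS.
have <- : below S i :|: above S i = S :\ i.
  apply/setP => x; rewrite !inE -andb_orr -neq_ltn andbC.
  by rewrite -(inj_eq val_inj).
rewrite cardsU (_ : _ :&: _ = set0) ?cards0 ?subn0 ?addKn //.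
by apply/setP => x; rewrite !inE; case: (ltngtP x i) => _; rewrite ?andbF.
Qed.

(** * Moments as polynomials in the free cumulants *)

Section NcMoments.
Variables (A : comPzRingType) (K : nat -> A).

(* [nc_open_fuel f k n], for [n < f], is the weighted number of noncrossing
   partitions of [k + n] points whose [k] first points lie in one block. *)
Fixpoint nc_open_fuel (f k n : nat) : A :=
  if f is f'.+1 then
    let mom j := if j is j'.+1 then nc_open_fuel f' 1 j' else 1 in
    K k * mom n + \sum_(i < n) mom i * nc_open_fuel f' k.+1 (n - i.+1)
  else 0.

Definition nc_open k n := nc_open_fuel n.+1 k n.
Definition nc_moment n := if n is n'.+1 then nc_open 1 n' else 1.

Lemma nc_open_fuelE f k n : (n < f)%N -> nc_open_fuel f k n = nc_open k n.
Proof.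
suff fuel g : (n < f)%N -> (n < g)%N -> nc_open_fuel f k n = nc_open_fuel g k n.
  by move=> nf; apply: fuel.
elim: f g k n => [|f IH] [|g] k n; rewrite ?ltn0 // !ltnS => nf ng /=.
congr (_ * _ + _); first by case: n ng nf => // n ng nf; apply: IH.
apply: eq_bigr => -[i /= i_n] _; congr (_ * _).
  case: i i_n => // i i_n; apply: IH.
  - exact: leq_trans (ltnW i_n) nf.
  - exact: leq_trans (ltnW i_n) ng.
have nn : (n - i.+1 < n)%N by rewrite ltn_subrL (leq_ltn_trans _ i_n).
by apply: IH; apply: leq_trans nn _.
Qed.

Lemma nc_openE k n : nc_open k n =
  K k * nc_moment n + \sum_(i < n) nc_moment i * nc_open k.+1 (n - i.+1).
Proof.
rewrite /nc_open /=; congr (_ * _ + _); first by case: n.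
apply: eq_bigr => -[i /= i_n] _.
have nn : (n - i.+1 < n)%N by rewrite ltn_subrL (leq_ltn_trans _ i_n).
congr (_ * _); last exact: nc_open_fuelE.
by case: i i_n {nn} => // i i_n; apply: nc_open_fuelE; apply: ltnW.
Qed.

(** Only cardinals matter, since every piece of the recursion is again a set of consecutive points
    of [S]. The two claims go by a joint induction: [nc_sum] of [S] is an open sum over a smaller
    set, and the open sum over [S] uses [nc_sum] of [S] itself. *)
Lemma nc_sums N (S : {set 'I_N}) :
  nc_sum K S = nc_moment #|S| /\
  forall B : {set 'I_N}, B != set0 ->
    (forall b s, b \in B -> s \in S -> (b < s)%N) ->
    nc_open_sum K B S = nc_open #|B| #|S|.
Proof.
have [n] := ubnP #|S|; elim: n S => // n IH S; rewrite ltnS => Sn.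
have sumS : nc_sum K S = nc_moment #|S|.
  have [->|/set0Pn[j jS]] := eqVneq S set0; first by rewrite cards0 nc_sum0.
  case: (arg_minnP (fun x : 'I_N => val x) jS) => i iS' imin.
  have iS : i \in S by exact: iS'.
  have Sc : #|S| = #|S :\ i|.+1 by rewrite (cardsD1 i) iS.
  have lt1 : (#|S :\ i| < n)%N by rewrite -Sc.
  rewrite (nc_sum_min K iS) (IH _ lt1).2.
  - by rewrite Sc cards1.
  - by apply/set0Pn; exists i; rewrite inE.
  - move=> b s; rewrite inE => /eqP -> /setD1P[si sS].
    rewrite ltn_neqAle imin // andbT; move: si; apply: contraNN => /eqP e.
    by apply/eqP/val_inj.
split=> // B /set0Pn[b0 b0B] BS.
have lt0 i : i \in S -> (#|below S i| < #|S|)%N.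
  move=> iS; apply: proper_card; apply/properP; split.
    by apply/subsetP => x; rewrite inE => /andP[].
  by exists i => //; rewrite inE ltnn andbF.
rewrite (nc_open_sum_rec K b0B BS) sumS nc_openE; congr (_ + _).
rewrite -(sum_rank S (fun j => nc_moment j * nc_open #|B|.+1 (#|S| - j.+1))).
apply: eq_bigr => i iS; rewrite (IH _ (leq_trans (lt0 i iS) Sn)).1; congr (_ * _).
have iB : i \notin B by apply/negP => /BS/(_ iS); rewrite ltnn.
have lt3 : (#|above S i| < n)%N.
  apply: leq_trans Sn; rewrite card_above // ltn_subrL /=.
  by rewrite (leq_ltn_trans _ (lt0 i iS)).
rewrite (IH _ lt3).2 ?cardsU1 ?iB ?card_above //.
  by apply/set0Pn; exists b0; rewrite inE b0B orbT.
move=> b s; rewrite !inE => /orP[/eqP->|bB] /andP[sS is_] //.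
exact: BS.
Qed.

Lemma nc_moment_sum n :
  nc_moment n = \sum_(P : {set {set 'I_n}} |
     finset.partition P [set: 'I_n]%SET && noncrossing P) \prod_(V in P) K #|V|.
Proof. by rewrite -[RHS]/(nc_sum K [set: 'I_n]) (nc_sums _).1 cardsT card_ord. Qed.

End NcMoments.

(** * Growth and formal equation of the moments *)

Lemma fact_mul_leq a b : (a`! * b`! <= (a + b)`!)%N.
Proof.
elim: a => [|a IH]; first by rewrite mul1n.
by rewrite addSn !factS -mulnA leq_mul // ltnS leq_addr.
Qed.

(** The gain of one over [fact_mul_leq] pays for the number of terms of the convolution in
    [fact_mul_sum]. *)
Lemma fact_mul_leq_pred a b : (0 < a)%N -> (0 < b)%N -> (a`! * b`! <= (a + b).-1`!)%N.
Proof.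
case: a => // a _ b0; elim: a => [|a IH]; first by rewrite mul1n.
rewrite factS -mulnA (leq_trans (leq_mul (leqnn _) IH)) //.
rewrite !addSn /= factS leq_mul // ltnS.
by rewrite -addn1 leq_add2l.
Qed.

Lemma fact_mul_sum n k :
  (\sum_(i < n) i.+1`! * (n + k - i)`! <= (n.+1 + k)`!)%N.
Proof.
apply: (@leq_trans (\sum_(i < n) (n + k)`!)).
  apply: leq_sum => i _; have := ltn_ord i => i_n.
  apply: (leq_trans (fact_mul_leq_pred _ _)) => //.
    by rewrite subn_gt0 ltn_addr.
  by rewrite addSn /= subnKC // (leq_trans (ltnW i_n)) // leq_addr.
rewrite sum_nat_const card_ord addSn factS leq_mul //.
by rewrite -addSn ltnW // ltn_addr.
Qed.

Section MomentBound.
Variables (R : numFieldType) (K : nat -> R) (L : R).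
Hypotheses (L0 : 0 <= L) (KL : forall s, (0 < s)%N -> `|K s| <= L ^+ s * s`!%:R).

(** The powers of 3 pay for the three parts of the recursion: the closed block, the term [i = 0],
    where [nc_moment 0 = 1] brings no gain in the factorials, and the remaining convolution. *)
Lemma nc_open_bound k n : (0 < k)%N ->
  `|nc_open K k n| <= L ^+ (k + n) * 3 ^+ n * (n + k)`!%:R.
Proof.
elim/ltn_ind: n k => n IH k k0.
have fM (a b c : nat) : (a * b <= c)%N -> a%:R * b%:R <= c%:R :> R.
  by move=> abc; rewrite -natrM ler_nat.
rewrite nc_openE; case: n IH => [|n] IH.
  by rewrite big_ord0 !addr0 !mulr1 addn0 KL.
have M1 i : (i <= n)%N -> `|nc_moment K i.+1| <= L ^+ i.+1 * 3 ^+ i * i.+1`!%:R.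
  by move=> i_n; have := IH i i_n 1%N isT; rewrite add1n addn1.
set b := L ^+ (k + n.+1) * 3 ^+ n * (n.+1 + k)`!%:R.
have b1 : `|K k * nc_moment K n.+1| <= b.
  rewrite normrM (le_trans (ler_pM _ _ (KL k0) (M1 n _))) //.
  rewrite [leLHS](_ : _ = L ^+ (k + n.+1) * 3 ^+ n * (k`!%:R * n.+1`!%:R)).
    by rewrite ler_wpM2l ?mulr_ge0 ?exprn_ge0 // fM // addnC fact_mul_leq.
  by rewrite exprD; ring.
rewrite big_ord_recl /=.
have b2 : `|nc_moment K 0 * nc_open K k.+1 (n.+1 - 1)| <= b.
  rewrite mul1r subn1 /= (le_trans (IH n _ k.+1 _)) //.
  by rewrite /b addSnnS !addnS addSn.
have b3 : `|\sum_(i < n) nc_moment K (bump 0 i) *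
    nc_open K k.+1 (n.+1 - (bump 0 i).+1)| <= b.
  apply: (@le_trans _ _ (\sum_(i < n) L ^+ (k + n.+1) * 3 ^+ n
      * (i.+1`! * (n + k - i)`!)%:R)).
    apply: (le_trans (ler_norm_sum _ _ _)); apply: ler_sum => -[i i_n] _ /=.
    rewrite /bump leq0n add1n subSS normrM.
    have lt1 : (n - i.+1 < n.+1)%N by rewrite ltnS leq_subr.
    apply: (le_trans (ler_pM _ _ (M1 i (ltnW i_n)) (IH _ lt1 k.+1 _))) => //.
    have -> : (n - i.+1 + k.+1 = n + k - i)%N.
      by rewrite addnS -addSn subnSK // addnBAC // ltnW.
    rewrite natrM.
    have -> : (k + n.+1 = i.+1 + (k.+1 + (n - i.+1)))%N.
      by rewrite addnCA subnKC // addSnnS.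
    have e3 : (3 : R) ^+ n = 3 ^+ i * 3 ^+ (n - i.+1) * 3.
      by rewrite -exprD -exprSr; congr (_ ^+ _); rewrite -addnS subnSK // subnKC // ltnW.
    rewrite e3 (exprD L i.+1).
    set u := L ^+ i.+1; set v := L ^+ _; set f1 := (i.+1)`!%:R; set f2 := (n + k - i)`!%:R.
    set s := 3 ^+ i; set t := 3 ^+ _.
    rewrite [leLHS](_ : _ = u * v * (s * t) * (f2 * f1)); last by ring.
    have ? : 0 <= u * v * (s * t) * (f2 * f1).
      by rewrite !mulr_ge0 ?exprn_ge0 ?ler0n.
    rewrite [leRHS](_ : _ = u * v * (s * t) * (f2 * f1) * 3); last by ring.
    by rewrite ler_peMr // ler1n.
  rewrite -mulr_sumr /b ler_wpM2l ?mulr_ge0 ?exprn_ge0 //.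
  by rewrite -natr_sum ler_nat fact_mul_sum.
rewrite (exprS 3) [leRHS](_ : _ = b + (b + b)); last by rewrite /b; ring.
apply: (le_trans (ler_normD _ _)); apply: lerD => //.
by apply: (le_trans (ler_normD _ _)); apply: lerD.
Qed.

Lemma nc_moment_bound n : `|nc_moment K n| <= (3 * L) ^+ n * n`!%:R.
Proof.
case: n => [|n]; first by rewrite normr1 mul1r.
apply: (le_trans (@nc_open_bound 1 n isT)); rewrite add1n addn1 exprMn mulrC.
rewrite mulrC [_ * L ^+ _]mulrC; apply: ler_wpM2r => //.
by rewrite ler_wpM2l ?exprn_ge0 // ler_eXn2l // ltr1n.
Qed.

End MomentBound.

Definition cauchy_prod (A : comPzRingType) (a b : nat -> A) (n : nat) : A :=
  \sum_(i < n.+1) a i * b (n - i)%N.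

(* If [M] is the moment sequence, [cauchy_coef M] and [cauchy_deriv_coef M] are
   the coefficients in [1 / z] of the Cauchy transform and of its derivative. *)
Definition cauchy_coef (A : comPzRingType) (M : nat -> A) (n : nat) : A :=
  if n is n'.+1 then M n' else 0.
Definition cauchy_deriv_coef (A : comPzRingType) (M : nat -> A) (n : nat) : A :=
  if n is n'.+2 then - (n'.+1%:R * M n') else 0.

Lemma mulX_derivMXn (A : comNzRingType) N (s : {poly A}) :
  'X * ('X^N * s)^`() = 'X^N * (N%:R * s + 'X * s^`()).
Proof.
rewrite derivM derivXn -mulr_natl.
by case: N => [|n]; rewrite ?expr0 /= ?exprS; ring.
Qed.

(** * The equation for the coefficients, with polynomials modulo a power of [X] *)

Section FormalEquation.
Variables (A : comNzRingType) (K dK M dM : nat -> A) (a d : nat -> nat -> A).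
Hypotheses (M0 : M 0 = 1) (MS : forall n, M n.+1 = a 1 n).
Hypotheses (dM0 : dM 0 = 0) (dMS : forall n, dM n.+1 = d 1 n).
Hypothesis a_rec : forall k n,
  a k n = K k * M n + \sum_(i < n) M i * a k.+1 (n - i.+1).
Hypothesis d_rec : forall k n, (0 < k)%N ->
  d k n = dK k * M n + K k * dM n
    + \sum_(i < n) (dM i * a k.+1 (n - i.+1) + M i * d k.+1 (n - i.+1)).
Hypothesis dKE : forall k, dK k.+1 = - (k%:R * K k.+1) + (k == 1)%:R.

Section Truncation.
Variable N : nat.
Let P (f : nat -> A) : {poly A} := \poly_(i < N) f i.
Let p := P M.
Let q := P dM.

Lemma poly_dvdXn (r : {poly A}) :
  (forall i, (i < N)%N -> r`_i = 0) -> exists s : {poly A}, r = 'X^N * s.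
Proof.
move=> r0; exists (drop_poly N r); rewrite -[LHS](poly_take_drop N).
rewrite (_ : take_poly N r = 0) ?add0r 1?mulrC //.
by apply/polyP => i; rewrite coef_take_poly coef0; case: ifP => // /r0.
Qed.

Let coefPP f g i : (i < N)%N ->
  ('X * (P f * P g))`_i = \sum_(j < i) f j * g (i - j.+1)%N.
Proof.
move=> iN; rewrite coefXM; case: i iN => [|i] iN; first by rewrite big_ord0.
rewrite coefM; apply: eq_bigr => -[j ji] _ /=; rewrite !coef_poly subSS.
by rewrite (leq_trans ji (ltnW iN)) (leq_ltn_trans (leq_subr _ _) (ltnW iN)).
Qed.

Let aP k : exists s : {poly A}, P (a k) = (K k)%:P * p + 'X * (p * P (a k.+1)) + 'X^N * s.
Proof.
have [|s sE] := @poly_dvdXn (P (a k) - ((K k)%:P * p + 'X * (p * P (a k.+1)))).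
  move=> i iN; rewrite coefB coefD coefCM coefPP // !coef_poly iN a_rec.
  by rewrite subrr.
by exists s; rewrite -sE addrC subrK.
Qed.

Let dP k : (0 < k)%N -> exists s : {poly A}, P (d k) =
  (dK k)%:P * p + (K k)%:P * q + 'X * (q * P (a k.+1))
  + 'X * (p * P (d k.+1)) + 'X^N * s.
Proof.
move=> k0; have [|s sE] := @poly_dvdXn (P (d k) - ((dK k)%:P * p + (K k)%:P * q
    + 'X * (q * P (a k.+1)) + 'X * (p * P (d k.+1)))).
  move=> i iN; rewrite coefB !coefD !coefCM !coefPP // !coef_poly iN d_rec //.
  by rewrite big_split /= addrA subrr.
by exists s; rewrite -sE addrC subrK.
Qed.

(** With [X = 1 / z], [y] is the truncated Cauchy transform, [dy] the series built in the same way
    from [dM], and [W = X y']; thus [- X W] is the derivative of [y] in [z]. *)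
Let W := 'X * (p + 'X * p^`()).
Let y := 'X * p.
Let dy := 'X * q.
Let Z k : {poly A} := if k is 0 then y * (W * p) else if k is 1 then W * p else 0.

(** Formally [P (a k.+1)] is [p phi(y)] with [phi(w) = sum_j K_{k+1+j} w^j]. [E k] eliminates [phi]
    and [phi'] between this series, its derivative by [X d/dX] and its time derivative with [dKE]
    inserted, so it vanishes as a formal series. [Z k] is the contribution of the term [(k == 1)] of
    [dKE]. *)
Let E k := W * P (d k.+1) + (y - dy) * ('X * (P (a k.+1))^`())
  + (k%:R * W - 'X * ('X * p^`()) - dy) * P (a k.+1) - Z k.

(* The combination [E k] is chosen so that the recursions telescope. *)
Let E_rec k : exists s : {poly A}, E k = y * E k.+1 + 'X^N * s.
Proof.
have [s1 e1] := aP k.+1; have [s2 e2] := dP (ltn0Sn k).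
have e3 : 'X * (P (a k.+1))^`() = (K k.+1)%:P * ('X * p^`())
    + W * P (a k.+2) + y * ('X * (P (a k.+2))^`()) + 'X^N * (N%:R * s1 + 'X * s1^`()).
  rewrite e1 derivD mulrDr mulX_derivMXn; congr (_ + _).
  by rewrite !derivD !derivM derivC derivX /W /y; ring.
have eZ : (k == 1)%:R * (W * p) - Z k = - (y * Z k.+1).
  by case: k {s1 e1 s2 e2 e3} => [|[|k]] //=; ring.
exists (W * s2 + (y - dy) * (N%:R * s1 + 'X * s1^`())
  + (k%:R * W - 'X * ('X * p^`()) - dy) * s1).
rewrite /E e3 e2 e1 dKE.
rewrite polyCD polyCN polyCM !polyC_natr.
rewrite -[Z k](subKr ((k == 1)%:R * (W * p))) eZ.
rewrite [k.+1%:R](_ : _ = k%:R + 1); last by rewrite -natr1.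
by move: (Z k.+1) (P (d k.+2)) (P (a k.+2)) => z D B; rewrite /W /y /dy; ring.
Qed.

(** After [N] steps of [E_rec] the main term carries [y ^+ N], and [X] divides [y]. *)
Let E0 : exists s : {poly A}, E 0 = 'X^N * s.
Proof.
have : forall j, exists s : {poly A}, E 0 = y ^+ j * E j + 'X^N * s.
  elim=> [|j [s sE]]; first by exists 0; rewrite expr0; ring.
  by have [s' sE'] := E_rec j; exists (s + y ^+ j * s'); rewrite sE sE' exprSr; ring.
by move=> /(_ N)[s ->]; rewrite /y exprMn; exists (p ^+ N * E N + s); ring.
Qed.

Let aM : exists s : {poly A}, 'X * P (a 1) = p - 1 + 'X^N * s.
Proof.
have [|s sE] := @poly_dvdXn ('X * P (a 1) - (p - 1)).
  move=> i iN; rewrite !coefB coefXM coef1 !coef_poly iN.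
  by case: i iN => [|i] iN /=; rewrite ?M0 ?subrr // (ltnW iN) MS subr0 subrr.
by exists s; rewrite -sE addrC subrK.
Qed.

Let dM' : exists s : {poly A}, 'X * P (d 1) = q + 'X^N * s.
Proof.
have [|s sE] := @poly_dvdXn ('X * P (d 1) - q).
  move=> i iN; rewrite !coefB coefXM !coef_poly iN.
  by case: i iN => [|i] iN /=; rewrite ?dM0 ?subrr // (ltnW iN) dMS subrr.
by exists s; rewrite -sE addrC subrK.
Qed.

(** This is [X] times the relation [E 0 = 0], with [X P (a 1)] and [X P (d 1)] replaced by [p - 1]
    and [q]; all errors are multiples of [X ^ N] and are collected in one remainder. *)
Lemma formal_equation_poly : exists s : {poly A},
  ('X * p) * ('X * q) = ('X * p) * ('X * p) * ('X * W) + ('X * p) * ('X * p)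
    - 'X * W + 'X * ('X^N * s).
Proof.
have [s0 e0] := E0; have [s1 e1] := aM; have [s2 e2] := dM'.
have e3 : 'X * ('X * (P (a 1))^`()) = 'X * p^`() - (p - 1)
    + 'X^N * (N%:R * s1 + 'X * s1^`() - s1).
  have : ('X * P (a 1))^`() = (p - 1 + 'X^N * s1)^`() by rewrite e1.
  move=> /(congr1 (fun r => 'X * r)).
  rewrite [in RHS]derivD [in RHS]mulrDr mulX_derivMXn derivM derivX derivB derivC.
  rewrite subr0 mul1r mulrDr e1.
  move=> e; rewrite -[LHS](addKr (p - 1 + 'X^N * s1)) e; ring.
pose r := s0 * 'X - W * s2 - (y - dy) * (N%:R * s1 + 'X * s1^`() - s1)
  + ('X * ('X * p^`()) + dy) * s1.
exists r.
have : 'X * E 0 = 'X * ('X^N * s0) by rewrite e0.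
have -> : 'X * E 0 = W * ('X * P (d 1)) + (y - dy) * ('X * ('X * (P (a 1))^`()))
  - ('X * ('X * p^`()) + dy) * ('X * P (a 1)) - 'X * (y * (W * p)).
  by rewrite /E /=; ring.
rewrite e2 e3 e1 => /eqP; rewrite -subr_eq0 => /eqP e.
apply/eqP; rewrite -subr_eq0; apply/eqP.
rewrite -[RHS](mulr0 'X) -[in RHS]e /r /W /y /dy; ring.
Qed.

End Truncation.

Lemma formal_equation n :
  cauchy_prod (cauchy_coef M) (cauchy_coef dM) n
  = - cauchy_prod (cauchy_prod (cauchy_coef M) (cauchy_coef M)) (cauchy_deriv_coef M) n
    + cauchy_prod (cauchy_coef M) (cauchy_coef M) n + cauchy_deriv_coef M n.
Proof.
(* Truncation at [n] is enough for the coefficient of order [n]: the shift by [X] makes ['X * p]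
   correct up to degree [n], and the remainder starts in degree [n + 1]. *)
have [s] := formal_equation_poly n.
set p := \poly_(i < n) M i; set q := \poly_(i < n) dM i => e.
have cg (f : nat -> A) i : (i <= n)%N -> ('X * \poly_(i < n) f i)`_i = cauchy_coef f i.
  by move=> i_n; rewrite coefXM; case: i i_n => //= i i_n; rewrite coef_poly i_n.
have ch i : (i <= n)%N -> (- ('X * ('X * (p + 'X * p^`()))))`_i = cauchy_deriv_coef M i.
  move=> i_n; rewrite coefN !coefXM; case: i i_n => [|[|i]] i_n //=; rewrite ?oppr0 //.
  rewrite coefD coefXM coef_poly (ltnW i_n); case: i i_n => [|i] i_n /=.
    by rewrite addr0 mul1r.
  by rewrite coef_deriv coef_poly (ltnW i_n) -mulrS mulr_natl.
have cm (u v : {poly A}) (b c : nat -> A) i : (i <= n)%N ->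
   (forall j, (j <= n)%N -> u`_j = b j) -> (forall j, (j <= n)%N -> v`_j = c j) ->
   (u * v)`_i = cauchy_prod b c i.
  move=> i_n ub vc; rewrite coefM; apply: eq_bigr => -[j ji] _ /=.
  rewrite ub; last by rewrite (leq_trans _ i_n) // -ltnS.
  by rewrite vc // (leq_trans (leq_subr _ _) i_n).
have /(congr1 (fun r : {poly A} => r`_n)) := e.
rewrite (cm _ _ _ _ n (leqnn _) (cg M) (cg dM)) => ->.
rewrite !coefD coefN.
have -> : ('X * ('X^n * s))`_n = 0.
  by rewrite coefXM; case: (n) s e => //= k s' _; rewrite coefXnM ltnSn.
rewrite addr0 (cm _ _ _ _ n (leqnn _) (cg M) (cg M)).
have -> : 'X * p * ('X * p) * ('X * ('X * (p + 'X * p^`()))) =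
  - ('X * p * ('X * p) * - ('X * ('X * (p + 'X * p^`())))) by ring.
rewrite coefN (cm _ _ (cauchy_prod (cauchy_coef M) (cauchy_coef M)) _ n (leqnn _) _ ch); last first.
  by move=> j jn; apply: cm => //; apply: cg.
by rewrite -[in RHS](ch n (leqnn n)) coefN.
Qed.

End FormalEquation.

From mathcomp Require Import all_fingroup complex.
From mathcomp Require Import all_classical all_reals all_analysis.
From mathcomp Require Import measurable_realfun.

Import Order.TTheory GRing.Theory Num.Theory.
Import numFieldNormedType.Exports.
Local Open Scope ring_scope.

(** * Time dependence of the moments *)

Section Tame.
Variable R : realType.
Implicit Types q dq p dp : R -> R.

(** Differentiability on the closed half-line, one-sided at 0, with a single constant for all times.
    The class is closed under sums and products, and the quadratic error makes Riemann sums of [dq]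
    converge to increments of [q] at an explicit rate. *)
Definition tame q dq := exists C : R, forall u : R, 0 <= u -> [/\ `|q u| <= C, `|dq u| <= C
  & forall v : R, 0 <= v -> `|q v - q u| <= C * `|v - u| /\
      `|q v - q u - (v - u) * dq u| <= C * (v - u) ^+ 2].

Lemma tame_ext q dq p dp : tame q dq -> (forall u, q u = p u) ->
  (forall u, 0 <= u -> dq u = dp u) -> tame p dp.
Proof.
move=> [C qC] qp dqp; exists C => u u0; have [c1 c2 c3] := qC u u0.
by rewrite -!qp -!dqp //; split=> // v v0; rewrite -!qp; apply: c3.
Qed.

Lemma tame_cst c : tame (fun=> c) (fun=> 0).
Proof.
exists `|c| => u _; rewrite normr0; split=> // v _.
by rewrite subrr mulr0 subr0 normr0; split; rewrite mulr_ge0 // sqr_ge0.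
Qed.

Lemma tameD q dq p dp : tame q dq -> tame p dp ->
  tame (fun u => q u + p u) (fun u => dq u + dp u).
Proof.
move=> [C qC] [D pD]; exists (C + D) => u u0.
have [c1 c2 c3] := qC u u0; have [d1 d2 d3] := pD u u0.
split=> [||v v0]; try by apply: le_trans (ler_normD _ _) (lerD _ _).
have [c4 c5] := c3 v v0; have [d4 d5] := d3 v v0; rewrite !mulrDl; split.
  apply: le_trans (lerD c4 d4); apply: le_trans (ler_normD _ _).
  by rewrite le_eqVlt; apply/orP; left; apply/eqP; congr `|_|; ring.
apply: le_trans (lerD c5 d5); apply: le_trans (ler_normD _ _).
by rewrite le_eqVlt; apply/orP; left; apply/eqP; congr `|_|; ring.
Qed.

Lemma tameM q dq p dp : tame q dq -> tame p dp ->
  tame (fun u => q u * p u) (fun u => dq u * p u + q u * dp u).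
Proof.
move=> [C qC] [D pD]; exists (3 * (C * D)) => u u0.
have [c1 c2 c3] := qC u u0; have [d1 d2 d3] := pD u u0.
have C0 : 0 <= C by apply: le_trans c1.
have D0 : 0 <= D by apply: le_trans d1.
have CD : 0 <= C * D by exact: mulr_ge0.
have M (x y a b : R) : `|x| <= a -> `|y| <= b -> `|x * y| <= a * b.
  by move=> xa yb; rewrite normrM ler_pM.
split=> [||v v0].
- by apply: (le_trans (M _ _ _ _ c1 d1)); lra.
- apply: (le_trans (ler_normD _ _)).
  by have := M _ _ _ _ c2 d1; have := M _ _ _ _ c1 d2; lra.
have [c4 c5] := c3 v v0; have [d4 d5] := d3 v v0; have [d6 _ _] := pD v v0.
split.
  rewrite (_ : _ - _ = (q v - q u) * p v + q u * (p v - p u)); last by ring.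
  apply: (le_trans (ler_normD _ _)).
  have := M _ _ _ _ c4 d6; have := M _ _ _ _ c1 d4.
  have : 0 <= C * D * `|v - u| by rewrite mulr_ge0.
  by rewrite !mulrA -!(mulrAC C D); lra.
rewrite (_ : _ - _ = (q v - q u - (v - u) * dq u) * p v
  + q u * (p v - p u - (v - u) * dp u) + dq u * ((v - u) * (p v - p u))); last by ring.
apply: (le_trans (ler_normD _ _)); apply: (le_trans (lerD (ler_normD _ _) (lexx _))).
have := M _ _ _ _ c5 d6; have := M _ _ _ _ c1 d5.
have := M _ _ _ _ c2 (M _ _ _ _ (lexx `|v - u|) d4).
have -> : C * (`|v - u| * (D * `|v - u|)) = C * D * (v - u) ^+ 2.
  by rewrite -[in RHS]real_normK ?num_real //; ring.
by rewrite mulrA (mulrAC C _ D) -(mulrA 3); lra.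
Qed.

Lemma tameZ c q dq : tame q dq -> tame (fun u => c * q u) (fun u => c * dq u).
Proof.
move=> tq; apply: tame_ext (tameM (tame_cst c) tq) _ _ => // u _.
by rewrite mul0r add0r.
Qed.

Lemma tameN q dq : tame q dq -> tame (fun u => - q u) (fun u => - dq u).
Proof. by move=> tq; apply: tame_ext (tameZ (-1) tq) _ _ => u *; rewrite mulN1r. Qed.

Lemma tame_sum n (q dq : nat -> R -> R) :
  (forall i, (i < n)%N -> tame (q i) (dq i)) ->
  tame (fun u => \sum_(i < n) q i u) (fun u => \sum_(i < n) dq i u).
Proof.
elim: n => [_|n IH tq].
  by apply: tame_ext (tame_cst 0) _ _ => u *; rewrite big_ord0.
apply: tame_ext (tameD (IH _) (tq n (ltnSn n))) _ _.
- by move=> i i_n; apply: tq; apply: ltnW.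
- by move=> u; rewrite big_ord_recr.
- by move=> u _; rewrite big_ord_recr.
Qed.

Lemma tame_exp a : 0 <= a ->
  tame (fun u => expR (- (a * u))) (fun u => - a * expR (- (a * u))).
Proof.
move=> a0; exists (1 + a + a ^+ 2) => u u0.
have a2 : 0 <= a ^+ 2 by exact: sqr_ge0.
have E1 v : 0 <= v -> 0 < expR (- (a * v)) <= 1.
  by move=> v0; rewrite expR_gt0 -expR0 ler_expR oppr_le0 mulr_ge0.
have D v w : 0 <= w -> expR (- (a * v)) >= expR (- (a * w)) * (1 - a * (v - w)).
  move=> w0; rewrite [- (a * v)](_ : _ = - (a * w) + - (a * (v - w))); last by ring.
  by rewrite expRD ler_wpM2l ?expR_ge0 // expR_ge1Dx.
have [e0 e1] := andP (E1 u u0).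
split=> [||v v0].
- by rewrite gtr0_norm //; lra.
- rewrite normrM normrN (ger0_norm a0) gtr0_norm //.
  by have := ler_wpM2l a0 e1; lra.
have [f0 f1] := andP (E1 v v0).
have duv := D v u u0; have dvu := D u v v0.
move: e0 e1 f0 f1 duv dvu.
set e := expR _; set f := expR _; set h := v - u.
rewrite [u - v](_ : _ = - h); last by rewrite /h; ring.
move=> e0 e1 f0 f1 duv dvu.
have ah0 : 0 <= a * `|h| by rewrite mulr_ge0.
have hn : h <= `|h| by exact: ler_norm.
have hN : - h <= `|h| by rewrite -normrN ler_norm.
have le_ah : `|f - e| <= a * `|h|.
  have k1 : e * (a * h) <= a * `|h|.
    apply: (@le_trans _ _ (e * (a * `|h|))).
      by rewrite ler_wpM2l ?ler_wpM2l // ltW.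
    by rewrite ler_piMl.
  have k2 : f * (a * - h) <= a * `|h|.
    apply: (@le_trans _ _ (f * (a * `|h|))).
      by rewrite ler_wpM2l ?ler_wpM2l // ltW.
    by rewrite ler_piMl.
  rewrite ler_norml; lra.
split.
  apply: (le_trans le_ah); have : 0 <= `|h| by []. 
  by have := normr_ge0 h; nra.
have h2 : 0 <= h ^+ 2 by exact: sqr_ge0.
rewrite ger0_norm; last by lra.
have up : f - e - h * (- a * e) <= (a * h) ^+ 2.
  (* If [a h <= 1], multiply [f (1 + a h) <= e] by [1 - a h]; otherwise the bounds [e <= 1] and
     [f <= 1] suffice. *)
  have [ah1|ah1] := lerP (a * h) 1.
    have : (f * (1 - a * - h)) * (1 - a * h) <= e * (1 - a * h).
      by rewrite ler_wpM2r // subr_ge0.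
    have : f * (a * h) ^+ 2 <= (a * h) ^+ 2 by rewrite ler_piMl // sqr_ge0.
    lra.
  have : (1 - e) * (a * h - 1) >= 0 by rewrite mulr_ge0 ?subr_ge0 // ltW.
  have : (a * h) * (a * h - 1) >= 0 by rewrite mulr_ge0 ?subr_ge0 //; lra.
  lra.
apply: (le_trans up); rewrite exprMn.
have : 0 <= (1 + a) * h ^+ 2 by rewrite mulr_ge0 // addr_ge0.
by lra.
Qed.

(** The derivatives of the moments are obtained by choice in [nc_open_tame]; uniqueness is what
    makes them satisfy the differentiated recursion. *)
Lemma tame_unique q dq dp : tame q dq -> tame q dp ->
  forall u, 0 <= u -> dq u = dp u.
Proof.
move=> [C qC] [D qD] u u0; have [c1 _ c3] := qC u u0; have [d1 _ d3] := qD u u0.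
have C0 : 0 <= C by apply: le_trans c1.
have D0 : 0 <= D by apply: le_trans d1.
apply/eqP; rewrite -subr_eq0 -normr_eq0 eq_le normr_ge0 andbT.
apply/ler_addgt0Pr => e e0; rewrite add0r.
pose h := e / (C + D + 1).
have CD0 : 0 < C + D + 1 by lra.
have h0 : 0 < h by rewrite divr_gt0.
have uh : 0 <= u + h by lra.
have uhE : u + h - u = h by rewrite addrC addKr.
have [_ c5] := c3 _ uh; have [_ d5] := d3 _ uh; rewrite uhE in c5 d5.
rewrite -(ler_pM2l h0) -{1}[h]gtr0_norm // -normrM.
rewrite (_ : h * _ = (q (u + h) - q u - h * dp u) - (q (u + h) - q u - h * dq u)); last by ring.
apply: (le_trans (ler_normB _ _)); apply: (le_trans (lerD d5 c5)).
rewrite -mulrDl expr2 mulrA mulrC ler_pM2l //.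
have -> : e = (C + D + 1) * h by rewrite /h mulrC divfK // gt_eqF.
by rewrite ler_pM2r //; lra.
Qed.

Section Moments.
Variables (K dK : R -> nat -> R) (m : R).
Hypothesis K_tame : forall k, tame (K ^~ k) (dK ^~ k).
Hypothesis dKE : forall (u : R) k, 0 <= u ->
  m * dK u k.+1 = - (k%:R * K u k.+1) + (k == 1)%:R.

Let M u := nc_moment (K u).

Lemma nc_open_tame : exists d : nat -> nat -> R -> R,
  forall k n, tame (fun u => nc_open (K u) k n) (d k n).
Proof.
suff dP k n : exists dq, tame (fun u => nc_open (K u) k n) dq.
  have [d hd] := choice (fun kn : nat * nat => dP kn.1 kn.2).
  by exists (fun k n => d (k, n)) => k n; apply: (hd (k, n)).
elim/ltn_ind: n k => n IH k.
have IHM i : (i <= n)%N -> exists dq, tame (fun u => M u i) dq.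
  case: i => [|i] i_n; last exact: IH.
  by exists (fun=> 0); apply: tame_cst.
have [d1 d1P] := IHM n (leqnn n).
have : forall i : 'I_n, exists dq,
    tame (fun u => M u i * nc_open (K u) k.+1 (n - i.+1)) dq.
  move=> i; have [d2 d2P] := IHM i (ltnW (ltn_ord i)).
  have [|d3 d3P] := IH (n - i.+1)%N _ k.+1.
    by rewrite ltn_subrL (leq_ltn_trans _ (ltn_ord i)).
  by eexists; apply: tameM d2P d3P.
move=> /choice[ds dsP].
have ts := @tame_sum n (fun i u => M u i * nc_open (K u) k.+1 (n - i.+1))
  (fun i u => if insub i is Some i' then ds i' u else 0).
have [D DP] : exists D,
    tame (fun u => \sum_(i < n) M u i * nc_open (K u) k.+1 (n - i.+1)) D.
  by eexists; apply: ts => i i_n; have := dsP (Ordinal i_n); rewrite insubT.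
eexists; apply: tame_ext (tameD (tameM (K_tame k) d1P) DP) _ _ => // u.
by rewrite nc_openE.
Qed.

Lemma moment_equation : exists dM : nat -> R -> R,
  (forall n, tame (M ^~ n) (dM n)) /\
  forall (n : nat) (u : R), 0 <= u ->
   let g := cauchy_coef (M u) in let h := cauchy_deriv_coef (M u) in
   cauchy_prod g (cauchy_coef (fun j => m * dM j u)) n
   = - cauchy_prod (cauchy_prod g g) h n + cauchy_prod g g n + h n.
Proof.
have [d dP] := nc_open_tame.
pose dM n := if n is n'.+1 then d 1%N n' else fun=> 0.
have dMP n : tame (M ^~ n) (dM n).
  by case: n => [|n]; [apply: tame_cst|apply: dP].
exists dM; split=> // n u u0 g h.
apply: (@formal_equation R (K u) (fun k => m * dK u k) (M u) (fun j => m * dM j u)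
  (nc_open (K u)) (fun k n => m * d k n u)) => //.
- by rewrite mulr0.
- exact: nc_openE.
- move=> k {}n k0.
  have t1 := tameD (tameM (K_tame k) (dMP n)) (@tame_sum n
    (fun i u => M u i * nc_open (K u) k.+1 (n - i.+1))
    (fun i u => dM i u * nc_open (K u) k.+1 (n - i.+1) + M u i * d k.+1 (n - i.+1)%N u)
    (fun i _ => tameM (dMP i) (dP k.+1 (n - i.+1)%N))).
  have t2 := tame_ext t1 (fun u => esym (nc_openE (K u) k n)) (fun u _ => erefl _).
  rewrite (tame_unique (dP k n) t2) //.
  rewrite mulrDr mulr_sumr; congr (_ + _); first by ring.
  by apply: eq_bigr => i _; ring.
- by move=> k; apply: dKE.
Qed.

(* The coefficients of [m / 2 * G ^ 2] and of [- G ^ 2 G' + G ^ 2 + G']. *)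
Lemma square_coef_tame n : tame
  (fun u => m / 2 * cauchy_prod (cauchy_coef (M u)) (cauchy_coef (M u)) n)
  (fun u => - cauchy_prod (cauchy_prod (cauchy_coef (M u)) (cauchy_coef (M u)))
                (cauchy_deriv_coef (M u)) n
            + cauchy_prod (cauchy_coef (M u)) (cauchy_coef (M u)) n
            + cauchy_deriv_coef (M u) n).
Proof.
have [dM [dMP eqn]] := moment_equation.
have gP i : tame (fun u => cauchy_coef (M u) i) (fun u => cauchy_coef (dM ^~ u) i).
  by case: i => [|i]; [apply: tame_cst|apply: dMP].
have := tameZ (m / 2) (@tame_sum n.+1 _ _ (fun i _ => tameM (gP i) (gP (n - i)%N))).
move=> /tame_ext; apply=> // u u0; rewrite -eqn // /cauchy_prod.
pose g := cauchy_coef (M u); pose dg := cauchy_coef (dM ^~ u).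
have -> : \sum_(i < n.+1) (dg i * g (n - i)%N + g i * dg (n - i)%N)
   = 2 * \sum_(i < n.+1) g i * dg (n - i)%N.
  rewrite big_split /= [X in X + _](_ : _ = \sum_(i < n.+1) g i * dg (n - i)%N).
    by ring.
  rewrite (reindex_inj rev_ord_inj) /=; apply: eq_bigr => i _.
  by rewrite subSS subKn -1?ltnS // mulrC.
rewrite mulrA divfK // mulr_sumr; apply: eq_bigr => i _.
by rewrite mulrCA; congr (_ * _); rewrite /dg; case: (n - i)%N => //=; rewrite mulr0.
Qed.

End Moments.
End Tame.

(** * A maximum principle *)

Section ComplexModulus.
Variable R : realType.
Local Notation C := (Cplx R).
Implicit Types (x y : R) (v w : C).

Lemma RtoCD x y : RtoC (x + y) = RtoC x + RtoC y.
Proof. exact: (rmorphD (real_complex R)). Qed.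
Lemma RtoCN x : RtoC (- x) = - RtoC x.
Proof. exact: (rmorphN (real_complex R)). Qed.
Lemma RtoCB x y : RtoC (x - y) = RtoC x - RtoC y.
Proof. exact: (rmorphB (real_complex R)). Qed.
Lemma RtoCM x y : RtoC (x * y) = RtoC x * RtoC y.
Proof. exact: (rmorphM (real_complex R)). Qed.
Lemma RtoCX x n : RtoC (x ^+ n) = RtoC x ^+ n.
Proof. exact: (rmorphXn (real_complex R)). Qed.
Lemma RtoC0 : RtoC 0 = 0 :> C. Proof. by []. Qed.
Lemma RtoC1 : RtoC 1 = 1 :> C. Proof. by []. Qed.
Lemma RtoC_nat n : RtoC n%:R = n%:R :> C.
Proof. exact: (rmorph_nat (real_complex R)). Qed.
Lemma RtoCV x : RtoC x^-1 = (RtoC x)^-1.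
Proof. exact: (fmorphV (real_complex R)). Qed.
Lemma RtoC_sum n (f : 'I_n -> R) : RtoC (\sum_i f i) = \sum_i RtoC (f i).
Proof. exact: (rmorph_sum (real_complex R)). Qed.
Lemma RtoC_eq0 x : (RtoC x == 0) = (x == 0).
Proof. by rewrite -RtoC0; apply/eqP/eqP => [[]|->]. Qed.

Lemma ReCD v w : ReC (v + w) = ReC v + ReC w. Proof. by case: v; case: w. Qed.
Lemma ImCD v w : ImC (v + w) = ImC v + ImC w. Proof. by case: v; case: w. Qed.
Lemma ImCN w : ImC (- w) = - ImC w. Proof. by case: w. Qed.
Lemma ReCM v w : ReC (v * w) = ReC v * ReC w - ImC v * ImC w.
Proof. by case: v; case: w. Qed.
Lemma ImCM v w : ImC (v * w) = ReC v * ImC w + ImC v * ReC w.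
Proof. by case: v; case: w. Qed.

Lemma norm_absC w : `|w| = RtoC (absC w).
Proof. by case: w => a b. Qed.

Lemma sqr_absC w : absC w ^+ 2 = ReC w ^+ 2 + ImC w ^+ 2.
Proof. by case: w => a b /=; rewrite sqr_sqrtr // addr_ge0 // sqr_ge0. Qed.

Lemma absC_ge0 w : 0 <= absC w.
Proof. by case: w => a b /=; rewrite sqrtr_ge0. Qed.

Lemma absC_RtoC x : absC (RtoC x) = `|x|.
Proof. by rewrite /absC /= expr0n addr0 sqrtr_sqr. Qed.

Lemma absC_real x : 0 <= x -> absC (RtoC x) = x.
Proof. by move=> x0; rewrite absC_RtoC ger0_norm. Qed.

Lemma RtoC_le x y : (RtoC x <= RtoC y) = (x <= y).
Proof. exact: lecR. Qed.
Lemma RtoC_lt x y : (RtoC x < RtoC y) = (x < y).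
Proof. exact: ltcR. Qed.

Lemma absC0 : absC (0 : C) = 0. Proof. by rewrite -RtoC0 absC_real. Qed.
Lemma absC1 : absC (1 : C) = 1. Proof. by rewrite -RtoC1 absC_real. Qed.
Lemma absC_nat n : absC (n%:R : C) = n%:R.
Proof. by rewrite -RtoC_nat absC_real. Qed.

Lemma RtoC_inj : injective (@RtoC R). Proof. by move=> x y []. Qed.

Lemma absCM v w : absC (v * w) = absC v * absC w.
Proof. by apply: RtoC_inj; rewrite RtoCM -!norm_absC normrM. Qed.
Lemma absCN w : absC (- w) = absC w.
Proof. by apply: RtoC_inj; rewrite -!norm_absC normrN. Qed.
Lemma absCD v w : absC (v + w) <= absC v + absC w.
Proof. by rewrite -RtoC_le RtoCD -!norm_absC ler_normD. Qed.
Lemma absCB v w : absC (v - w) <= absC v + absC w.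
Proof. by rewrite -RtoC_le RtoCD -!norm_absC ler_normB. Qed.
Lemma absC_dist v w : absC (v - w) = absC (w - v).
Proof. by rewrite -absCN opprB. Qed.
Lemma absCX w n : absC (w ^+ n) = absC w ^+ n.
Proof. by apply: RtoC_inj; rewrite RtoCX -!norm_absC normrX. Qed.
Lemma absCV w : absC w^-1 = (absC w)^-1.
Proof. by apply: RtoC_inj; rewrite RtoCV -!norm_absC normfV. Qed.
Lemma absC_eq0 w : (absC w == 0) = (w == 0).
Proof. by rewrite -RtoC_eq0 -norm_absC normr_eq0. Qed.
Lemma absC_gt0 w : (0 < absC w) = (w != 0).
Proof. by rewrite lt_def absC_ge0 andbT absC_eq0. Qed.
Lemma absC_sum n (f : 'I_n -> C) : absC (\sum_i f i) <= \sum_i absC (f i).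
Proof.
elim/big_ind2: _ => [|a b c d ab cd|//]; first by rewrite absC0.
by apply: le_trans (absCD _ _) _; rewrite lerD.
Qed.

Lemma le_ReC w : `|ReC w| <= absC w.
Proof. by case: w => a b; rewrite /= -sqrtr_sqr ler_wsqrtr // lerDl sqr_ge0. Qed.
Lemma le_ImC w : `|ImC w| <= absC w.
Proof. by case: w => a b; rewrite /= -sqrtr_sqr ler_wsqrtr // lerDr sqr_ge0. Qed.

Lemma absC_le_ReIm w : absC w <= `|ReC w| + `|ImC w|.
Proof.
rewrite -(@ler_pXn2r _ 2) ?nnegrE ?absC_ge0 ?addr_ge0 // sqr_absC.
rewrite -[ReC w ^+ 2]real_normK ?num_real // -[ImC w ^+ 2]real_normK ?num_real //.
have : 0 <= `|ReC w| * `|ImC w| by rewrite mulr_ge0.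
by rewrite sqrrD; lra.
Qed.

Lemma absC_lerB v w : absC v - absC w <= absC (v - w).
Proof. by rewrite lerBlDr; apply: le_trans (absCD _ _); rewrite subrK. Qed.

End ComplexModulus.

(** * Second-order expansions at a point, and the maximum principle on a rectangle *)

Section Taylor.
Variable R : realType.
Local Notation C := (Cplx R).
Implicit Types (F G : C -> C) (w : C).

Definition bounded_near0 (f : C -> C) :=
  exists K r : R, 0 < r /\ forall h, absC h < r -> absC (f h) <= K.

Lemma bounded_near0_cst c : bounded_near0 (fun=> c).
Proof. by exists (absC c), 1. Qed.

Lemma bounded_near0_id : bounded_near0 id.
Proof. by exists 1, 1; split=> // h /ltW. Qed.

Lemma bounded_near0D f g : bounded_near0 f -> bounded_near0 g ->
  bounded_near0 (fun h => f h + g h).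
Proof.
move=> [K [r [r0 fK]]] [L [s [s0 gL]]]; exists (K + L), (Num.min r s).
split=> [|h]; first by rewrite lt_min r0.
by rewrite lt_min => /andP[/fK ? /gL ?]; apply: le_trans (absCD _ _) (lerD _ _).
Qed.

Lemma bounded_near0M f g : bounded_near0 f -> bounded_near0 g ->
  bounded_near0 (fun h => f h * g h).
Proof.
move=> [K [r [r0 fK]]] [L [s [s0 gL]]]; exists (K * L), (Num.min r s).
split=> [|h]; first by rewrite lt_min r0.
by rewrite lt_min => /andP[/fK ? /gL ?]; rewrite absCM ler_pM ?absC_ge0.
Qed.

Lemma bounded_near0X f n : bounded_near0 f -> bounded_near0 (fun h => f h ^+ n).
Proof.
move=> fb; elim: n => [|n IH]; first exact: bounded_near0_cst.
have [K [r [r0 H]]] := bounded_near0M fb IH; exists K, r; split=> // h /H.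
by rewrite exprS.
Qed.

(** This is all the complex differentiability that the maximum principle uses: a mean over four
    directions leaves an error of order 3, which is beaten by any positive multiple of [h ^+ 2]. *)
Definition taylor2 F w := exists (a b : C) (K r : R), 0 < r /\
  forall h, absC h < r ->
    absC (F (w + h) - F w - a * h - b * h ^+ 2) <= K * absC h ^+ 3.

Lemma taylor2P F w : taylor2 F w <-> exists (a b : C) (rho : C -> C),
  bounded_near0 rho /\ forall h, F (w + h) = F w + a * h + b * h ^+ 2 + h ^+ 3 * rho h.
Proof.
split=> [[a [b [K [r [r0 FK]]]]]|[a [b [rho [[K [r [r0 rK]]] FE]]]]]; last first.
  exists a, b, K, r; split=> // h hr.
  rewrite FE (_ : _ - _ = h ^+ 3 * rho h); last by ring.
  by rewrite absCM absCX mulrC ler_wpM2r ?exprn_ge0 ?absC_ge0 // rK.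
exists a, b, (fun h => (F (w + h) - F w - a * h - b * h ^+ 2) / h ^+ 3).
split=> [|h].
  exists (Num.max K 0), r; split=> // h hr.
  have [->|h0] := eqVneq h 0.
    by rewrite !expr0n /= invr0 mulr0 absC0 le_max lexx orbT.
  rewrite absCM absCV absCX ler_pdivrMr ?exprn_gt0 ?absC_gt0 //.
  apply: le_trans (FK _ hr) _; rewrite ler_wpM2r ?exprn_ge0 ?absC_ge0 //.
  by rewrite le_max lexx.
have [->|h0] := eqVneq h 0; first by rewrite addr0 !expr0n /= !mulr0 mul0r !addr0.
by rewrite [_ ^+ 3 * _]mulrC divfK ?expf_neq0 //; ring.
Qed.

Lemma taylor2_cst c w : taylor2 (fun=> c) w.
Proof.
apply/taylor2P; exists 0, 0, (fun=> 0); split=> [|h]; last by ring.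
exact: bounded_near0_cst.
Qed.

Lemma taylor2_id w : taylor2 id w.
Proof.
apply/taylor2P; exists 1, 0, (fun=> 0); split=> [|h]; last by ring.
exact: bounded_near0_cst.
Qed.

Lemma taylor2D F G w : taylor2 F w -> taylor2 G w -> taylor2 (fun v => F v + G v) w.
Proof.
move=> /taylor2P[a [b [rho [rb FE]]]] /taylor2P[c [d [sig [sb GE]]]].
apply/taylor2P; exists (a + c), (b + d), (fun h => rho h + sig h).
by split=> [|h]; [exact: bounded_near0D | rewrite FE GE; ring].
Qed.

Lemma taylor2M F G w : taylor2 F w -> taylor2 G w -> taylor2 (fun v => F v * G v) w.
Proof.
move=> /taylor2P[a [b [rho [rb FE]]]] /taylor2P[c [d [sig [sb GE]]]].
apply/taylor2P; exists (a * G w + F w * c), (b * G w + a * c + F w * d),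
  (fun h => (a * d + b * c) + (b * d) * h
   + rho h * (G w + c * h + d * h ^+ 2 + h ^+ 3 * sig h)
   + (F w + a * h + b * h ^+ 2) * sig h).
split=> [|h]; last by rewrite FE GE; ring.
have cb := bounded_near0_cst; have ib := bounded_near0_id.
have Xb n := bounded_near0X n ib.
by repeat first [exact: cb | exact: ib | exact: rb | exact: sb | exact: (Xb 2)
  | exact: (Xb 3) | apply: bounded_near0D | apply: bounded_near0M].
Qed.

Lemma taylor2Z c F w : taylor2 F w -> taylor2 (fun v => c * F v) w.
Proof. by move=> tF; apply: taylor2M => //; apply: taylor2_cst. Qed.

Lemma taylor2X F n w : taylor2 F w -> taylor2 (fun v => F v ^+ n) w.
Proof.
move=> tF; elim: n => [|n IH]; first exact: taylor2_cst.
have := taylor2M tF IH.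
by rewrite (_ : (fun v => F v * _) = (fun v => F v ^+ n.+1)) // funeqE => v; rewrite exprS.
Qed.

Lemma taylor2_prod n (F : nat -> C -> C) w :
  (forall i, taylor2 (F i) w) -> taylor2 (fun v => \prod_(i < n) F i v) w.
Proof.
move=> tF; elim: n => [|n IH].
  rewrite (_ : (fun v => _) = (fun=> 1)); first exact: taylor2_cst.
  by rewrite funeqE => v; rewrite big_ord0.
have := taylor2M IH (tF n).
rewrite (_ : (fun v => _ * F n v) = (fun v => \prod_(i < n.+1) F i v)) //.
by rewrite funeqE => v; rewrite big_ord_recr.
Qed.

Lemma taylor2_sum n (F : nat -> C -> C) w :
  (forall i, taylor2 (F i) w) -> taylor2 (fun v => \sum_(i < n) F i v) w.
Proof.
move=> tF; elim: n => [|n IH].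
  rewrite (_ : (fun v => _) = (fun=> 0)); first exact: taylor2_cst.
  by rewrite funeqE => v; rewrite big_ord0.
have := taylor2D IH (tF n).
rewrite (_ : (fun v => _ + F n v) = (fun v => \sum_(i < n.+1) F i v)) //.
by rewrite funeqE => v; rewrite big_ord_recr.
Qed.

Lemma taylor2_affine F c d w : taylor2 F (c * w + d) -> taylor2 (fun v => F (c * v + d)) w.
Proof.
move=> /taylor2P[a [b [rho [[K [r [r0 rK]]] FE]]]]; apply/taylor2P.
exists (a * c), (b * c ^+ 2), (fun h => c ^+ 3 * rho (c * h)); split=> [|h]; last first.
  by rewrite mulrDr addrAC FE; ring.
apply: bounded_near0M; first exact: bounded_near0_cst.
exists K, (r / (absC c + 1)).
have c1 : 0 < absC c + 1 by rewrite ltr_wpDl ?absC_ge0.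
split=> [|h hr]; first by rewrite divr_gt0.
apply: rK; rewrite absCM; apply: le_lt_trans (_ : (absC c + 1) * absC h < r).
  by rewrite ler_wpM2r ?absC_ge0 // lerDl.
by rewrite mulrC -ltr_pdivlMr.
Qed.

Lemma inv_taylor v h : v != 0 -> v + h != 0 :> C ->
  (v + h)^-1 - v^-1 + h / v ^+ 2 - h ^+ 2 / v ^+ 3 = - h ^+ 3 / (v ^+ 3 * (v + h)).
Proof. by move=> v0 vh0; field; rewrite ?v0 ?vh0. Qed.

Lemma taylor2_inv c w : w + c != 0 -> taylor2 (fun v => (v + c)^-1) w.
Proof.
move=> wc; have a0 : 0 < absC (w + c) by rewrite absC_gt0.
exists (- (w + c) ^- 2), ((w + c) ^- 3), (2 / absC (w + c) ^+ 4), (absC (w + c) / 2).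
split=> [|h hr]; first by rewrite divr_gt0.
have lb : absC (w + c) / 2 <= absC (w + c + h).
  have := absC_lerB (w + c) (- h); rewrite opprK absCN; lra.
have vh : w + c + h != 0 by rewrite -absC_gt0; apply: lt_le_trans lb; rewrite divr_gt0.
have -> : (w + h + c)^-1 - (w + c)^-1 - - (w + c) ^- 2 * h - (w + c) ^- 3 * h ^+ 2
  = - h ^+ 3 / ((w + c) ^+ 3 * (w + c + h)).
  rewrite -inv_taylor // [w + h + c]addrAC.
  by move: (w + c)^-1 (w + c + h)^-1 ((w + c) ^- 2) ((w + c) ^- 3) => x1 x2 x3 x4; ring.
rewrite mulNr absCN absCM absCV absCM !absCX mulrC ler_wpM2r ?exprn_ge0 ?absC_ge0 //.
rewrite -[leRHS]invrK lef_pV2 ?posrE ?mulr_gt0 ?exprn_gt0 //; last 2 first.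
  by rewrite absC_gt0.
  by rewrite invr_gt0 divr_gt0 // exprn_gt0.
rewrite invf_div (_ : _ / 2 = absC (w + c) ^+ 3 * (absC (w + c) / 2)); last first.
  by rewrite exprSr mulrA.
by rewrite ler_wpM2l ?exprn_ge0 // ltW.
Qed.

Lemma taylor2_lipschitz F w : taylor2 F w -> exists K r : R, [/\ 0 < r, 0 <= K
  & forall h, absC h < r -> absC (F (w + h) - F w) <= K * absC h].
Proof.
move=> [a [b [K [r [r0 FK]]]]].
exists (`|K| + absC a + absC b), (Num.min r 1); split=> [||h].
- by rewrite lt_min r0 /=.
- by rewrite !addr_ge0 ?absC_ge0.
rewrite lt_min => /andP[hr h1]; have h0 := absC_ge0 h; have H := FK h hr.
rewrite (_ : F (w + h) - F w = (F (w + h) - F w - a * h - b * h ^+ 2)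
   + (a * h + b * h ^+ 2)); last by ring.
apply: le_trans (absCD _ _) _; apply: le_trans (lerD H (absCD _ _)) _.
rewrite (absCM a) (absCM b) absCX.
have a0 := absC_ge0 a; have b0 := absC_ge0 b.
have h2 : absC h ^+ 2 <= absC h by rewrite ler_piMl // ltW.
have h3 : absC h ^+ 3 <= absC h.
  by rewrite exprS ler_piMr // exprn_ile1 // ltW.
rewrite mulrDl mulrDl -addrA lerD //; last by rewrite lerD // ler_wpM2l.
apply: le_trans (_ : `|K| * absC h ^+ 3 <= _); last by rewrite ler_wpM2l.
by rewrite ler_wpM2r ?exprn_ge0 // ler_norm.
Qed.

(* Averaging over [w + h], [w + i h], [w - h], [w - i h] kills the terms of
   order 1 and 2. *)
Lemma taylor2_mean4 F w : taylor2 F w -> exists K r : R, [/\ 0 < r, 0 <= K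
  & forall h : R, 0 < h < r -> 4 * absC (F w) <=
     absC (F (w + Complex h 0)) + absC (F (w + Complex (- h) 0))
     + absC (F (w + Complex 0 h)) + absC (F (w + Complex 0 (- h))) + K * h ^+ 3].
Proof.
move=> [a [b [K [r [r0 FK]]]]]; exists (4 * `|K|), r; split=> // h /andP[h0 hr].
pose e (v : C) := F (w + v) - F w - a * v - b * v ^+ 2.
have eK (v : C) : absC v = h -> absC (e v) <= `|K| * h ^+ 3.
  move=> vh; rewrite -vh; apply: le_trans (FK _ _) _; first by rewrite vh.
  by rewrite ler_wpM2r ?exprn_ge0 ?absC_ge0 // ler_norm.
have abs1 (c d : R) : c ^+ 2 + d ^+ 2 = h ^+ 2 -> absC (Complex c d : C) = h.
  move=> cd; apply/eqP; rewrite -(@eqrXn2 _ 2) ?absC_ge0 //; last exact: ltW.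
  by rewrite sqr_absC cd.
have e1 := eK (Complex h 0) (abs1 _ _ _).
have e2 := eK (Complex (- h) 0) (abs1 _ _ _).
have e3 := eK (Complex 0 h) (abs1 _ _ _).
have e4 := eK (Complex 0 (- h)) (abs1 _ _ _).
have {e1} := e1 _; rewrite expr0n addr0 => /(_ erefl) e1.
have {e2} := e2 _; rewrite expr0n addr0 sqrrN => /(_ erefl) e2.
have {e3} := e3 _; rewrite expr0n add0r => /(_ erefl) e3.
have {e4} := e4 _; rewrite expr0n add0r sqrrN => /(_ erefl) e4.
have ii : (Complex 0 h : C) = 'i%C * Complex h 0.
  by apply/eqP; rewrite eq_complex /= !mul0r !mul1r subrr add0r !eqxx.
have n2 : (Complex (- h) 0 : C) = - Complex h 0.
  by apply/eqP; rewrite eq_complex /= oppr0 !eqxx.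
have n4 : (Complex 0 (- h) : C) = - ('i%C * Complex h 0).
  by rewrite -ii; apply/eqP; rewrite eq_complex /= oppr0 !eqxx.
have i2 : 'i%C ^+ 2 = -1 :> C by exact: sqr_i.
have sum4 : 4 * F w = F (w + Complex h 0) + F (w + Complex (- h) 0)
   + F (w + Complex 0 h) + F (w + Complex 0 (- h))
   - (e (Complex h 0) + e (Complex (- h) 0) + (e (Complex 0 h) + e (Complex 0 (- h)))).
  rewrite /e n2 ii n4; move: i2; set i := 'i%C; set u : C := Complex h 0 => i2.
  have -> : b * (i * u) ^+ 2 = - (b * u ^+ 2) by rewrite exprMn i2; ring.
  have -> : b * (- (i * u)) ^+ 2 = - (b * u ^+ 2) by rewrite sqrrN exprMn i2; ring.
  by ring.
rewrite -[4 * absC _](_ : absC (4 * F w) = _); last by rewrite absCM absC_nat.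
rewrite sum4; apply: le_trans (absCB _ _) _; apply: lerD.
  do 2 (apply: le_trans (absCD _ _) _; rewrite lerD2r).
  exact: absCD.
apply: le_trans (absCD _ _) _.
have := absCD (e (Complex h 0)) (e (Complex (- h) 0)).
have := absCD (e (Complex 0 h)) (e (Complex 0 (- h))).
by move: e1 e2 e3 e4; lra.
Qed.

Definition in_square (V : R) (w : C) := (0 <= ReC w <= V) && (`|ImC w| <= V).

(** At an interior maximum of [|F| + eps |w|^2], the mean over four points at distance [h] would
    exceed the central value by at least [eps h^2 - O(h^3)]. The quadratic term replaces the usual
    argument on the equality case. *)
Lemma max_principle F (V A : R) : 0 < V ->
  (forall w, in_square V w -> taylor2 F w) ->
  (forall w, in_square V w -> ReC w = 0 \/ ReC w = V \/ `|ImC w| = V ->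
     absC (F w) <= A) ->
  forall w, in_square V w -> absC (F w) <= A.
Proof.
move=> V0 tF bF w1 w1V; rewrite leNgt; apply/negP => w1A.
(* On the rectangle [|w|^2 <= 2 V^2], so the perturbation costs at most half of the excess of
   [|F w1|] over [A]; the maximum point then still has [|F| > A] and is not on the boundary. *)
pose eps := (absC (F w1) - A) / (4 * V ^+ 2).
have V2 : 0 < V ^+ 2 by rewrite exprn_gt0.
have eps0 : 0 < eps by rewrite divr_gt0 ?mulr_gt0 // subr_gt0.
have epsE : 4 * (eps * V ^+ 2) = absC (F w1) - A.
  by rewrite mulrCA -[_ * (4 * _)]/(_ / _ * _) divfK // gt_eqF ?mulr_gt0.
pose z (p : R * R) : C := Complex p.1 p.2.
pose U (p : R * R) : R := absC (F (z p)) + eps * (p.1 ^+ 2 + p.2 ^+ 2).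
pose Q : set (R * R) := (`[0, V]%classic `*` `[- V, V]%classic)%classic.
have QP p : Q p <-> in_square V (z p).
  rewrite /Q /in_square /= !in_itv /= ler_norml.
  by split=> [[-> ->]//|/andP[]].
have cU : {within Q, continuous U}%classic.
  apply: continuous_in_subspaceT => p; rewrite inE => /QP /tF /taylor2_lipschitz.
  move=> [K [r [r0 K0 HK]]].
  apply: cvgD; last first.
    apply: cvgM; first exact: cvg_cst.
    by apply: cvgD; rewrite -?topredE; apply: cvgM; first [exact: cvg_fst | exact: cvg_snd].
  apply/cvgrPdist_le => e e0.
  set d := Num.min (r / 2) (e / (K + 1)).
  have d0 : 0 < d / 2 by rewrite divr_gt0 // lt_min !divr_gt0 //; lra.
  near=> q.
  pose h : C := Complex (q.1 - p.1) (q.2 - p.2).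
  have hE : z q = z p + h.
    by apply/eqP; rewrite eq_complex /= addrC subrK addrC subrK !eqxx.
  have hs : absC h <= d.
    apply: le_trans (absC_le_ReIm _) _.
    have : `|p.1 - q.1| < d / 2 /\ `|p.2 - q.2| < d / 2.
      by near: q; exact: (near_ball p (d / 2) d0).
    by rewrite (distrC p.1) (distrC p.2) /= => -[]; lra.
  move: hs; rewrite le_min => /andP[h1 h2].
  have hr : absC h < r by apply: le_lt_trans h1 _; lra.
  have := HK _ hr; rewrite -hE => H.
  have hK : K * absC h <= e.
    apply: le_trans (_ : (K + 1) * absC h <= _).
      by rewrite ler_wpM2r ?absC_ge0 // lerDl.
    by rewrite mulrC -ler_pdivlMr //; lra.
  rewrite ler_norml; have := absC_lerB (F (z p)) (F (z q)).
  have := absC_lerB (F (z q)) (F (z p)); rewrite (absC_dist (F (z p))); lra.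
have Q0 : (Q !=set0)%classic.
  by exists (ReC w1, ImC w1); apply/QP; move: w1V; rewrite /z; case: (w1).
have cQ : compact Q by apply: compact_setX; apply: segment_compact.
have [p pQ pmax] := compact_EVT_max Q0 cQ cU.
move: pQ; rewrite inE => /QP pV.
have UV q : in_square V (z q) -> q.1 ^+ 2 + q.2 ^+ 2 <= 2 * V ^+ 2.
  move=> /andP[/andP[/= q0 q1] q2].
  have : q.1 ^+ 2 <= V ^+ 2 by rewrite ler_pXn2r ?nnegrE //; lra.
  have : q.2 ^+ 2 <= V ^+ 2.
    by rewrite -[q.2 ^+ 2]real_normK ?num_real // ler_pXn2r ?nnegrE //; lra.
  lra.
have pU : absC (F w1) <= U p.
  have w1E : z (ReC w1, ImC w1) = w1 by rewrite /z; case: (w1).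
  have : U (ReC w1, ImC w1) <= U p by apply: pmax; rewrite inE; apply/QP; rewrite w1E.
  apply: le_trans; rewrite /U w1E lerDl mulr_ge0 ?addr_ge0 ?sqr_ge0 //; exact: ltW.
have pA : A < absC (F (z p)).
  have := UV p pV; rewrite -(ler_pM2l eps0) => H.
  have : 0 < eps * V ^+ 2 by rewrite mulr_gt0.
  by move: pU; rewrite /U; lra.
have interior : [/\ 0 < p.1, p.1 < V & `|p.2| < V].
  have nb := bF _ pV; have /andP[/andP[/= p0 p1] p2] := pV.
  split; rewrite lt_neqAle ?p0 ?p1 ?p2 andbT; apply/eqP => H.
  - by have := nb (or_introl (esym H)); lra.
  - by have := nb (or_intror (or_introl H)); lra.
  - by have := nb (or_intror (or_intror H)); lra.
have [p1 p2 p3] := interior; move: (p3); rewrite ltr_norml => /andP[p4 p5].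
have [K [r [r0 K0 HK]]] := taylor2_mean4 (tF _ pV).
pose d := Num.min (Num.min r (eps / (K + 1))) (Num.min (Num.min p.1 (V - p.1))
   (Num.min (V - p.2) (V + p.2))).
have d0 : 0 < d.
  by rewrite !lt_min r0 divr_gt0 ?p1 ?subr_gt0 ?p2 ?p5 //=; lra.
pose h := d / 2.
have h0 : 0 < h by rewrite divr_gt0.
have hd : h < d by rewrite /h; lra.
move: (hd); rewrite /d !lt_min => /andP[/andP[hr hK]] /andP[/andP[h1 h2] /andP[h3 h4]].
have step (a b : R) : `|a| <= h -> `|b| <= h ->
    absC (F (z p + Complex a b)) + eps * ((p.1 + a) ^+ 2 + (p.2 + b) ^+ 2) <= U p.
  move=> ah bh.
  have -> : z p + Complex a b = z (p.1 + a, p.2 + b) by [].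
  apply: (pmax (p.1 + a, p.2 + b)); rewrite inE; apply/QP.
  move: ah bh; rewrite !ler_norml => /andP[a1 a2] /andP[b1 b2].
  rewrite /in_square /= ler_norml; clear - h1 h2 h3 h4 a1 a2 b1 b2; apply/andP; split; apply/andP; split; lra.
have hh : `|h| <= h by rewrite gtr0_norm.
have hN : `|- h| <= h by rewrite normrN.
have n0 : `|0 : R| <= h by rewrite normr0 ltW.
have := HK h; rewrite h0 hr => /(_ isT).
have := step h 0 hh n0; have := step (- h) 0 hN n0.
have := step 0 h n0 hh; have := step 0 (- h) n0 hN.
rewrite /U.
have : K * h ^+ 3 < 4 * (eps * h ^+ 2).
  rewrite [ltLHS](_ : _ = K * h * h ^+ 2); last by ring.
  rewrite [ltRHS]mulrA ltr_pM2r ?exprn_gt0 //.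
  apply: le_lt_trans (_ : (K + 1) * h < _); first by rewrite ler_pM2r // lerDl.
  by move: hK; rewrite ltr_pdivlMr ?ltr_wpDl // mulrC; lra.
set f1 := absC _; set f2 := absC _; set f3 := absC _; set f4 := absC _; set f5 := absC _.
lra.
Unshelve. all: by end_near.
Qed.

End Taylor.

(** * Quasianalyticity *)

Section Multiplier.
Variable R : realType.
Local Notation C := (Cplx R).

Lemma bernoulli_ineq (y : R) n : 0 <= y -> 1 + n%:R * y <= (1 + y) ^+ n.
Proof.
move=> y0; elim: n => [|n IH]; first by rewrite mul0r addr0.
rewrite exprS; apply: le_trans (_ : (1 + y) * (1 + n%:R * y) <= _); last first.
  by rewrite ler_wpM2l // addr_ge0.
have : 0 <= n%:R * y ^+ 2 by rewrite mulr_ge0 // sqr_ge0.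
by rewrite -[n.+1%:R]natr1; lra.
Qed.

Variable kappa : R.
Hypothesis kappa01 : 0 <= kappa <= 1.

Definition mult_factor (b : R) (w : C) : C :=
  1 + RtoC kappa * (w * (w + RtoC b)^-1).

(** The exponent [2 ^ k] matches the pole [- 2 ^ k]. Once [2 ^ k] is large compared with [|w|], a
    factor has modulus about [exp (kappa Re w)], so the product diverges inside the half-plane. On
    the axis its logarithm is only of order [kappa |w|^2 / 2 ^ k], which is summable. *)
Definition mult (N : nat) (w : C) : C :=
  \prod_(k < N) mult_factor (2 ^+ k) w ^+ (2 ^ k)%N.

Let shift_neq0 (b : R) w : 0 < b -> 0 <= ReC w -> w + RtoC b != 0.
Proof.
move=> b0 w0; apply/eqP => /(congr1 (@ReC R)); rewrite ReCD /=.
by move: b0 w0; case: w => /= *; lra.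
Qed.

Lemma taylor2_mult N w : 0 <= ReC w -> taylor2 (mult N) w.
Proof.
move=> w0.
apply: (@taylor2_prod _ N (fun k v => mult_factor (2 ^+ k) v ^+ (2 ^ k)%N)) => k.
apply: taylor2X.
apply: taylor2D; first exact: taylor2_cst.
apply: taylor2Z; apply: taylor2M; first exact: taylor2_id.
by apply: taylor2_inv; apply: shift_neq0 => //; rewrite exprn_gt0.
Qed.

Lemma absC_shift (b : R) (w : C) : 0 <= b -> 0 <= ReC w -> absC w <= absC (w + RtoC b).
Proof.
move=> b0 w0; rewrite -(@ler_pXn2r _ 2) ?nnegrE ?absC_ge0 // !sqr_absC.
rewrite ReCD ImCD /= addr0 lerD2r ler_pXn2r ?nnegrE ?addr_ge0 //.
by rewrite lerDl.
Qed.

Let ratio_le1 (b : R) w : 0 < b -> 0 <= ReC w -> absC (w * (w + RtoC b)^-1) <= 1.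
Proof.
move=> b0 w0; rewrite absCM absCV ler_pdivrMr ?mul1r ?absC_gt0 ?shift_neq0 //.
by apply: absC_shift => //; apply: ltW.
Qed.

(** Each factor is at most [1 + kappa <= 2] and the exponents add up to [2 ^ N - 1]. This crude
    bound serves where smallness can still be arranged after [N] is fixed. *)
Lemma mult_upper N w : 0 <= ReC w -> absC (mult N w) <= 2 ^+ (2 ^ N).
Proof.
move=> w0; elim: N => [|N IH]; first by rewrite /mult big_ord0 absC1 ler1n.
rewrite /mult big_ord_recr /= absCM expnS mul2n -addnn exprD.
apply: ler_pM; rewrite ?absC_ge0 // absCX lerXn2r ?nnegrE ?absC_ge0 //.
apply: le_trans (absCD _ _) _; rewrite absC1 absCM absC_RtoC.
have := ratio_le1 (exprn_gt0 N (ltr0Sn R 1)) w0.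
have := absC_ge0 (w * (w + RtoC (2 ^+ N))^-1).
case/andP: kappa01 => k0 k1; rewrite (ger0_norm k0).
set u := absC _ => u0 u1; have : kappa * u <= 1 * 1 by rewrite ler_pM.
lra.
Qed.

Lemma sqr_absC_factor (b s : R) : 0 < b ->
  absC (mult_factor b (Complex 0 s)) ^+ 2 =
  1 + (2 * kappa + kappa ^+ 2) * (s ^+ 2 / (s ^+ 2 + b ^+ 2)).
Proof.
move=> b0; have bs : 0 < s ^+ 2 + b ^+ 2 by rewrite ltr_wpDl ?sqr_ge0 ?exprn_gt0.
have w0 : Complex 0 s + RtoC b != 0 :> C by apply: shift_neq0.
have -> : mult_factor b (Complex 0 s) =
  (RtoC b + Complex 0 ((1 + kappa) * s)) * (Complex 0 s + RtoC b)^-1.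
  rewrite /mult_factor -[1 in LHS](mulfV w0) mulrA -mulrDl; congr (_ * _).
  by apply/eqP; rewrite eq_complex /= !mul0r !subr0 !add0r !addr0; apply/andP; split; apply/eqP; ring.
rewrite absCM exprMn absCV exprVn !sqr_absC !ReCD !ImCD /= !addr0 !add0r.
by field; rewrite gt_eqF.
Qed.

(** Telescoping against [4 s b / (s + b)] along [b = 2 ^ k]; one step amounts to
    [(s + b)(s + 2 b) <= 4 (s^2 + b^2)]. *)
Lemma dyadic_sum (s : R) N : 0 <= s ->
  \sum_(k < N) 2 ^+ k * (s ^+ 2 / (s ^+ 2 + (2 ^+ k) ^+ 2)) <= 4 * s.
Proof.
rewrite le_eqVlt => /orP[/eqP <-|s0].
  by rewrite mulr0 big1 // => k _; rewrite expr0n mul0r mulr0.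
have phi : \sum_(k < N) 2 ^+ k * (s ^+ 2 / (s ^+ 2 + (2 ^+ k) ^+ 2))
    <= 4 * s * (2 ^+ N / (s + 2 ^+ N)) - 4 * s * (1 / (s + 1)).
  elim: N => [|N IH]; first by rewrite big_ord0 expr0 subrr.
  rewrite big_ord_recr /= [2 ^+ N.+1]exprS; move: IH; set b := 2 ^+ N => IH.
  have b0 : 0 < b by rewrite exprn_gt0.
  have D1 : 0 < s ^+ 2 + b ^+ 2 by rewrite addr_gt0 ?exprn_gt0.
  have D2 : 0 < s + b by rewrite addr_gt0.
  have D3 : 0 < s + 2 * b by rewrite addr_gt0 // mulr_gt0.
  have -> : 4 * s * (2 * b / (s + 2 * b)) = 4 * s * (b / (s + b))
     + b * (s ^+ 2 * (4 / ((s + 2 * b) * (s + b)))).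
    by field; rewrite !gt_eqF.
  have H : b * (s ^+ 2 / (s ^+ 2 + b ^+ 2)) <= b * (s ^+ 2 * (4 / ((s + 2 * b) * (s + b)))).
    rewrite ler_pM2l // ler_pM2l ?exprn_gt0 // ler_pdivlMr ?mulr_gt0 //.
    rewrite mulrC ler_pdivrMr //.
    have := sqr_ge0 (s - b); have := sqr_ge0 s; have := sqr_ge0 b; lra.
  lra.
apply: le_trans phi _; rewrite -mulrBr ler_piMr ?mulr_ge0 ?ltW //.
have : 2 ^+ N / (s + 2 ^+ N) <= 1.
  rewrite ler_pdivrMr ?mul1r ?lerDr ?ltW // addr_gt0 ?exprn_gt0 //.
have : 0 < 1 / (s + 1) by rewrite divr_gt0 // addr_gt0.
lra.
Qed.

(** The constant is [12 = 3 * 4]: [2 kappa + kappa^2 <= 3 kappa] in each factor, and 4 from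
    [dyadic_sum]. *)
Lemma mult_axis N (s : R) :
  absC (mult N (Complex 0 s)) ^+ 2 <= expR (12 * kappa * `|s|).
Proof.
have [k0 k1] := andP kappa01.
have step : absC (mult N (Complex 0 s)) ^+ 2 <= expR (3 * kappa *
    \sum_(k < N) 2 ^+ k * (s ^+ 2 / (s ^+ 2 + (2 ^+ k) ^+ 2))).
  elim: N => [|N IH]; first by rewrite /mult !big_ord0 absC1 expr1n mulr0 expR0.
  rewrite /mult !big_ord_recr /= absCM exprMn mulrDr expRD.
  apply: ler_pM; rewrite ?exprn_ge0 ?absC_ge0 //.
  have b0 : 0 < 2 ^+ N :> R by rewrite exprn_gt0.
  rewrite absCX [in leLHS]exprAC sqr_absC_factor //.
  set q := s ^+ 2 / _.
  have q0 : 0 <= q by rewrite divr_ge0 ?addr_ge0 ?sqr_ge0.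
  rewrite [in leRHS]mulrCA -natrX expRM_natl.
  rewrite lerXn2r ?nnegrE ?expR_ge0 //.
    by rewrite addr_ge0 // mulr_ge0 // addr_ge0 ?sqr_ge0 // mulr_ge0.
  apply: le_trans (expR_ge1Dx _); rewrite lerD2l ler_wpM2r //.
  have : kappa ^+ 2 <= kappa by rewrite ler_piMr.
  lra.
apply: le_trans step _; rewrite ler_expR.
rewrite -[s ^+ 2]real_normK ?num_real //.
have := dyadic_sum N (normr_ge0 s); set S := \sum_(k < N) _ => H.
have : 3 * kappa * S <= 3 * kappa * (4 * `|s|) by rewrite ler_wpM2l // mulr_ge0.
lra.
Qed.

(** Once [b = 2 ^ k >= |w|], one has [|w + b| <= 2 b], so the factor is at least [1 + y / b] with
    [y = kappa Re w / 4], and its power of exponent [b] is at least [1 + y] by the Bernoulli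
    inequality. The earlier factors are at least 1. *)
Lemma mult_lower (w : C) : 0 < kappa -> 0 < ReC w ->
  forall A : R, exists N, A <= absC (mult N w).
Proof.
move=> k0 w0 A.
have w00 := ltW w0.
have fac (b : R) : 0 < b -> 1 + kappa * (b * ReC w / absC (w + RtoC b) ^+ 2)
    <= absC (mult_factor b w).
  move=> b0; have wb := shift_neq0 b0 w00.
  have d0 : 0 < absC (w + RtoC b) ^+ 2 by rewrite exprn_gt0 ?absC_gt0.
  apply: le_trans (le_ReC _); apply: le_trans (ler_norm _).
  have -> : ReC (mult_factor b w) = 1 + kappa *
      ((absC w ^+ 2 + b * ReC w) / absC (w + RtoC b) ^+ 2).
    rewrite /mult_factor ReCD ReCM mul0r subr0; congr (1 + kappa * _).
    have -> : w * (w + RtoC b)^-1 = w * Complex (ReC w + b) (- ImC w)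
        * RtoC (absC (w + RtoC b) ^- 2).
      rewrite -mulrA; congr (_ * _); apply: (mulfI wb); rewrite mulfV //.
      rewrite mulrA (_ : (w + RtoC b) * _ = RtoC (absC (w + RtoC b) ^+ 2)).
        by rewrite -RtoCM mulfV // gt_eqF.
      rewrite sqr_absC; case: (w) => x y; apply/eqP; rewrite eq_complex /=.
      by apply/andP; split; apply/eqP; ring.
    rewrite ReCM mulr0 subr0; congr (_ * _); rewrite sqr_absC ReCM /=.
    by ring.
  rewrite lerD2l ler_pM2l // ler_pM2r ?invr_gt0 // lerDr.
  by rewrite sqr_ge0.
have ge1 (b : R) : 0 < b -> 1 <= absC (mult_factor b w).
  move=> b0; apply: le_trans (fac b b0); rewrite lerDl mulr_ge0 ?(ltW k0) //.
  by rewrite divr_ge0 ?exprn_ge0 ?absC_ge0 // mulr_ge0 // ltW.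
have [k0' k0P] : exists k, absC w <= 2 ^+ k.
  exists (Num.bound (absC w)); apply: ltW; apply: lt_trans (archi_boundP (absC_ge0 w)) _.
  by rewrite -natrX ltr_nat ltn_expl.
pose y := kappa * (ReC w / 4).
have y0 : 0 < y by rewrite mulr_gt0 // divr_gt0.
have grow j : 1 + j%:R * y <= absC (mult (k0' + j) w).
  apply: le_trans (bernoulli_ineq _ (ltW y0)) _.
  elim: j => [|j IH].
    rewrite addn0 expr0 /mult; elim/big_ind: _ => [|u v u1 v1|k _].
    - by rewrite absC1.
    - by rewrite absCM -[leLHS]mulr1 ler_pM.
    - by rewrite absCX exprn_ege1 // ge1 // exprn_gt0.
  rewrite addnS /mult big_ord_recr /= absCM exprSr.
  have p1 : 0 <= 1 + y by rewrite addr_ge0 // ltW.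
  apply: (ler_pM (exprn_ge0 _ p1) p1 IH).
  pose k := (k0' + j)%N; rewrite -/k; set b : R := 2 ^+ k.
  have b0 : 0 < b by rewrite exprn_gt0.
  have wb : absC w <= b :> R.
    by apply: le_trans k0P _; rewrite /b ler_eXn2l ?leq_addr // ltr1n.
  have bN : b = (2 ^ k)%N%:R by rewrite /b natrX.
  rewrite absCX.
  have yb : 0 <= y / b by rewrite divr_ge0 // ltW.
  apply: le_trans (_ : (1 + y / b) ^+ (2 ^ k)%N <= _); last first.
    rewrite lerXn2r ?nnegrE ?absC_ge0 ?addr_ge0 //.
    apply: le_trans (fac b b0); rewrite lerD2l /y -mulrA ler_pM2l //.
    have d0 : 0 < absC (w + RtoC b) ^+ 2.
      by rewrite exprn_gt0 ?absC_gt0 ?shift_neq0.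
    have : absC (w + RtoC b) ^+ 2 <= (2 * b) ^+ 2.
      rewrite lerXn2r ?nnegrE ?absC_ge0 //; first by rewrite mulr_ge0 // ltW.
      apply: le_trans (absCD _ _) _; rewrite (absC_real (ltW b0)).
      by move: wb; lra.
    rewrite -[_ <= _](@lef_pV2 R) ?posrE // ?exprn_gt0 ?mulr_gt0 // => H.
    have -> : ReC w / 4 / b = b * ReC w * (2 * b) ^- 2.
      by field; rewrite gt_eqF.
    by rewrite ler_pM2l // mulr_gt0.
  apply: le_trans (bernoulli_ineq _ yb).
  by rewrite -bN mulrCA mulfV ?mulr1 // gt_eqF.
exists (k0' + Num.bound (`|A| / y))%N; apply: le_trans (grow _).
have := archi_boundP (divr_ge0 (normr_ge0 A) (ltW y0)).
by rewrite ltr_pdivrMr // => H; have := ler_norm A; lra.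
Qed.

End Multiplier.

(** * Finitely many small coefficients force a small value *)

Section FlatSmall.
Variable R : realType.
Local Notation C := (Cplx R).

Lemma fact_le_expn n : (n`! <= n ^ n)%N.
Proof.
elim: n => // n IH; rewrite factS expnS leq_mul //.
by apply: leq_trans IH _; case: n => // n; rewrite leq_exp2r.
Qed.

Lemma expR_half_le2 : expR (2^-1) <= 2 :> R.
Proof.
rewrite -[leLHS]invrK -expRN -[leRHS]invrK lef_pV2 ?posrE ?invr_gt0 ?expR_gt0 //.
by apply: le_trans (expR_ge1Dx _); lra.
Qed.

Variables (B L eta : R).
Hypotheses (B0 : 0 <= B) (L0 : 0 < L) (eta0 : 0 < eta).

Definition gevrey (f : C -> C) (a : nat -> C) := forall n (z : C),
  eta <= `|ImC z| ->
  absC (f z - \sum_(j < n) a j / z ^+ j) <= B * L ^+ n * n`!%:R / absC z ^+ n.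

(** By [n! <= n ^ n] the remainder is at most [B (L n / r) ^ n]; truncating near [n = r / (2 L)]
    makes it exponentially small in [r]. *)
Lemma gevrey_truncation (r : R) n : 0 < r -> n%:R <= r / (2 * L) ->
  B * L ^+ n * n`!%:R / r ^+ n <= B * (2^-1) ^+ n.
Proof.
move=> r0 nr.
rewrite [leLHS](_ : _ = B * (L ^+ n * n`!%:R / r ^+ n)); last by rewrite !mulrA.
rewrite ler_wpM2l // ler_pdivrMr ?exprn_gt0 // -exprMn.
apply: le_trans (_ : (L * n%:R) ^+ n <= _).
  by rewrite exprMn ler_wpM2l ?exprn_ge0 ?(ltW L0) // -natrX ler_nat fact_le_expn.
rewrite lerXn2r ?nnegrE ?mulr_ge0 ?invr_ge0 ?(ltW L0) ?(ltW r0) //.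
have := ler_wpM2l (ltW L0) nr.
by rewrite (_ : L * (r / (2 * L)) = 2^-1 * r) //; field; rewrite gt_eqF.
Qed.

(** [J] and [delta] depend on the class, [z0] and [eps], but not on [f]. The choices are made in the
    order [N], from the growth of the multiplier at [w0], the side [V] of the rectangle, and finally
    [J] and [delta]; [2 B + 1] bounds the product with the multiplier on the boundary. *)
Lemma flat_small (z0 : C) (eps : R) : eta < `|ImC z0| -> 0 < eps ->
  exists J (delta : R), 0 < delta /\ forall f a,
    (forall z, eta <= `|ImC z| -> taylor2 f z) -> gevrey f a ->
    (forall j, (j < J)%N -> absC (a j) <= delta) -> absC (f z0) <= eps.
Proof.
move=> z0eta eps0.
have B1 : 0 < 2 * B + 1 by rewrite ltr_wpDl ?mulr_ge0.
pose s := Num.sg (ImC z0).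
have s2 : s * s = 1.
  have : ImC z0 != 0 by rewrite -normr_gt0; apply: lt_trans z0eta.
  by rewrite /s -expr2 sqr_sg => ->.
have sE : s * ImC z0 = `|ImC z0| by rewrite -normrEsg.
have sN x : `|s * x| = `|x|.
  by rewrite normrM normr_sg -normr_gt0 (lt_trans eta0 z0eta) mul1r.
(* With this [kappa] the multiplier is at most [2 ^ (n + 1)] on the axis, where [n] is the integer
   part of [|z| / (2 L)]: it grows no faster than the truncated remainder [B / 2 ^ n] decays. *)
pose kappa := Num.min 1 (24 * L)^-1.
have kappa0 : 0 < kappa by rewrite lt_min ltr01 invr_gt0 mulr_gt0.
have kappa01 : 0 <= kappa <= 1 by rewrite (ltW kappa0) ge_min lexx.
have kappaL : kappa * (24 * L) <= 1.
  by rewrite -ler_pdivlMr ?mulr_gt0 // div1r ge_min lexx orbT.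
(* The map [w |-> c w + d] sends [Re w >= 0] to the half-plane [s Im z >= eta] that contains
   [z0]. *)
pose c : C := Complex 0 s; pose d : C := Complex 0 (s * eta).
have zE w : c * w + d = Complex (- (s * ImC w)) (s * (eta + ReC w)).
  by case: w => x y; apply/eqP; rewrite eq_complex /= !mul0r; apply/andP; split; apply/eqP; ring.
pose w0 : C := Complex (`|ImC z0| - eta) (- (s * ReC z0)).
have w0E : c * w0 + d = z0.
  rewrite zE /= mulrN opprK mulrA s2 mul1r addrC subrK -sE mulrA s2 mul1r.
  by case: (z0).
have Imz w : 0 <= ReC w -> eta <= `|ImC (c * w + d)|.
  move=> w0'; rewrite zE /= sN ger0_norm ?lerDl //.
  by rewrite addr_ge0 // ltW.
have w0pos : 0 < ReC w0 by rewrite /= subr_gt0.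
have [N NP] := mult_lower kappa0 w0pos ((2 * B + 1) / eps).
pose CN : R := 2 ^+ (2 ^ N).
have CN0 : 0 < CN by rewrite exprn_gt0.
(* On the far sides [|f| <= B L / |z| + |a 0|] meets a multiplier of size at most [CN]; [V >= L CN]
   reduces the first product to [B]. The term [absC w0] puts [w0] in the rectangle. *)
pose V := 1 + L * CN + absC w0.
have LCN : 0 <= L * CN by rewrite mulr_ge0 ?ltW.
have V0 : 0 < V by rewrite /V; have := absC_ge0 w0; lra.
(* On the side along the axis [|z| <= V + eta], so every truncation order used there is below
   [J]. *)
pose J := (Num.truncn ((V + eta) / (2 * L))).+1.
pose S : R := \sum_(j < J) (eta^-1) ^+ j.
have S1 : 1 <= S.
  by rewrite /S big_ord_recl expr0 lerDl sumr_ge0 // => j _; rewrite exprn_ge0 // invr_ge0 ltW.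
have S0 : 0 < S by apply: lt_le_trans S1.
have CS0 : 0 < CN * S by rewrite mulr_gt0.
exists J, (CN * S)^-1; split; first by rewrite invr_gt0.
move=> f a tf ga aJ.
pose F (w : C) := f (c * w + d) * mult kappa N w.
have inner w : 0 <= ReC w -> eta <= absC (c * w + d) /\ absC w <= absC (c * w + d).
  move=> w0'; split; first by apply: le_trans (Imz w w0') (le_ImC _).
  rewrite -(@ler_pXn2r _ 2) ?nnegrE ?absC_ge0 // !sqr_absC zE /=.
  rewrite sqrrN !exprMn (expr2 s) s2 !mul1r [leLHS]addrC lerD2l.
  by rewrite lerXn2r ?nnegrE ?addr_ge0 ?lerDr ?(ltW eta0).
suff /(_ w0) : forall w, in_square V w -> absC (F w) <= 2 * B + 1.
  have w0V : in_square V w0.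
    have := le_ReC w0; have := le_ImC w0; rewrite /in_square /= => i1 i2.
    apply/andP; split; [apply/andP; split|]; first by rewrite subr_ge0 ltW.
      by have := ler_norm (`|ImC z0| - eta); rewrite /V; lra.
    by rewrite /V; lra.
  move=> /(_ w0V); rewrite /F w0E absCM => H.
  have M0 : 0 < (2 * B + 1) / eps by rewrite divr_gt0.
  have := ler_wpM2l (absC_ge0 (f z0)) NP => /le_trans/(_ H).
  rewrite mulrA ler_pdivrMr // mulrC ler_pM2l //; lra.
apply: max_principle => // w /andP[/andP[w0' _] wV].
  apply: taylor2M; last exact: taylor2_mult.
  by apply: taylor2_affine; apply: tf; apply: Imz.
move=> [wRe|wV'].
  have wE : w = Complex 0 (ImC w) by rewrite -wRe; case: (w).
  have [z1 z2] := inner w w0'.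
  set z := c * w + d; set r := absC z.
  have r0 : 0 < r by apply: lt_le_trans z1.
  have rV : r <= V + eta.
    apply: le_trans (absCD _ _) _; rewrite absCM lerD //.
      have -> : absC c = 1.
        by apply/eqP; rewrite -(@eqrXn2 _ 2) ?absC_ge0 // sqr_absC /= expr0n add0r expr2 s2 expr1n.
      rewrite mul1r; apply: le_trans (absC_le_ReIm _) _.
      by rewrite wRe normr0 add0r.
    by apply: le_trans (absC_le_ReIm _) _; rewrite /= normr0 add0r sN gtr0_norm.
  pose n := Num.truncn (r / (2 * L)).
  have L2 : 0 < 2 * L by rewrite mulr_gt0.
  have rL : 0 <= r / (2 * L) by rewrite ltW // divr_gt0.
  have nJ : (n < J)%N.
    by rewrite ltnS; apply: le_truncn; rewrite ler_pM2r ?invr_gt0.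
  have e1 : absC (f z - \sum_(j < n) a j / z ^+ j) * absC (mult kappa N w) <= 2 * B.
    have nr0 : n%:R <= r / (2 * L) by rewrite /n truncn_le.
    have H1 := le_trans (ga n z (Imz w w0')) (gevrey_truncation r0 nr0).
    have H2 : absC (mult kappa N w) <= 2 ^+ n.+1.
      rewrite -(@ler_pXn2r _ 2) ?nnegrE ?absC_ge0 ?exprn_ge0 // wE.
      apply: le_trans (mult_axis kappa01 _ _) _.
      have nr : r / (2 * L) < n.+1%:R by rewrite /n truncnS_gt.
      apply: le_trans (_ : expR ((2 * n.+1)%:R * 2^-1) <= _).
        rewrite ler_expR [leRHS](_ : _ = n.+1%:R); last first.
          by rewrite natrM mulrC mulKf // pnatr_eq0.
        have Imw : `|ImC w| <= r by apply: le_trans (le_ImC _) z2.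
        move: nr; rewrite ltr_pdivrMr // => nr.
        apply: le_trans (_ : 12 * kappa * (n.+1%:R * (2 * L)) <= _).
          rewrite ler_wpM2l ?mulr_ge0 ?(ltW kappa0) //.
          by apply: le_trans Imw (ltW nr).
        have := ler_wpM2l (ler0n R n.+1) kappaL; lra.
      rewrite expRM_natl mulnC exprM lerXn2r ?nnegrE ?exprn_ge0 ?expR_ge0 //.
      by rewrite lerXn2r ?nnegrE ?expR_ge0 // expR_half_le2.
    apply: le_trans (ler_pM (absC_ge0 _) (absC_ge0 _) H1 H2) _.
    by rewrite exprS mulrACA -mulrA mulrCA -exprMn mulVf // expr1n mulr1 mulrC.
  have e2 : absC (\sum_(j < n) a j / z ^+ j) * absC (mult kappa N w) <= 1.
    apply: le_trans (_ : (CN * S)^-1 * S * CN <= 1); last first.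
      by rewrite -mulrA [S * CN]mulrC mulVf // mulf_neq0 ?gt_eqF.
    apply: ler_pM; rewrite ?absC_ge0 ?mult_upper //.
    apply: le_trans (absC_sum _) _; rewrite /S mulr_sumr.
    apply: le_trans (_ : \sum_(j < n) (CN * S)^-1 * eta^-1 ^+ j <= _).
      apply: ler_sum => j _; rewrite absCM absCV absCX -exprVn.
      apply: ler_pM; rewrite ?absC_ge0 ?exprn_ge0 ?invr_ge0 ?absC_ge0 //.
        by apply: aJ; apply: ltn_trans nJ.
      by rewrite lerXn2r ?nnegrE ?invr_ge0 ?absC_ge0 ?(ltW eta0) // lef_pV2.
    rewrite (big_ord_widen J (fun j => (CN * S)^-1 * eta^-1 ^+ j)) ?(ltnW nJ) //.
    rewrite [leRHS](bigID (fun j : 'I_J => (j < n)%N)) /= lerDl sumr_ge0 // => j _.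
    by rewrite mulr_ge0 ?exprn_ge0 ?invr_ge0 ?(ltW eta0) ?(ltW CS0).
  rewrite /F absCM -/z -[f z](subrK (\sum_(j < n) a j / z ^+ j)).
  apply: le_trans (ler_wpM2r (absC_ge0 _) (absCD _ _)) _.
  by rewrite mulrDl lerD.
have [z1 z2] := inner w w0'.
have Vz : V <= absC (c * w + d).
  apply: le_trans z2; case: wV' => [<-|<-]; last exact: le_ImC.
  by apply: le_trans (ler_norm _) (le_ReC _).
set z := c * w + d in z1 z2 Vz *.
have r0 : 0 < absC z by apply: lt_le_trans Vz.
have := ga 1%N z (Imz w w0'); rewrite big_ord1 expr0 invr1 mulr1 expr1 mulr1 => H.
have a0 : absC (a 0%N) <= (CN * S)^-1 by exact: aJ.
have fz : absC (f z) <= B * L / absC z + (CN * S)^-1.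
  rewrite -[f z](subrK (a 0%N)); apply: le_trans (absCD _ _) _.
  by rewrite lerD.
rewrite /F absCM; apply: le_trans (ler_pM (absC_ge0 _) (absC_ge0 _) fz (mult_upper kappa01 N w0')) _.
rewrite mulrDl; apply: lerD.
  apply: le_trans (_ : B <= _); last by rewrite ler_peMl // ler1n.
  rewrite mulrAC ler_pdivrMr // -mulrA ler_wpM2l // -/CN.
  by apply: le_trans Vz; rewrite /V; have := absC_ge0 w0; lra.
rewrite -/CN invfM mulrAC mulVf ?gt_eqF // mul1r.
by rewrite invf_le1 //; lra.
Qed.

End FlatSmall.

(** * Gevrey expansions *)

Section GevreyClass.
Variable R : realType.
Local Notation C := (Cplx R).
Variable eta : R.
Hypothesis eta0 : 0 < eta.

Definition gevrey_class (B L : R) (f : C -> C) (a : nat -> C) :=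
  (forall n, absC (a n) <= B * L ^+ n * n`!%:R) /\ gevrey B L eta f a.

Lemma absC_pos (z : C) : eta <= `|ImC z| -> 0 < absC z.
Proof. by move=> zeta; apply: lt_le_trans eta0 (le_trans zeta (le_ImC z)). Qed.

Lemma gevrey_class_ext B L f g a b : (forall z, f z = g z) -> (forall n, a n = b n) ->
  gevrey_class B L f a -> gevrey_class B L g b.
Proof.
move=> fg ab [aB fa]; split=> [n|n z zeta]; first by rewrite -ab.
by rewrite -fg; under eq_bigr do rewrite -ab; apply: fa.
Qed.

Lemma gevrey_class_mono B L B' L' f a : 0 <= B -> 0 <= L -> B <= B' -> L <= L' ->
  gevrey_class B L f a -> gevrey_class B' L' f a.
Proof.
move=> B0 L0 BB LL [aB fa].
have mono n : B * L ^+ n * n`!%:R <= B' * L' ^+ n * n`!%:R.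
  rewrite ler_wpM2r // ler_pM ?exprn_ge0 // lerXn2r ?nnegrE //.
  exact: le_trans LL.
split=> [n|n z zeta]; first exact: le_trans (aB n) (mono n).
apply: le_trans (fa n z zeta) _; rewrite ler_wpM2r ?invr_ge0 ?exprn_ge0 ?absC_ge0 //.
Qed.

Lemma gevrey_classD B B' L f g a b : gevrey_class B L f a -> gevrey_class B' L g b ->
  gevrey_class (B + B') L (fun z => f z + g z) (fun n => a n + b n).
Proof.
move=> [aB fa] [bB gb]; split=> [n|n z zeta].
  by apply: le_trans (absCD _ _) _; rewrite !mulrDl lerD.
rewrite (eq_bigr (fun j : 'I_n => a j / z ^+ j + b j / z ^+ j)); last first.
  by move=> j _; rewrite mulrDl.
rewrite big_split opprD addrACA !mulrDl.
by apply: le_trans (absCD _ _) _; apply: lerD; [apply: fa|apply: gb].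
Qed.

Lemma gevrey_class_sum N B L (f : nat -> C -> C) (a : nat -> nat -> C) :
  (forall i, gevrey_class B L (f i) (a i)) ->
  gevrey_class (N%:R * B) L (fun z => \sum_(i < N) f i z) (fun n => \sum_(i < N) a i n).
Proof.
move=> fa; elim: N => [|N IH].
  split=> [n|n z _]; rewrite ?big_ord0 ?mul0r ?absC0 //.
  by rewrite big1 ?subrr ?absC0 // => i _; rewrite big_ord0 mul0r.
rewrite -natr1 mulrDl mul1r.
by apply: gevrey_class_ext (gevrey_classD IH (fa N)) => ?; rewrite big_ord_recr.
Qed.

Lemma gevrey_classZ B L c f a : gevrey_class B L f a ->
  gevrey_class (absC c * B) L (fun z => c * f z) (fun n => c * a n).
Proof.
move=> [aB fa]; split=> [n|n z zeta].
  by rewrite absCM -!mulrA ler_wpM2l ?absC_ge0 // mulrA.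
under eq_bigr do rewrite -mulrA.
rewrite -mulr_sumr -mulrBr absCM -!mulrA ler_wpM2l ?absC_ge0 // !mulrA.
exact: fa.
Qed.


Lemma sum_cauchy_prod (a b : nat -> C) z n :
  \sum_(j < n) cauchy_prod a b j / z ^+ j
  = \sum_(i < n) a i / z ^+ i * \sum_(j < n - i) b j / z ^+ j.
Proof.
elim: n => [|n IH]; first by rewrite !big_ord0.
rewrite big_ord_recr /= IH big_ord_recr /= subSnn big_ord1.
rewrite /cauchy_prod big_ord_recr /= subnn expr0 invr1 mulr1 mulrDl addrA.
rewrite mulr_suml -big_split /=; congr (_ + _); last by rewrite mulrAC.
apply: eq_bigr => -[i i_n] _ /=; rewrite subSn ?(ltnW i_n) // big_ord_recr /= mulrDr.
congr (_ + _).
have -> : z ^+ n = z ^+ i * z ^+ (n - i) by rewrite -exprD subnKC // ltnW.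
by rewrite invfM mulrACA.
Qed.

Lemma sum_fact_le n m : (m <= n.+1)%N -> (\sum_(i < m) i`! * (n - i)`! <= m * n`!)%N.
Proof.
move=> mn; rewrite -[m in (m * _)%N]card_ord -sum_nat_const; apply: leq_sum => -[i im] _ /=.
apply: leq_trans (fact_mul_leq _ _) _; rewrite subnKC //.
by rewrite -ltnS (leq_trans im).
Qed.

(** Each product [i! (n - i)!] is at most [n!]; doubling [L] absorbs their number, since
    [n + 1 <= 2 ^ n]. *)
Lemma gevrey_classM B L f g a b : 0 <= B -> 0 <= L ->
  gevrey_class B L f a -> gevrey_class B L g b ->
  gevrey_class (B ^+ 2) (2 * L) (fun z => f z * g z) (cauchy_prod a b).
Proof.
move=> B0 L0 [aB fa] [bB gb].
have key n m : (m <= n.+1)%N ->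
    \sum_(i < m) (B * L ^+ i * i`!%:R) * (B * L ^+ (n - i) * (n - i)`!%:R)
    <= m%:R * (B ^+ 2 * L ^+ n * n`!%:R).
  move=> mn.
  have -> : m%:R * (B ^+ 2 * L ^+ n * n`!%:R) = B ^+ 2 * L ^+ n * (m * n`!)%:R.
    by rewrite natrM; ring.
  apply: le_trans (_ : B ^+ 2 * L ^+ n * (\sum_(i < m) i`! * (n - i)`!)%N%:R <= _).
    rewrite natr_sum mulr_sumr; apply: ler_sum => -[i im] _ /=.
    have i_n : (i <= n)%N by rewrite -ltnS (leq_trans im).
    have -> : L ^+ n = L ^+ i * L ^+ (n - i) by rewrite -exprD subnKC.
    by rewrite natrM le_eqVlt; apply/orP; left; apply/eqP; ring.
  by rewrite ler_wpM2l ?mulr_ge0 ?exprn_ge0 // ler_nat sum_fact_le.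
have grow n : n.+1%:R * (B ^+ 2 * L ^+ n * n`!%:R) <= B ^+ 2 * (2 * L) ^+ n * n`!%:R.
  rewrite exprMn.
  rewrite [leRHS](_ : _ = 2 ^+ n * (B ^+ 2 * L ^+ n * n`!%:R)); last by ring.
  rewrite ler_wpM2r ?mulr_ge0 ?exprn_ge0 //.
  by rewrite -natrX ler_nat ltn_expl.
split=> [n|n z zeta].
  apply: le_trans (absC_sum _) _; apply: le_trans (grow n).
  apply: le_trans (key n n.+1 (leqnn _)); apply: ler_sum => i _.
  by rewrite absCM ler_pM ?absC_ge0.
have r0 := absC_pos zeta.
rewrite sum_cauchy_prod.
(* The coefficient [a i] is paired with the remainder of [g] of the complementary order [n - i], so
   every term has the full decay [|z| ^ -n]. *)
rewrite (_ : f z * g z - _ = (f z - \sum_(i < n) a i / z ^+ i) * g z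
  + \sum_(i < n) a i / z ^+ i * (g z - \sum_(j < n - i) b j / z ^+ j)); last first.
  have -> : \sum_(i < n) a i / z ^+ i * (g z - \sum_(j < n - i) b j / z ^+ j) =
      (\sum_(i < n) a i / z ^+ i) * g z
      - \sum_(i < n) a i / z ^+ i * \sum_(j < n - i) b j / z ^+ j.
    by rewrite mulr_suml -sumrB; apply: eq_bigr => i _; rewrite mulrBr.
  by ring.
apply: le_trans (absCD _ _) _.
apply: le_trans (_ : n.+1%:R * (B ^+ 2 * L ^+ n * n`!%:R) / absC z ^+ n <= _); last first.
  by rewrite ler_wpM2r ?invr_ge0 ?exprn_ge0 ?absC_ge0.
rewrite -[n.+1%:R]natr1 [leRHS](_ : _ = n%:R * (B ^+ 2 * L ^+ n * n`!%:R) / absC z ^+ n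
  + B ^+ 2 * L ^+ n * n`!%:R / absC z ^+ n); last by ring.
rewrite addrC; apply: lerD.
  apply: le_trans (_ : (\sum_(i < n) (B * L ^+ i * i`!%:R) * (B * L ^+ (n - i) * (n - i)`!%:R))
     / absC z ^+ n <= _); last first.
    by rewrite ler_wpM2r ?invr_ge0 ?exprn_ge0 ?absC_ge0 // key.
  apply: le_trans (absC_sum _) _; rewrite mulr_suml; apply: ler_sum => -[i i_n] _ /=.
  rewrite !absCM absCV absCX.
  have -> : absC z ^+ n = absC z ^+ i * absC z ^+ (n - i).
    by rewrite -exprD subnKC // ltnW.
  rewrite invfM mulrACA; apply: ler_pM; rewrite ?mulr_ge0 ?invr_ge0 ?exprn_ge0 ?absC_ge0 //.
    by rewrite ler_wpM2r ?invr_ge0 ?exprn_ge0 ?absC_ge0.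
  exact: gb.
rewrite absCM.
have g0 : absC (g z) <= B.
  by have := gb 0%N z zeta; rewrite big_ord0 subr0 !expr0 !mulr1 invr1 mulr1.
apply: le_trans (ler_pM (absC_ge0 _) (absC_ge0 _) (fa n z zeta) g0) _.
by rewrite le_eqVlt; apply/orP; left; apply/eqP; ring.
Qed.

End GevreyClass.

(** * Cauchy transforms *)

Section ComplexExpectation.
Variable R : realType.
Local Notation C := (Cplx R).

Definition Cmeasurable (f : R -> C) :=
  measurable_fun setT (@ReC R \o f : measurableTypeR R -> R) /\
  measurable_fun setT (@ImC R \o f : measurableTypeR R -> R).

Lemma Cmeasurable_real (q : R -> R) :
  measurable_fun setT (q : measurableTypeR R -> R) -> Cmeasurable (fun x => RtoC (q x)).
Proof. by move=> mq; split=> //; apply: measurable_cst. Qed.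

Lemma Cmeasurable_cst (c : C) : Cmeasurable (fun=> c).
Proof. by split; apply: measurable_cst. Qed.

Lemma CmeasurableM f g : Cmeasurable f -> Cmeasurable g -> Cmeasurable (fun x => f x * g x).
Proof.
move=> [f1 f2] [g1 g2]; split.
  rewrite (_ : _ \o _ = (fun x => ReC (f x) * ReC (g x) - ImC (f x) * ImC (g x))).
    by apply: measurable_funB; apply: measurable_funM.
  by apply/funext => x /=; rewrite ReCM.
rewrite (_ : _ \o _ = (fun x => ReC (f x) * ImC (g x) + ImC (f x) * ReC (g x))).
  by apply: measurable_funD; apply: measurable_funM.
by apply/funext => x /=; rewrite ImCM.
Qed.

Lemma CmeasurableX f n : Cmeasurable f -> Cmeasurable (fun x => f x ^+ n).
Proof.
move=> mf; elim: n => [|n IH]; first exact: Cmeasurable_cst.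
have := CmeasurableM mf IH.
by rewrite (_ : (fun x => _) = (fun x => f x ^+ n.+1)) //; apply/funext => x; rewrite exprS.
Qed.

Lemma Cmeasurable_inv (z : C) : ImC z != 0 -> Cmeasurable (fun x => (z - RtoC x)^-1).
Proof.
case: z => a b /= b0.
have D0 (x : R) : (a - x) ^+ 2 + b ^+ 2 != 0.
  by rewrite gt_eqF // ltr_wpDl ?sqr_ge0 // exprn_even_gt0.
have cD : continuous (fun x : R => (a - x) ^+ 2 + b ^+ 2).
  move=> x; apply: cvgD; last exact: cvg_cst.
  by under eq_fun do rewrite expr2; apply: cvgM; apply: cvgB; first [exact: cvg_cst|exact: cvg_id].
have mI : measurable_fun setT (fun x : measurableTypeR R => ((a - x) ^+ 2 + b ^+ 2)^-1).
  by apply: continuous_measurable_fun => x; apply: cvgV => //; apply: cD.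
have invE x : (Complex a b - RtoC x)^-1 =
   Complex ((a - x) * ((a - x) ^+ 2 + b ^+ 2)^-1) (- b * ((a - x) ^+ 2 + b ^+ 2)^-1) :> C.
  have zx : Complex a b - RtoC x != 0 :> C.
    by rewrite eq_complex /= subr0 negb_and b0 orbT.
  apply: (mulfI zx); rewrite mulfV //; apply/eqP; rewrite eq_complex /= subr0.
  by apply/andP; split; apply/eqP; field.
split.
  rewrite (_ : _ \o _ = (fun x => (a - x) * ((a - x) ^+ 2 + b ^+ 2)^-1)).
    by apply: measurable_funM => //; apply: measurable_funB.
  by apply/funext => x; exact: (congr1 (@ReC R) (invE x)).
rewrite (_ : _ \o _ = (fun x => - b * ((a - x) ^+ 2 + b ^+ 2)^-1)).
  by apply: measurable_funM => //; apply: measurable_cst.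
by apply/funext => x; exact: (congr1 (@ImC R) (invE x)).
Qed.

Variable mu : probability (measurableTypeR R) R.

Definition Cintegrable (f : R -> C) :=
  mu.-integrable setT (EFin \o (@ReC R \o f)) /\
  mu.-integrable setT (EFin \o (@ImC R \o f)).

Definition Cmean (f : R -> C) : C := Cintegral mu setT f.

Lemma CintegrableD f g : Cintegrable f -> Cintegrable g ->
  Cintegrable (fun x => f x + g x).
Proof.
move=> [f1 f2] [g1 g2]; split.
  apply: eq_integrable (integrableD measurableT f1 g1) => // x _ /=.
  by rewrite -EFinD ReCD.
apply: eq_integrable (integrableD measurableT f2 g2) => // x _ /=.
by rewrite -EFinD ImCD.
Qed.

Lemma CintegrableZ c f : Cintegrable f -> Cintegrable (fun x => c * f x).
Proof.
move=> [f1 f2].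
have Z (k : R) (q : R -> R) : mu.-integrable setT (EFin \o q) ->
    mu.-integrable setT (EFin \o (fun x => k * q x)).
  by move=> iq; apply: (integrableZl measurableT k iq).
split.
  apply: eq_integrable (integrableD measurableT (Z (ReC c) _ f1) (Z (- ImC c) _ f2)) => // x _ /=.
  by rewrite -EFinD ReCM mulNr.
apply: eq_integrable (integrableD measurableT (Z (ReC c) _ f2) (Z (ImC c) _ f1)) => // x _ /=.
by rewrite -EFinD ImCM.
Qed.

Lemma CmeanD f g : Cintegrable f -> Cintegrable g ->
  Cmean (fun x => f x + g x) = Cmean f + Cmean g.
Proof.
move=> [f1 f2] [g1 g2]; rewrite /Cmean /Cintegral.
rewrite -[RHS]/(Complex _ _); congr Complex.
  by rewrite -RintegralD //; apply: eq_Rintegral => x _ /=; rewrite ReCD.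
by rewrite -RintegralD //; apply: eq_Rintegral => x _ /=; rewrite ImCD.
Qed.

Lemma CmeanZ c f : Cintegrable f -> Cmean (fun x => c * f x) = c * Cmean f.
Proof.
move=> [f1 f2]; rewrite /Cmean /Cintegral.
have Z (k : R) (q : R -> R) : mu.-integrable setT (EFin \o q) ->
    mu.-integrable setT (EFin \o (fun x => k * q x)).
  by move=> iq; apply: (integrableZl measurableT k iq).
case: c => a b; rewrite -[RHS]/(Complex _ _); congr Complex.
  rewrite -RintegralZl // -RintegralZl // -RintegralB //; [|exact: Z|exact: Z].
  by apply: eq_Rintegral => x _ /=; rewrite ReCM.
rewrite -RintegralZl // -RintegralZl // -RintegralD //; [|exact: Z|exact: Z].
by apply: eq_Rintegral => x _ /=; rewrite ImCM.
Qed.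

Lemma Cmean_real (q : R -> R) : Cmean (fun x => RtoC (q x)) = RtoC (Rintegral mu setT q).
Proof.
rewrite /Cmean /Cintegral /RtoC; congr Complex.
rewrite -[LHS]/(Rintegral mu setT (cst 0)) Rintegral_cst //.
by rewrite mul0r.
Qed.

Lemma Cintegrable_real (q : R -> R) : mu.-integrable setT (EFin \o q) ->
  Cintegrable (fun x => RtoC (q x)).
Proof. by move=> iq; split=> //; apply: integrable0. Qed.

Lemma Cmean_bound f (g : R -> R) : Cmeasurable f -> mu.-integrable setT (EFin \o g) ->
  (forall x, absC (f x) <= g x) ->
  Cintegrable f /\ absC (Cmean f) <= 2 * Rintegral mu setT g.
Proof.
move=> [m1 m2] ig fg.
have dom (p : C -> R) : (forall w, `|p w| <= absC w) ->
   measurable_fun setT (p \o f : measurableTypeR R -> R) ->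
   mu.-integrable setT (EFin \o (p \o f)) /\
   `|Rintegral mu setT (p \o f)| <= Rintegral mu setT g.
  move=> pw mp.
  have pg x : `|p (f x)| <= g x by apply: le_trans (pw _) (fg x).
  have ip : mu.-integrable setT (EFin \o (p \o f)).
    apply: le_integrable ig => //; first exact/measurable_EFinP.
    by move=> x _ /=; rewrite lee_fin (le_trans (pg x)) // ler_norm.
  split=> //; apply: le_trans (le_normr_Rintegral _ ip) _ => //.
  apply: le_Rintegral => //; last by move=> x _; apply: pg.
  exact: (integrable_norm ip).
have [i1 b1] := dom _ (@le_ReC R) m1; have [i2 b2] := dom _ (@le_ImC R) m2.
split=> //; apply: le_trans (absC_le_ReIm _) _.
by rewrite mulrDl !mul1r lerD.
Qed.

End ComplexExpectation.

Section CauchyTransform.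
Variable R : realType.
Local Notation C := (Cplx R).

(** The growth hypotheses concern moments without absolute values; an odd power is dominated through
    [|x| <= 1 + x^2] by the two neighbouring even ones. *)
Lemma normX_le_even (x : R) n :
  `|x| ^+ n <= x ^+ n./2.*2 + x ^+ n./2.*2.+2.
Proof.
have E k : x ^+ k.*2 = `|x| ^+ k.*2.
  by rewrite -mul2n !exprM real_normK ?num_real.
have -> : x ^+ n./2.*2.+2 = `|x| ^+ n./2.*2.+2 by rewrite -doubleS E.
rewrite E -{1}[n]odd_double_half.
have p0 k : 0 <= `|x| ^+ k by rewrite exprn_ge0.
case: (odd n) => /=; last by rewrite add0n lerDl.
rewrite add1n [X in _ <= _ + X]exprS !exprS.
have : 0 <= `|x| ^+ n./2.*2 * (1 - `|x|) ^+ 2 by rewrite mulr_ge0 ?sqr_ge0.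
have : 0 <= `|x| ^+ n./2.*2 * `|x| by rewrite mulr_ge0.
by lra.
Qed.

Lemma leq_fact2 m n : (m <= n)%N -> (m`! <= n`!)%N.
Proof.
move=> mn; rewrite -(subnKC mn) (leq_trans _ (fact_mul_leq _ _)) //.
by rewrite leq_pmulr ?fact_gt0.
Qed.

Lemma fact_shift2_le n : (n.+2`! <= 2 * 4 ^ n * n`!)%N.
Proof.
have H k : (k.+2 * k.+1 <= 2 * 4 ^ k)%N.
  elim: k => // k IH; rewrite expnS.
  apply: leq_trans (_ : 4 * (k.+2 * k.+1) <= _)%N; last first.
    by rewrite [leqRHS]mulnCA leq_mul2l IH orbT.
  have -> : (k.+3 * k.+2 = k.+2 * k.+3)%N by rewrite mulnC.
  rewrite [leqRHS]mulnCA leq_mul2l /=.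
  by rewrite mulnS -[k.+3]/(3 + k)%N leq_add // leq_pmull.
by rewrite !factS mulnA leq_mul.
Qed.

Variable mu : probability (measurableTypeR R) R.
Hypothesis mom : forall j, mu.-integrable setT (fun x => (x ^+ j)%:E).

Let abs_moment n := moment mu n./2.*2 + moment mu n./2.*2.+2.

Lemma Cmean_moment_bound f n (c : R) : Cmeasurable f -> 0 <= c ->
  (forall x, absC (f x) <= c * `|x| ^+ n) ->
  Cintegrable mu f /\ absC (Cmean mu f) <= 2 * (c * abs_moment n).
Proof.
move=> mf c0 fc.
pose g (x : R) := c * (x ^+ n./2.*2 + x ^+ n./2.*2.+2).
have ie : mu.-integrable setT (EFin \o (fun x : R => x ^+ n./2.*2 + x ^+ n./2.*2.+2)).
  exact: (integrableD measurableT (mom _) (mom _)).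
have ig : mu.-integrable setT (EFin \o g) by exact: (integrableZl measurableT c ie).
have fg x : absC (f x) <= g x.
  by apply: le_trans (fc x) _; rewrite /g ler_wpM2l // normX_le_even.
have [i b] := Cmean_bound mf ig fg; split=> //.
by move: b; rewrite /g RintegralZl // RintegralD //; [exact: mom|exact: mom].
Qed.

Section AtPoint.
Variable z : C.
Hypothesis z0 : ImC z != 0.

Let y : R := `|ImC z|.
Let y0 : 0 < y. Proof. by rewrite normr_gt0. Qed.
Let k (x : R) : C := (z - RtoC x)^-1.
Let xp n (x : R) : C := RtoC x ^+ n.
Let xk n p (x : R) : C := RtoC x ^+ n * k x ^+ p.

Lemma stieltjes_zx (x : R) : z - RtoC x != 0.
Proof.
by apply/eqP => /(congr1 (@ImC R)); rewrite ImCD ImCN subr0 => /eqP; apply/negP.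
Qed.

Lemma stieltjes_z : z != 0.
Proof. by have := stieltjes_zx 0; rewrite subr0. Qed.

Lemma stieltjes_kernel_bound x : absC (k x) <= y^-1.
Proof.
rewrite /k absCV lef_pV2 ?posrE // ?absC_gt0 ?stieltjes_zx //.
by apply: le_trans (le_ImC _); rewrite ImCD ImCN subr0.
Qed.

Let mk : Cmeasurable k. Proof. exact: Cmeasurable_inv. Qed.

Let mx n : Cmeasurable (xp n).
Proof. by apply: CmeasurableX; apply: Cmeasurable_real; apply: measurable_id. Qed.

Definition stieltjes_deriv : C := - Cmean mu (fun x => (z - RtoC x)^-1 ^+ 2).

Lemma Cmean_monomial j : Cintegrable mu (xp j) /\
  Cmean mu (xp j) = RtoC (moment mu j).
Proof.
have -> : xp j = (fun x => RtoC (x ^+ j)).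
  by apply/funext => x; rewrite RtoCX.
by split; [apply: Cintegrable_real; apply: mom | rewrite Cmean_real].
Qed.

Let kX (x : R) n p : absC (xk n p x) <= y^-1 ^+ p * `|x| ^+ n.
Proof.
rewrite /xk absCM !absCX absC_RtoC mulrC ler_wpM2r ?exprn_ge0 //.
by rewrite lerXn2r ?nnegrE ?absC_ge0 ?invr_ge0 ?(ltW y0) // stieltjes_kernel_bound.
Qed.

Let mkX n p : Cmeasurable (xk n p).
Proof. by apply: CmeasurableM; [exact: mx|exact: CmeasurableX]. Qed.

Let ikX n p : Cintegrable mu (xk n p) /\
  absC (Cmean mu (xk n p)) <= 2 * (y^-1 ^+ p * abs_moment n).
Proof.
apply: (Cmean_moment_bound (mkX n p) _ (fun x => kX x n p)).
by rewrite exprn_ge0 // invr_ge0 ltW.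
Qed.

Lemma stieltjes_expansion n :
  stieltjes mu z - \sum_(j < n) RtoC (moment mu j) / z ^+ j.+1
  = z ^- n * Cmean mu (xk n 1).
Proof.
have zn0 := stieltjes_z.
elim: n => [|n IH].
  rewrite big_ord0 subr0 expr0 invr1 mul1r; congr Cintegral.
  by apply/funext => x; rewrite /xk expr0 mul1r expr1.
rewrite big_ord_recr /= opprD addrA IH.
have [i1 e1] := Cmean_monomial n; have [i2 _] := ikX n.+1 1.
have -> : (xk n 1) =
   (fun x => z^-1 * xp n x + z^-1 * xk n.+1 1 x).
  apply/funext => x; rewrite /xk /xp /k !expr1 (exprS _ n).
  by have := stieltjes_zx x; set t := RtoC x => t0; field; rewrite t0.
rewrite CmeanD ?CmeanZ ?e1; [|exact: i2|exact: i1|exact: CintegrableZ|exact: CintegrableZ].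
by rewrite exprS; field; rewrite expf_neq0.
Qed.

(** The right-hand side is the derivative in [z] of [z^-n] times the mean of [x^n / (z - x)], the
    remainder of [stieltjes_expansion]. *)
Lemma stieltjes_deriv_expansion n :
  stieltjes_deriv - \sum_(j < n) - (j.+1%:R * RtoC (moment mu j)) / z ^+ j.+2
  = - (z ^- n * (n%:R / z * Cmean mu (xk n 1)
                 + Cmean mu (xk n 2))).
Proof.
have zn0 := stieltjes_z.
elim: n => [|n IH].
  rewrite big_ord0 subr0 expr0 invr1 mul1r !mul0r add0r; congr (- Cintegral _ _ _).
  by apply/funext => x; rewrite /xk expr0 mul1r.
rewrite big_ord_recr /= opprD addrA IH.
have [i1 e1] := Cmean_monomial n; have [i2 _] := ikX n.+1 1.
have [i3 _] := ikX n.+1 2; have [i4 _] := ikX n 1.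
have -> : (xk n 1) =
   (fun x => z^-1 * xp n x + z^-1 * xk n.+1 1 x).
  apply/funext => x; rewrite /xk /xp /k !expr1 (exprS _ n).
  by have := stieltjes_zx x; set t := RtoC x => t0; field; rewrite t0.
have -> : (xk n 2) =
   (fun x => z^-1 * xk n.+1 2 x + z^-1 * xk n 1 x).
  apply/funext => x; rewrite /xk /xp /k !expr1 (exprS _ n).
  by have := stieltjes_zx x; set t := RtoC x => t0; field; rewrite t0.
have -> : Cmean mu (fun x => z^-1 * xk n.+1 2 x + z^-1 * xk n 1 x) =
  z^-1 * Cmean mu (xk n.+1 2)
  + z^-1 * (z^-1 * RtoC (moment mu n) + z^-1 * Cmean mu (xk n.+1 1)).
  rewrite CmeanD ?CmeanZ; [|exact: i4|exact: i3|exact: CintegrableZ|exact: CintegrableZ].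
  congr (_ + _ * _).
  have -> : (xk n 1) =
     (fun x => z^-1 * xp n x + z^-1 * xk n.+1 1 x).
    apply/funext => x; rewrite /xk /xp /k !expr1 (exprS _ n).
    by have := stieltjes_zx x; set t := RtoC x => t0; field; rewrite t0.
  by rewrite CmeanD ?CmeanZ ?e1; [|exact: i2|exact: i1|exact: CintegrableZ|exact: CintegrableZ].
rewrite CmeanD ?CmeanZ ?e1; [|exact: i2|exact: i1|exact: CintegrableZ|exact: CintegrableZ].
by rewrite -[n.+1%:R]natr1 !exprS; field; rewrite zn0 expf_neq0.
Qed.

Lemma stieltjes_remainder n :
  absC (stieltjes mu z - \sum_(j < n) RtoC (moment mu j) / z ^+ j.+1)
  <= 2 * (y^-1 * abs_moment n) / absC z ^+ n.
Proof.
rewrite stieltjes_expansion absCM absCV absCX mulrC.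
rewrite ler_wpM2r ?invr_ge0 ?exprn_ge0 ?absC_ge0 //.
by have [_] := ikX n 1; rewrite expr1.
Qed.

Lemma stieltjes_deriv_remainder n :
  absC (stieltjes_deriv - \sum_(j < n) - (j.+1%:R * RtoC (moment mu j)) / z ^+ j.+2)
  <= 2 * (n.+1%:R * (y^-1 ^+ 2 * abs_moment n)) / absC z ^+ n.
Proof.
rewrite stieltjes_deriv_expansion absCN absCM absCV absCX mulrC.
rewrite ler_wpM2r ?invr_ge0 ?exprn_ge0 ?absC_ge0 //.
apply: le_trans (absCD _ _) _; rewrite !absCM absC_nat absCV.
have [_ b1] := ikX n 1; have [_ b2] := ikX n 2.
have b3 : n%:R / absC z * absC (Cmean mu (xk n 1))
   <= n%:R / y * (2 * (y^-1 ^+ 1 * abs_moment n)).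
  apply: ler_pM; rewrite ?absC_ge0 ?mulr_ge0 ?invr_ge0 ?absC_ge0 //.
  rewrite ler_wpM2l // lef_pV2 ?posrE ?absC_gt0 ?stieltjes_z //.
  exact: le_ImC.
apply: le_trans (lerD b3 b2) _.
by rewrite -[n.+1%:R]natr1 le_eqVlt; apply/orP; left; apply/eqP; ring.
Qed.

Section Increment.
Variable h : C.
Hypothesis hy : absC h < y / 2.

Let kh (x : R) : C := (z + h - RtoC x)^-1.

Let y2 : y / 2 <= `|ImC (z + h)|.
Proof.
have := ler_normB (ImC z + ImC h) (ImC h); rewrite addrK -/y ImCD.
by have := le_ImC h; have := hy; lra.
Qed.

Let zh0 : ImC (z + h) != 0.
Proof. by rewrite -normr_gt0; apply: lt_le_trans y2; rewrite divr_gt0. Qed.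

Let zhx x : z + h - RtoC x != 0.
Proof.
by apply/eqP => /(congr1 (@ImC R)); rewrite ImCD ImCN subr0 => /eqP; apply/negP.
Qed.

Let kh_bound x : absC (kh x) <= (y / 2)^-1.
Proof.
rewrite /kh absCV lef_pV2 ?posrE ?divr_gt0 // ?absC_gt0 ?zhx //.
have := le_ImC (z + h - RtoC x); rewrite [ImC (_ - _)]ImCD ImCN subr0.
exact: le_trans.
Qed.

Let kk p q (x : R) : C := k x ^+ p * kh x ^+ q.

Lemma increment_bound p q : Cintegrable mu (kk p q) /\
  absC (Cmean mu (kk p q)) <= 2 * (y^-1 ^+ p * (y / 2)^-1 ^+ q * abs_moment 0).
Proof.
have y2' : 0 < y / 2 by rewrite divr_gt0.
apply: Cmean_moment_bound => [||x].
- by apply: CmeasurableM; apply: CmeasurableX => //; apply: Cmeasurable_inv.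
- by rewrite mulr_ge0 // exprn_ge0 // invr_ge0 ltW.
rewrite expr0 mulr1 /kk absCM !absCX; apply: ler_pM; rewrite ?exprn_ge0 ?absC_ge0 //.
  by rewrite lerXn2r ?nnegrE ?absC_ge0 ?invr_ge0 ?(ltW y0) // stieltjes_kernel_bound.
by rewrite lerXn2r ?nnegrE ?absC_ge0 ?invr_ge0 ?(ltW y2').
Qed.

Let ik p : Cintegrable mu (fun x => k x ^+ p).
Proof.
have [i _] := increment_bound p 0; move: i; rewrite (_ : kk p 0 = (fun x => k x ^+ p)) //.
by apply/funext => x; rewrite /kk expr0 mulr1.
Qed.

Let khE x : kh x = k x - h * k x ^+ 2 + h ^+ 2 * (k x ^+ 2 * kh x).
Proof.
have := stieltjes_zx x; have := zhx x; rewrite /k /kh; set t := RtoC x => t0 t1.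
by field; rewrite t0 t1.
Qed.

Lemma stieltjes_increment1 : stieltjes mu (z + h) - stieltjes mu z - h * stieltjes_deriv
  = h ^+ 2 * Cmean mu (kk 2 1).
Proof.
have [i _] := increment_bound 2 1.
rewrite -[stieltjes mu (z + h)]/(Cmean mu kh).
have -> : kh = (fun x => k x ^+ 1 + ((- h) * k x ^+ 2 + h ^+ 2 * kk 2 1 x)).
  by apply/funext => x; rewrite {1}khE /kk !expr1; ring.
rewrite (CmeanD (ik 1) (CintegrableD (CintegrableZ (- h) (ik 2)) (CintegrableZ (h ^+ 2) i))).
rewrite (CmeanD (CintegrableZ (- h) (ik 2)) (CintegrableZ (h ^+ 2) i)).
rewrite (CmeanZ (- h) (ik 2)) (CmeanZ (h ^+ 2) i).
rewrite /stieltjes_deriv (_ : stieltjes mu z = Cmean mu (fun x => k x ^+ 1)); last first.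
  by congr Cintegral; apply/funext => x; rewrite expr1.
by rewrite -/k; ring.
Qed.

Lemma stieltjes_increment2 : stieltjes mu (z + h) - stieltjes mu z - h * stieltjes_deriv
  - h ^+ 2 * Cmean mu (fun x => k x ^+ 3) = - h ^+ 3 * Cmean mu (kk 3 1).
Proof.
have [i _] := increment_bound 3 1; rewrite stieltjes_increment1.
have -> : kk 2 1 = (fun x => k x ^+ 3 + (- h) * kk 3 1 x).
  apply/funext => x; have := stieltjes_zx x; have := zhx x.
  by rewrite /kk /k /kh; set t := RtoC x => t0 t1; field; rewrite t0 t1.
by rewrite (CmeanD (ik 3) (CintegrableZ (- h) i)) (CmeanZ _ i); ring.
Qed.

Lemma stieltjes_deriv_increment2 : - Cmean mu (fun x => kh x ^+ 2) - stieltjes_deriv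
  - 2 * Cmean mu (fun x => k x ^+ 3) * h - (- 3 * Cmean mu (fun x => k x ^+ 4)) * h ^+ 2
  = h ^+ 3 * (4 * Cmean mu (kk 3 2) + 3 * h * Cmean mu (kk 4 2)).
Proof.
have [i _] := increment_bound 3 2; have [j _] := increment_bound 4 2.
have -> : (fun x => kh x ^+ 2) = (fun x => k x ^+ 2 + ((- 2 * h) * k x ^+ 3
    + ((3 * h ^+ 2) * k x ^+ 4 + ((- 4 * h ^+ 3) * kk 3 2 x + (- 3 * h ^+ 4) * kk 4 2 x)))).
  apply/funext => x; have := stieltjes_zx x; have := zhx x.
  by rewrite /kk /k /kh; set t := RtoC x => t0 t1; field; rewrite t0 t1.
have i2 := CintegrableZ (- 4 * h ^+ 3) i; have j2 := CintegrableZ (- 3 * h ^+ 4) j.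
have ij := CintegrableD i2 j2; have k4 := CintegrableZ (3 * h ^+ 2) (ik 4).
have k4ij := CintegrableD k4 ij; have k3 := CintegrableZ (- 2 * h) (ik 3).
rewrite (CmeanD (ik 2) (CintegrableD k3 k4ij)) (CmeanD k3 k4ij) (CmeanD k4 ij) (CmeanD i2 j2).
rewrite (CmeanZ _ (ik 3)) (CmeanZ _ (ik 4)) (CmeanZ _ i) (CmeanZ _ j).
by rewrite /stieltjes_deriv -/k; ring.
Qed.

End Increment.

Lemma stieltjes_taylor1 : exists K, forall h, absC h < y / 2 ->
  absC (stieltjes mu (z + h) - stieltjes mu z - h * stieltjes_deriv) <= K * absC h ^+ 2.
Proof.
exists (2 * (y^-1 ^+ 2 * (y / 2)^-1 ^+ 1 * abs_moment 0)) => h hy.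
rewrite stieltjes_increment1 // absCM absCX mulrC.
by rewrite ler_wpM2r ?exprn_ge0 ?absC_ge0 // (increment_bound hy 2 1).2.
Qed.

Lemma stieltjes_taylor2 : taylor2 (stieltjes mu) z.
Proof.
exists stieltjes_deriv, (Cmean mu (fun x => k x ^+ 3)),
  (2 * (y^-1 ^+ 3 * (y / 2)^-1 ^+ 1 * abs_moment 0)), (y / 2).
split=> [|h hy]; first by rewrite divr_gt0.
rewrite mulrC [_ * h ^+ 2]mulrC stieltjes_increment2 // mulNr absCN absCM absCX mulrC.
by rewrite ler_wpM2r ?exprn_ge0 ?absC_ge0 // (increment_bound hy 3 1).2.
Qed.

End AtPoint.

Lemma stieltjes_deriv_taylor2 z : ImC z != 0 -> taylor2 stieltjes_deriv z.
Proof.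
move=> z0; have y0 : 0 < `|ImC z| by rewrite normr_gt0.
pose y := `|ImC z|.
exists (2 * Cmean mu (fun x => (z - RtoC x)^-1 ^+ 3)),
  (- 3 * Cmean mu (fun x => (z - RtoC x)^-1 ^+ 4)),
  (4 * (2 * (y^-1 ^+ 3 * (y / 2)^-1 ^+ 2 * abs_moment 0))
   + 3 * (y / 2) * (2 * (y^-1 ^+ 4 * (y / 2)^-1 ^+ 2 * abs_moment 0))), (y / 2).
split=> [|h hy]; first by rewrite divr_gt0.
have := stieltjes_deriv_increment2 z0 hy; rewrite -/(stieltjes_deriv (z + h)) => ->.
rewrite absCM absCX mulrC ler_wpM2r ?exprn_ge0 ?absC_ge0 //.
apply: le_trans (absCD _ _) _; rewrite !absCM !absC_nat; apply: lerD.
  by rewrite ler_wpM2l // (increment_bound z0 hy 3 2).2.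
apply: ler_pM; rewrite ?mulr_ge0 ?absC_ge0 ?(increment_bound z0 hy 4 2).2 //.
by rewrite ler_wpM2l // ltW.
Qed.

End CauchyTransform.

(** * Uniform expansions of Cauchy transforms whose moments grow factorially *)

Section CauchyGevrey.
Variable R : realType.
Local Notation C := (Cplx R).
Variables (L eta : R).
Hypotheses (L1 : 1 <= L) (eta0 : 0 < eta).

Definition moment_growth (mu : probability (measurableTypeR R) R) :=
  (forall j, mu.-integrable setT (fun x => (x ^+ j)%:E)) /\
  (forall j, `|moment mu j| <= L ^+ j * j`!%:R).

(** One constant for the transform and its derivative. The terms with [L ^+ 2] bound the two exact
    remainders, [8] being [2 * 4] from [abs_moment_le]; [1] and [1 / eta] bound the coefficients
    that an index shift moves into the remainder. *)
Let B := 8 * L ^+ 2 / eta + 8 * L ^+ 2 / eta ^+ 2 + 1 + 1 / eta.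

Let L0 : 0 <= L. Proof. exact: le_trans L1. Qed.

Let abs_moment_le mu n : moment_growth mu ->
  moment mu n./2.*2 + moment mu n./2.*2.+2 <= 4 * L ^+ 2 * ((4 * L) ^+ n * n`!%:R).
Proof.
move=> [_ mg].
have le_n k : (k <= n.+2)%N -> moment mu k <= L ^+ n.+2 * n.+2`!%:R.
  move=> kn; apply: le_trans (ler_norm _) _; apply: le_trans (mg k) _.
  apply: ler_pM; rewrite ?exprn_ge0 //; last by rewrite ler_nat leq_fact2.
  exact: ler_weXn2l.
have e : (n./2.*2 <= n)%N by rewrite -{2}[n]odd_double_half leq_addl.
apply: le_trans (lerD (le_n _ _) (le_n _ _)) _; [exact: leq_trans (leqW (leqW e))|exact: e|].
have f : n.+2`!%:R <= 2 * 4 ^+ n * n`!%:R :> R.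
  by rewrite -natrX -!natrM ler_nat fact_shift2_le.
have Ln : 0 <= L ^+ n.+2 by rewrite exprn_ge0.
have := ler_wpM2l Ln f; rewrite exprMn (exprD L 2 n : L ^+ n.+2 = _).
by lra.
Qed.

Let coef_le mu n : moment_growth mu ->
  absC (RtoC (cauchy_coef (moment mu) n)) <= L ^+ n * n`!%:R.
Proof.
move=> [_ mg]; rewrite absC_RtoC; case: n => [|n] /=; first by rewrite normr0 mulr_ge0.
apply: le_trans (mg n) _; apply: ler_pM; rewrite ?exprn_ge0 // ?ler_nat ?leq_fact2 //.
exact: ler_weXn2l.
Qed.

Let deriv_coef_le mu n : moment_growth mu ->
  absC (RtoC (cauchy_deriv_coef (moment mu) n)) <= L ^+ n * n.-1`!%:R.
Proof.
move=> [_ mg]; rewrite absC_RtoC; case: n => [|[|n]] /=; rewrite ?normr0 ?mulr_ge0 ?exprn_ge0 //.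
rewrite normrN normrM normr_nat; apply: le_trans (ler_wpM2l _ (mg n)) _ => //.
rewrite mulrCA -natrM -factS ler_wpM2r //.
by apply: ler_weXn2l => //; rewrite !leqW.
Qed.

Let eV : 0 < eta^-1. Proof. by rewrite invr_gt0. Qed.

Let LX n : L ^+ n <= (8 * L) ^+ n.
Proof. by rewrite lerXn2r ?nnegrE ?mulr_ge0 // ler_peMl // ler1n. Qed.

Lemma stieltjes_gevrey mu : moment_growth mu ->
  gevrey_class eta B (8 * L) (stieltjes mu) (fun n => RtoC (cauchy_coef (moment mu) n)).
Proof.
move=> mg; have L2 : 0 <= L ^+ 2 by rewrite sqr_ge0.
have B1 : 1 <= B.
  by rewrite /B addrAC lerDr !addr_ge0 ?mulr_ge0 ?invr_ge0 ?exprn_ge0 ?(ltW eta0).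
have cB n : absC (RtoC (cauchy_coef (moment mu) n)) <= (8 * L) ^+ n * n`!%:R.
  by apply: le_trans (coef_le n mg) _; rewrite ler_wpM2r.
split=> [n|n z zeta].
  apply: le_trans (cB n) _; rewrite -mulrA ler_peMl // mulr_ge0 ?exprn_ge0 ?mulr_ge0 //.
have r0 := absC_pos eta0 zeta.
have z0 : ImC z != 0 by rewrite -normr_gt0; apply: lt_le_trans zeta.
have := stieltjes_remainder mg.1 z0 n.
(* The first [n] moments reach the power [n] of [1 / z], one beyond the truncation; the last term is
   moved to the remainder. *)
have -> : \sum_(j < n) RtoC (moment mu j) / z ^+ j.+1 =
    \sum_(j < n) RtoC (cauchy_coef (moment mu) j) / z ^+ j
    + RtoC (cauchy_coef (moment mu) n) / z ^+ n.
  rewrite -(big_ord_recr n (fun j => RtoC (cauchy_coef (moment mu) j) / z ^+ j)) /=.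
  by rewrite big_ord_recl /= mul0r add0r.
set S := \sum_(j < n) _; set a := RtoC _ => H.
rewrite (_ : stieltjes mu z - S = stieltjes mu z - (S + a / z ^+ n) + a / z ^+ n); last by ring.
apply: le_trans (absCD _ _) _; rewrite absCM absCV absCX.
apply: le_trans (lerD H (lexx _)) _; rewrite -mulrDl ler_wpM2r ?invr_ge0 ?exprn_ge0 ?absC_ge0 //.
have am := abs_moment_le n mg.
have yV : `|ImC z|^-1 <= eta^-1 by rewrite lef_pV2 ?posrE // normr_gt0.
set X := (8 * L) ^+ n * n`!%:R.
have X0 : 0 <= X by rewrite mulr_ge0 ?exprn_ge0 ?mulr_ge0.
have X4 : (4 * L) ^+ n * n`!%:R <= X.
  by rewrite ler_wpM2r // lerXn2r ?nnegrE ?mulr_ge0 // ler_wpM2r // ler_nat.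
have t1 : 2 * (`|ImC z|^-1 * (moment mu n./2.*2 + moment mu n./2.*2.+2))
    <= 8 * L ^+ 2 / eta * X.
  apply: le_trans (_ : 2 * (`|ImC z|^-1 * (4 * L ^+ 2 * X)) <= _).
    rewrite ler_wpM2l // ler_wpM2l ?invr_ge0 //; apply: le_trans am _.
    by rewrite ler_wpM2l // mulr_ge0.
  apply: le_trans (_ : 2 * (eta^-1 * (4 * L ^+ 2 * X)) <= _); last first.
    by rewrite le_eqVlt; apply/orP; left; apply/eqP; ring.
  have A0 : 0 <= 4 * L ^+ 2 * X by apply: mulr_ge0 => //; apply: mulr_ge0.
  by rewrite ler_wpM2l // ler_wpM2r.
apply: le_trans (lerD t1 (cB n)) _; rewrite -[B * _ * _]mulrA -/X /B.
have : 0 <= 8 * L ^+ 2 / eta ^+ 2 * X.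
  by apply: mulr_ge0 => //; rewrite divr_ge0 ?exprn_ge0 ?mulr_ge0 ?(ltW eta0).
have : 0 <= 1 / eta * X by apply: mulr_ge0; rewrite // mul1r ltW.
by lra.
Qed.

(** The factor [n + 1] in the remainder of the derivative turns [4 L] into [8 L], and here two
    powers of [1 / z] exceed the truncation. *)
Lemma stieltjes_deriv_gevrey mu : moment_growth mu ->
  gevrey_class eta B (8 * L) (stieltjes_deriv mu)
    (fun n => RtoC (cauchy_deriv_coef (moment mu) n)).
Proof.
move=> mg; have L2 : 0 <= L ^+ 2 by rewrite sqr_ge0.
have B1 : 1 <= B.
  by rewrite /B addrAC lerDr !addr_ge0 ?mulr_ge0 ?invr_ge0 ?exprn_ge0 ?(ltW eta0).
have cB n : absC (RtoC (cauchy_deriv_coef (moment mu) n)) <= (8 * L) ^+ n * n`!%:R.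
  apply: le_trans (deriv_coef_le n mg) _; apply: ler_pM; rewrite ?exprn_ge0 ?LX //.
  by rewrite ler_nat leq_fact2 ?leq_pred.
have cB' n : absC (RtoC (cauchy_deriv_coef (moment mu) n.+1)) <= (8 * L) ^+ n * n`!%:R.
  move: mg => [_ mg]; rewrite absC_RtoC; case: n => [|n] /=.
    by rewrite normr0 mulr_ge0.
  rewrite normrN normrM normr_nat; apply: le_trans (ler_wpM2l _ (mg n)) _ => //.
  rewrite mulrCA -natrM -factS ler_wpM2r //.
  by apply: le_trans (LX n.+1); apply: ler_weXn2l.
split=> [n|n z zeta].
  apply: le_trans (cB n) _; rewrite -mulrA ler_peMl // mulr_ge0 ?exprn_ge0 ?mulr_ge0 //.
have r0 := absC_pos eta0 zeta.
have z0 : ImC z != 0 by rewrite -normr_gt0; apply: lt_le_trans zeta.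
have := stieltjes_deriv_remainder mg.1 z0 n.
have -> : \sum_(j < n) - (j.+1%:R * RtoC (moment mu j)) / z ^+ j.+2 =
    \sum_(j < n) RtoC (cauchy_deriv_coef (moment mu) j) / z ^+ j
    + RtoC (cauchy_deriv_coef (moment mu) n) / z ^+ n
    + RtoC (cauchy_deriv_coef (moment mu) n.+1) / z ^+ n.+1.
  rewrite -(big_ord_recr n (fun j => RtoC (cauchy_deriv_coef (moment mu) j) / z ^+ j)) /=.
  rewrite -(big_ord_recr n.+1 (fun j => RtoC (cauchy_deriv_coef (moment mu) j) / z ^+ j)) /=.
  rewrite !big_ord_recl /= !mul0r !add0r; apply: eq_bigr => j _.
  by rewrite RtoCN RtoCM RtoC_nat.
set S := \sum_(j < n) _; set a := RtoC _; set b := RtoC _ => H.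
rewrite (_ : stieltjes_deriv mu z - S = stieltjes_deriv mu z - (S + a / z ^+ n + b / z ^+ n.+1)
  + (a / z ^+ n + b / z ^+ n.+1)); last by ring.
apply: le_trans (absCD _ _) _; apply: le_trans (lerD H (absCD _ _)) _.
have b1 : absC (b / z ^+ n.+1) <= (1 / eta * ((8 * L) ^+ n * n`!%:R)) / absC z ^+ n.
  rewrite absCM absCV absCX exprS invfM mulrA ler_wpM2r ?invr_ge0 ?exprn_ge0 ?absC_ge0 //.
  rewrite mulrC; apply: ler_pM; rewrite ?absC_ge0 ?invr_ge0 ?absC_ge0 ?cB' //.
  by rewrite mul1r lef_pV2 ?posrE // (le_trans zeta (le_ImC _)).
have a1 : absC (a / z ^+ n) <= ((8 * L) ^+ n * n`!%:R) / absC z ^+ n.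
  by rewrite absCM absCV absCX ler_wpM2r ?invr_ge0 ?exprn_ge0 ?absC_ge0 ?cB.
apply: le_trans (lerD (lexx _) (lerD a1 b1)) _.
rewrite -!mulrDl ler_wpM2r ?invr_ge0 ?exprn_ge0 ?absC_ge0 //.
have am := abs_moment_le n mg.
have yV : `|ImC z|^-1 <= eta^-1 by rewrite lef_pV2 ?posrE // normr_gt0.
rewrite -[B * _ * _]mulrA; set X := (8 * L) ^+ n * n`!%:R.
have X0 : 0 <= X by rewrite mulr_ge0 ?exprn_ge0 ?mulr_ge0.
have X4 : n.+1%:R * ((4 * L) ^+ n * n`!%:R) <= X.
  have -> : X = 2 ^+ n * ((4 * L) ^+ n * n`!%:R).
    by rewrite /X mulrA -exprMn mulrA -natrM.
  rewrite ler_wpM2r ?mulr_ge0 ?exprn_ge0 ?mulr_ge0 //.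
  by rewrite -natrX ler_nat ltn_expl.
have t1 : 2 * (n.+1%:R * (`|ImC z|^-1 ^+ 2 * (moment mu n./2.*2 + moment mu n./2.*2.+2)))
    <= 8 * L ^+ 2 / eta ^+ 2 * X.
  apply: le_trans (_ : 2 * (`|ImC z|^-1 ^+ 2 * (4 * L ^+ 2 * X)) <= _).
    rewrite ler_wpM2l // mulrCA ler_wpM2l ?exprn_ge0 ?invr_ge0 //.
    apply: le_trans (ler_wpM2l _ am) _ => //.
    by rewrite mulrCA ler_wpM2l // mulr_ge0.
  apply: le_trans (_ : 2 * (eta^-1 ^+ 2 * (4 * L ^+ 2 * X)) <= _); last first.
    by rewrite exprVn le_eqVlt; apply/orP; left; apply/eqP; ring.
  have A0 : 0 <= 4 * L ^+ 2 * X by apply: mulr_ge0 => //; apply: mulr_ge0.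
  by rewrite ler_wpM2l // ler_wpM2r // lerXn2r ?nnegrE ?invr_ge0 ?(ltW eta0).
apply: le_trans (lerD t1 (lexx _)) _; rewrite /B.
have : 0 <= 8 * L ^+ 2 / eta * X.
  by apply: mulr_ge0 => //; rewrite divr_ge0 ?mulr_ge0 ?(ltW eta0).
by lra.
Qed.

Lemma cauchy_gevrey : exists B' L' : R, [/\ 0 <= B', 0 < L' &
  forall mu, moment_growth mu ->
    gevrey_class eta B' L' (stieltjes mu) (fun n => RtoC (cauchy_coef (moment mu) n)) /\
    gevrey_class eta B' L' (stieltjes_deriv mu)
      (fun n => RtoC (cauchy_deriv_coef (moment mu) n))].
Proof.
exists B, (8 * L); split=> [||mu mg].
- by rewrite !addr_ge0 ?mulr_ge0 ?invr_ge0 ?exprn_ge0 ?(ltW eta0).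
- by rewrite mulr_gt0 //; apply: lt_le_trans L1.
by split; [apply: stieltjes_gevrey|apply: stieltjes_deriv_gevrey].
Qed.

End CauchyGevrey.

(** * Positivity of the mean pausing time and nonvanishing of the Cauchy transform *)

Section Positivity.
Variable R : realType.
Local Notation C := (Cplx R).
Local Open Scope classical_set_scope.

(** A nonnegative variable of mean zero vanishes almost surely, against the mass on the open
    half-line. *)
Lemma mean_gt0 (psi : probability (measurableTypeR R) R) :
  psi `[0%R, +oo[ = 1%E -> (0 < psi `]0%R, +oo[)%E ->
  psi.-integrable setT (fun x => x%:E) -> 0 < \int[psi]_x x.
Proof.
move=> psi1 psi0 ix.
pose D : set (measurableTypeR R) := `[0%R, +oo[.
have mD : measurable D by exact: measurable_itv.
have N0 : psi (~` D) = 0%E.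
  rewrite probability_setC // -[psi D]/(psi `[0%R, +oo[) psi1.
  by rewrite subee.
have mN : measurable (~` D) by exact: measurableC.
have D0 x : D x -> 0 <= x by rewrite /D /= in_itv /= andbT.
have iD : (\int[psi]_x x%:E = \int[psi]_(x in D) `|x%:E|)%E.
  rewrite (negligible_integral mN measurableT ix N0) setTD setCK.
  apply: eq_integral => x; rewrite inE => /D0 x0.
  by rewrite gee0_abs ?lee_fin.
have nz : (\int[psi]_(x in D) `|x%:E| != 0)%E.
  apply/eqP => /(ae_eq_integral_abs psi mD _)[|]; last first.
    move=> A [mA A0 AD]; apply/negP: psi0; rewrite -leNgt -A0.
    have mP : measurable (`]0%R, +oo[ : set (measurableTypeR R)) by exact: measurable_itv.
    apply: le_measure; [by rewrite inE|by rewrite inE|].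
    move=> x /=; rewrite in_itv /= andbT => x0; apply: AD => /=.
    have : D x by rewrite /D /= in_itv /= andbT ltW.
    by move=> Dx /(_ Dx) [] /eqP; rewrite gt_eqF.
  by apply/measurable_EFinP; apply: measurable_funS measurableT _ _ => //; apply: measurable_id.
have : (0 < \int[psi]_x x%:E)%E.
  by rewrite iD lt_def nz integral_ge0.
rewrite /Rintegral; have := integral_fune_fin_num measurableT ix.
by case: (\int[psi]_x x%:E)%E => //= v _; rewrite lte_fin.
Qed.

Local Close Scope classical_set_scope.

(** The imaginary part of the kernel is [- Im z / p x], of constant sign. The mean of [1 / p] is
    bounded below by the tangent [2 / A - p / A^2] at the mean [A] of [p], that is, by Jensen's
    inequality. *)
Lemma stieltjes_neq0 (mu : probability (measurableTypeR R) R) :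
  (forall j, mu.-integrable setT (fun x => (x ^+ j)%:E)) ->
  forall z : C, ImC z != 0 -> stieltjes mu z != 0.
Proof.
move=> mom z z0.
pose p (x : R) := (ReC z - x) ^+ 2 + ImC z ^+ 2.
have pE x : p x = x ^+ 2 + (- 2 * ReC z * x ^+ 1 + (ReC z ^+ 2 + ImC z ^+ 2) * x ^+ 0).
  by rewrite /p; ring.
have Z (k : R) j : mu.-integrable setT (EFin \o (fun x : R => k * x ^+ j)).
  exact: (integrableZl measurableT k (mom j)).
have ip : mu.-integrable setT (EFin \o p).
  apply: eq_integrable (integrableD measurableT (mom 2%N)
    (integrableD measurableT (Z (- 2 * ReC z) 1%N) (Z (ReC z ^+ 2 + ImC z ^+ 2) 0%N))) => //.
  by move=> x _ /=; rewrite pE !EFinD.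
have icst (c : R) : mu.-integrable setT (EFin \o (fun _ : R => c)).
  apply: eq_integrable (Z c 0%N) => // x _ /=; rewrite expr0 mulr1 //.
have cstE (c : R) : Rintegral mu setT (fun=> c) = c.
  rewrite -[LHS]/(Rintegral mu setT (cst c)) Rintegral_cst; last exact: measurableT.
  have mu1 : mu setT = 1%E by exact: probability_setT.
  by rewrite (_ : fine _ = 1) ?mulr1 // -[1]/(fine 1%E); congr fine; exact: mu1.
have b2 : 0 < ImC z ^+ 2 by rewrite exprn_even_gt0.
pose A := Rintegral mu setT p.
have A0 : 0 < A.
  apply: lt_le_trans b2 _; rewrite -[leLHS]cstE; apply: le_Rintegral => // x _.
  by rewrite /p lerDr sqr_ge0.
have k0 x : absC ((z - RtoC x)^-1) <= `|ImC z|^-1 by exact: stieltjes_kernel_bound.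
have [[_ ik] _] := @Cmean_bound R mu (fun x => (z - RtoC x)^-1) (fun=> `|ImC z|^-1)
  (Cmeasurable_inv z0) (icst _) k0.
pose k (x : R) := ImC ((z - RtoC x)^-1).
have kE x : k x = - ImC z / p x.
  have zx := stieltjes_zx z0 x.
  have p0 : 0 < p x by rewrite /p ltr_wpDl ?sqr_ge0.
  rewrite /k (_ : (z - RtoC x)^-1 = Complex ((ReC z - x) / p x) (- ImC z / p x)) //.
  apply: (mulfI zx); rewrite mulfV //; move: p0 z0; rewrite /p; case: (z) => a b /= p0 b0.
  apply/eqP; rewrite eq_complex /= subr0.
  by apply/andP; split; apply/eqP; field; rewrite gt_eqF.
apply/eqP => /(congr1 (@ImC R)) /= G0.
have {}G0 : Rintegral mu setT k = 0 by exact: G0.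
have H : Rintegral mu setT (fun x => ImC z ^+ 2 * (2 / A) + (- (ImC z ^+ 2) / A ^+ 2) * p x)
   <= Rintegral mu setT (fun x => - ImC z * k x).
  apply: le_Rintegral => //.
  - by apply: eq_integrable (integrableD measurableT (icst (ImC z ^+ 2 * (2 / A)))
      (integrableZl measurableT (- (ImC z ^+ 2) / A ^+ 2) ip)) => // x _ /=; rewrite EFinD EFinM.
  - exact: (integrableZl measurableT (- ImC z) ik).
  move=> x _; rewrite kE.
  have p0 : 0 < p x by rewrite /p ltr_wpDl ?sqr_ge0.
  rewrite -subr_ge0 (_ : _ - _ = ImC z ^+ 2 * ((p x - A) ^+ 2 / (p x * A ^+ 2))).
    by rewrite mulr_ge0 ?sqr_ge0 // divr_ge0 ?sqr_ge0 // mulr_ge0 ?sqr_ge0 ?ltW.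
  by field; rewrite !gt_eqF.
move: H; rewrite RintegralD; [|exact: measurableT|exact: icst
  |exact: (integrableZl measurableT _ ip)].
rewrite cstE !RintegralZl // G0 mulr0 -/A => H.
have : 0 < ImC z ^+ 2 / A by rewrite divr_gt0.
have e : ImC z ^+ 2 * (2 / A) + (- (ImC z ^+ 2) / A ^+ 2) * A = ImC z ^+ 2 / A.
  by field; rewrite gt_eqF.
by rewrite -e ltNge H.
Qed.

End Positivity.

(** * Evolution of Gevrey families *)

Section Evolution.
Variable R : realType.
Local Notation C := (Cplx R).
Variables (B L eta : R).
Hypotheses (B0 : 0 <= B) (L0 : 0 < L) (eta0 : 0 < eta).

Lemma tame_equicont J (q : nat -> R -> R) (delta : R) : 0 < delta ->
  (forall j, exists dq, tame (q j) dq) ->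
  exists2 e : R, 0 < e & forall j u v, (j < J)%N -> 0 <= u -> 0 <= v ->
    `|u - v| <= e -> `|q j u - q j v| <= delta.
Proof.
move=> d0 tq; elim: J => [|J [e e0 eP]]; first by exists 1.
have [dq [c qC]] := tq J.
have c0 : 0 <= c by have [+ _ _] := qC 0 (lexx 0); apply: le_trans.
have c1 : 0 < c + 1 by rewrite ltr_wpDl.
exists (Num.min e (delta / (c + 1))); first by rewrite lt_min e0 divr_gt0.
move=> j u v; rewrite ltnS leq_eqVlt le_min => /orP[/eqP ->|jJ] u0 v0 /andP[uv1 uv2]; last exact: eP.
have [_ _ /(_ u u0)[H _]] := qC v v0; apply: le_trans H _.
apply: le_trans (_ : (c + 1) * `|u - v| <= _); first by rewrite ler_wpM2r // lerDl.
by rewrite mulrC -ler_pdivlMr.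
Qed.

(** [B] and [L] are common to all times, so that [flat_small] applies to differences and averages
    over times. *)
Definition gevrey_family (F : R -> C -> C) (q : nat -> R -> R) :=
  (forall u, 0 <= u -> gevrey_class eta B L (F u) (fun n => RtoC (q n u))) /\
  (forall u z, 0 <= u -> eta <= `|ImC z| -> taylor2 (F u) z).

Lemma gevrey_family_continuous F q z eps : gevrey_family F q ->
  (forall j, exists dq, tame (q j) dq) -> eta < `|ImC z| -> 0 < eps ->
  exists2 e : R, 0 < e & forall u v, 0 <= u -> 0 <= v -> `|u - v| <= e ->
    absC (F u z - F v z) <= eps.
Proof.
move=> [Fq Ft] tq zeta eps0.
have B2 : 0 <= B + absC (-1 : C) * B by rewrite addr_ge0 ?mulr_ge0 ?absC_ge0.
have [J [delta [d0 HJ]]] := flat_small B2 L0 eta0 zeta eps0.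
have [e e0 He] := tame_equicont J d0 tq.
exists e => // u v u0 v0 uv.
rewrite -mulN1r; apply: (HJ (fun w => F u w + -1 * F v w) (fun n => RtoC (q n u) + -1 * RtoC (q n v))).
- by move=> w wz; apply: taylor2D; [apply: Ft|apply: taylor2Z; apply: Ft].
- exact: (gevrey_classD (Fq u u0) (gevrey_classZ (-1) (Fq v v0))).2.
- by move=> j jJ; rewrite mulN1r -RtoCB absC_RtoC; apply: He.
Qed.

(** The [N] steps have quadratic errors [c ((s - t) / N)^2] each. The mesh points are convex
    combinations of [s] and [t], hence nonnegative also when [s < t]. *)
Lemma tame_riemann (q p : R -> R) : tame q p -> exists2 c, 0 <= c &
  forall (s t : R) N, 0 <= s -> 0 <= t -> (0 < N)%N ->
    `|q s - q t - \sum_(i < N) (s - t) / N%:R * p (t + i%:R * ((s - t) / N%:R))|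
    <= c * (s - t) ^+ 2 / N%:R.
Proof.
move=> [c qC]; exists c; first by have [+ _ _] := qC 0 (lexx 0); apply: le_trans.
move=> s t N s0 t0 N0; set h := (s - t) / N%:R.
have NR : N%:R != 0 :> R by rewrite pnatr_eq0 -lt0n.
have NR0 : 0 < N%:R :> R by rewrite ltr0n.
have hN : N%:R * h = s - t by rewrite /h mulrC divfK.
have pos i : (i <= N)%N -> 0 <= t + i%:R * h.
  move=> iN; rewrite (_ : t + i%:R * h = (1 - i%:R / N%:R) * t + i%:R / N%:R * s); last first.
    by rewrite /h; field.
  have i1 : i%:R / N%:R <= 1 :> R by rewrite ler_pdivrMr // mul1r ler_nat.
  by rewrite addr_ge0 // mulr_ge0 // subr_ge0.
have step n : (n <= N)%N -> `|q (t + n%:R * h) - q t - \sum_(i < n) h * p (t + i%:R * h)|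
    <= n%:R * (c * h ^+ 2).
  elim: n => [|n IH] nN; first by rewrite big_ord0 !mul0r addr0 subrr subr0 normr0.
  have [_ _ /(_ _ (pos _ nN))[_ H]] := qC _ (pos n (ltnW nN)).
  have e : t + n.+1%:R * h - (t + n%:R * h) = h by rewrite -natr1; ring.
  rewrite e in H; rewrite big_ord_recr /= -[n.+1%:R in leRHS]natr1 mulrDl mul1r.
  rewrite (_ : _ - _ = (q (t + n%:R * h) - q t - \sum_(i < n) h * p (t + i%:R * h))
    + (q (t + n.+1%:R * h) - q (t + n%:R * h) - h * p (t + n%:R * h))); last by ring.
  by apply: le_trans (ler_normD _ _) (lerD (IH (ltnW nN)) H).
have := step N (leqnn N); rewrite hN [t + _]addrC subrK => /le_trans; apply.
by rewrite /h le_eqVlt; apply/orP; left; apply/eqP; field.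
Qed.

(** The sum has class constant [|s - t| B] for every [N], so [J] and [delta] are fixed before the
    mesh is refined to make the first [J] coefficients small. *)
Lemma gevrey_family_riemann F q G p z eps s t :
  gevrey_family F q -> gevrey_family G p -> (forall j, tame (q j) (p j)) ->
  eta < `|ImC z| -> 0 < eps -> 0 <= s -> 0 <= t ->
  exists2 N, (0 < N)%N & absC (F s z - F t z -
    \sum_(i < N) RtoC ((s - t) / N%:R) * G (t + i%:R * ((s - t) / N%:R)) z) <= eps.
Proof.
move=> [Fq Ft] [Gp Gt] qp zeta eps0 s0 t0.
pose B' := B + absC (-1 : C) * B + absC (-1 : C) * (`|s - t| * B).
have B'0 : 0 <= B' by rewrite !addr_ge0 ?mulr_ge0 ?absC_ge0.
have [J [delta [d0 HJ]]] := flat_small B'0 L0 eta0 zeta eps0.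
have [c cP] : exists c : R, forall j N, (j < J)%N -> (0 < N)%N ->
    `|q j s - q j t - \sum_(i < N) (s - t) / N%:R * p j (t + i%:R * ((s - t) / N%:R))|
    <= c / N%:R.
  elim: (J) => [|j [c cP]]; first by exists 0.
  have [c' c'0 H] := tame_riemann (qp j).
  exists (Num.max c (c' * (s - t) ^+ 2)) => i N; rewrite ltnS leq_eqVlt => /orP[/eqP->|ij] N0.
    apply: le_trans (H _ _ _ s0 t0 N0) _.
    by rewrite ler_wpM2r // le_max lexx orbT.
  apply: le_trans (cP _ _ ij N0) _.
  by rewrite ler_wpM2r // le_max lexx.
pose N := (Num.bound (`|c| / delta)).+1.
have N0 : (0 < N)%N by [].
have NR0 : 0 < N%:R :> R by rewrite ltr0n.
exists N => //; set h := (s - t) / N%:R.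
have pos (i : nat) : (i <= N)%N -> 0 <= t + i%:R * h.
  move=> iN; rewrite (_ : t + i%:R * h = (1 - i%:R / N%:R) * t + i%:R / N%:R * s); last first.
    by rewrite /h; field; rewrite gt_eqF.
  have i1 : i%:R / N%:R <= 1 :> R by rewrite ler_pdivrMr // mul1r ler_nat.
  by rewrite addr_ge0 // mulr_ge0 // subr_ge0.
(* The mesh is continued by [t] beyond [N], since [gevrey_class_sum] takes a family over all indices
   at nonnegative times. *)
pose tt i := t + (if (i <= N)%N then i else 0%N)%:R * h.
have tt0 i : 0 <= tt i by rewrite /tt; case: ifP => [/pos//|_]; rewrite mul0r addr0.
have ttE i : (i < N)%N -> tt i = t + i%:R * h by rewrite /tt => /ltnW ->.
have clsum : gevrey_class eta (`|s - t| * B) L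
   (fun w => \sum_(i < N) RtoC h * G (tt i) w) (fun n => \sum_(i < N) RtoC h * RtoC (p n (tt i))).
  have := @gevrey_class_sum R eta N _ _ _ _ (fun i => gevrey_classZ (RtoC h) (Gp (tt i) (tt0 i))).
  rewrite absC_RtoC (_ : N%:R * (`|h| * B) = `|s - t| * B) //.
  by rewrite /h normrM normfV normr_nat; field; rewrite gt_eqF.
have HF := HJ (fun w => F s w + -1 * F t w + -1 * \sum_(i < N) RtoC h * G (tt i) w)
  (fun n => RtoC (q n s) + -1 * RtoC (q n t) + -1 * \sum_(i < N) RtoC h * RtoC (p n (tt i))).
have -> : F s z - F t z - \sum_(i < N) RtoC h * G (t + i%:R * h) z =
   F s z + -1 * F t z + -1 * \sum_(i < N) RtoC h * G (tt i) z.
  rewrite !mulN1r; congr (_ - _); apply: eq_bigr => i _; by rewrite ttE.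
apply: HF => [w wz||j jJ].
- apply: taylor2D; first by apply: taylor2D; [apply: Ft|apply: taylor2Z; apply: Ft].
  apply: taylor2Z; apply: (@taylor2_sum R N (fun i w => RtoC h * G (tt i) w)) => i.
  by apply: taylor2Z; apply: Gt.
- exact: (gevrey_classD (gevrey_classD (Fq s s0) (gevrey_classZ (-1) (Fq t t0)))
    (gevrey_classZ (-1) clsum)).2.
have -> : \sum_(i < N) RtoC h * RtoC (p j (tt i)) =
   RtoC (\sum_(i < N) h * p j (t + i%:R * h)).
  by rewrite RtoC_sum; apply: eq_bigr => i _; rewrite (RtoCM h) ttE.
rewrite !mulN1r -!RtoCB absC_RtoC; apply: le_trans (cP _ _ jJ N0) _.
rewrite ler_pdivrMr // mulrC -ler_pdivrMr //.
apply: le_trans (_ : `|c| / delta <= _); first by rewrite ler_pM2r ?invr_gt0 // ler_norm.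
apply: ltW; apply: lt_trans (archi_boundP _) _; first by rewrite divr_ge0 // ltW.
by rewrite ltr_nat.
Qed.

(** Half of the error is the Riemann sum, whose mesh may depend on [s]; the other half is the
    continuity in time of [G] between [t] and [s]. *)
Lemma gevrey_family_derivative F q G p z eps t :
  gevrey_family F q -> gevrey_family G p -> (forall j, tame (q j) (p j)) ->
  (forall j, exists dp, tame (p j) dp) ->
  eta < `|ImC z| -> 0 < eps -> 0 <= t ->
  exists2 e : R, 0 < e & forall s, 0 <= s -> `|s - t| <= e ->
    absC (F s z - F t z - RtoC (s - t) * G t z) <= eps * `|s - t|.
Proof.
move=> hF hG qp tp zeta eps0 t0.
have eps2 : 0 < eps / 2 by rewrite divr_gt0.
have [e e0 He] := gevrey_family_continuous hG tp zeta eps2.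
exists e => // s s0 st.
have [->|st0] := eqVneq s t.
  by rewrite !subrr mul0r subr0 normr0 mulr0 absC0.
have n0 : 0 < `|s - t| by rewrite normr_gt0 subr_eq0.
have eps3 : 0 < eps / 2 * `|s - t| by rewrite mulr_gt0.
have [N N0 HN] := gevrey_family_riemann hF hG qp zeta eps3 s0 t0.
have NR0 : 0 < N%:R :> R by rewrite ltr0n.
move: HN; set h := (s - t) / N%:R => HN.
have hE : RtoC (s - t) * G t z = \sum_(i < N) RtoC h * G t z.
  rewrite sumr_const card_ord -mulr_natl mulrA -RtoC_nat -RtoCM.
  by congr (RtoC _ * _); rewrite /h mulrC divfK // gt_eqF.
rewrite (_ : _ - _ = (F s z - F t z - \sum_(i < N) RtoC h * G (t + i%:R * h) z)
  + (\sum_(i < N) RtoC h * (G (t + i%:R * h) z - G t z))); last first.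
  have -> : \sum_(i < N) RtoC h * (G (t + i%:R * h) z - G t z) =
    \sum_(i < N) RtoC h * G (t + i%:R * h) z - \sum_(i < N) RtoC h * G t z.
    by rewrite -sumrB; apply: eq_bigr => i _; rewrite mulrBr.
  by rewrite hE; ring.
apply: le_trans (absCD _ _) _.
have -> : eps * `|s - t| = eps / 2 * `|s - t| + \sum_(i < N) `|h| * (eps / 2).
  rewrite sumr_const card_ord -mulr_natl /h normrM normfV normr_nat.
  by field; rewrite gt_eqF.
apply: lerD => //; apply: le_trans (absC_sum _) _; apply: ler_sum => -[i iN] _ /=.
rewrite absCM absC_RtoC ler_wpM2l //.
have ih1 : i%:R / N%:R <= 1 :> R by rewrite ler_pdivrMr // mul1r ler_nat ltnW.
have ih : t + i%:R * h = (1 - i%:R / N%:R) * t + i%:R / N%:R * s.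
  by rewrite /h; field; rewrite gt_eqF.
apply: He => //; first by rewrite ih addr_ge0 // mulr_ge0 // subr_ge0.
rewrite addrC addKr /h mulrA mulrAC normrM; apply: le_trans st.
by rewrite ler_piMl // ger0_norm.
Qed.

End Evolution.

(** * The limit shapes *)

Section LimitCumulants.
Variable R : realType.
Local Notation C := (Cplx R).
Variables (r : nat -> R) (m : R).
Hypothesis m0 : 0 < m.

Let K (u : R) k := limit_cumulant r m u k.
Let dK (u : R) k := if (k == 1%N) || (k == 2%N) then 0 else - (k.-1%:R / m) * K u k.

Lemma limit_cumulant_tame k : tame (K ^~ k) (dK ^~ k).
Proof.
have [k12|k12] := boolP ((k == 1%N) || (k == 2%N)).
  apply: tame_ext (tame_cst (if k == 1%N then 0 else 1)) _ _ => u *.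
    by rewrite /K /limit_cumulant; case/orP: k12 => /eqP ->.
  by rewrite /dK k12.
have [k1 k2] : (k == 1%N) = false /\ (k == 2%N) = false.
  by move: k12; case: (k == 1%N); case: (k == 2%N).
have a0 : 0 <= k.-1%:R / m by rewrite divr_ge0 // ltW.
apply: tame_ext (tameZ (r k) (tame_exp a0)) _ _ => u *.
  by rewrite /K /limit_cumulant k1 k2 mulrAC.
by rewrite /dK k1 k2 /K /limit_cumulant k1 k2 mulrCA [in RHS]mulrAC.
Qed.

(** For [k = 1] this reads [0 = - 1 + 1]: the semicircle part restores what the compression takes
    from the variance. *)
Lemma limit_cumulant_deriv (u : R) k : 0 <= u ->
  m * dK u k.+1 = - (k%:R * K u k.+1) + (k == 1%N)%:R.
Proof.
move=> _; rewrite /dK /K /limit_cumulant eqSS; case: k => [|[|k]] /=.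
- by rewrite !mulr0 oppr0 addr0.
- by rewrite mulr0 mul1r addNr.
- by rewrite addr0; set x := _ * expR _; field; rewrite gt_eqF.
Qed.

(** By induction from [(n + 1) ^ n <= e n ^ n], with 4 in place of [e]. *)
Lemma natX_le_fact n : n%:R ^+ n <= 4 ^+ n * n`!%:R :> R.
Proof.
elim: n => [|n IH]; first by rewrite !expr0 mul1r.
have e4 : expR 1 <= 4 :> R.
  have -> : 1 = 2%:R * 2^-1 :> R by rewrite mulfV.
  rewrite expRM_natl; apply: le_trans (_ : 2 ^+ 2 <= _); last by rewrite expr2; lra.
  by rewrite lerXn2r ?nnegrE ?expR_ge0 // expR_half_le2.
have step : n.+1%:R ^+ n <= 4 * n%:R ^+ n :> R.
  case: n {IH} => [|n]; first by rewrite !expr0 mulr1 ler1n.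
  have n0 : n.+1%:R != 0 :> R by rewrite pnatr_eq0.
  have -> : n.+2%:R = (1 + n.+1%:R^-1) * n.+1%:R :> R.
    by rewrite mulrDl mul1r mulVf // natr1.
  rewrite exprMn ler_wpM2r ?exprn_ge0 //; apply: le_trans e4.
  rewrite -[leRHS](_ : expR (n.+1%:R * n.+1%:R^-1) = _); last by rewrite mulfV.
  by rewrite expRM_natl lerXn2r ?nnegrE ?expR_ge0 ?addr_ge0 ?invr_ge0 // expR_ge1Dx.
rewrite exprS factS natrM exprS.
apply: le_trans (_ : n.+1%:R * (4 * (4 ^+ n * n`!%:R)) <= _); last first.
  by rewrite le_eqVlt; apply/orP; left; apply/eqP; ring.
by rewrite ler_wpM2l //; apply: le_trans step _; rewrite ler_wpM2l.
Qed.

Hypothesis r_odd : forall j, odd j -> r j = 0.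
Hypothesis r_growth : exists2 K0 : R, 0 < K0 &
  (forall k, odd k -> (3 <= k)%N -> `|r k.+1| `^ (k.+1%:R^-1) <= K0)
  \/ (forall k, odd k -> (3 <= k)%N -> `|r k.+1| `^ (k.+1%:R^-1) <= K0 * k.+1%:R).

(** The first growth alternative implies the second, which [natX_le_fact] turns into
    [(4 K0) ^ s s!]; the [+ 1] in [L] makes room for the second cumulant. Exponential factors are at
    most 1, whence uniformity in time. *)
Lemma limit_cumulant_growth : exists2 L : R, 1 <= L &
  forall u s, 0 <= u -> (0 < s)%N -> `|K u s| <= L ^+ s * s`!%:R.
Proof.
have [K0 K00 gr] := r_growth.
have {}gr k : odd k -> (3 <= k)%N -> `|r k.+1| `^ (k.+1%:R^-1) <= K0 * k.+1%:R.
  case: gr => gr ok k3; last exact: gr.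
  by apply: le_trans (gr k ok k3) _; rewrite ler_peMr ?ler1n // ltW.
pose L := 4 * K0 + 1; have L1 : 1 <= L by rewrite lerDr mulr_ge0 // ltW.
have L0 : 0 <= L by apply: le_trans L1.
exists L => // u s u0 s0; rewrite /K /limit_cumulant.
have [_|s1] := eqVneq s 1%N; first by rewrite normr0 mulr_ge0 ?exprn_ge0.
have [->|s2] := eqVneq s 2%N.
  have L2 : 1 <= L ^+ 2 by rewrite exprn_ege1.
  by rewrite normr1 -[2`!]/2%N; lra.
rewrite normrM [X in _ * X]ger0_norm ?expR_ge0 //.
have E1 : expR (- (s.-1%:R * u / m)) <= 1.
  by rewrite -expR0 ler_expR oppr_le0 divr_ge0 ?mulr_ge0 // ltW.
apply: le_trans (_ : `|r s| * 1 <= _); first by rewrite ler_wpM2l.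
rewrite mulr1; have [os|es] := boolP (odd s).
  by rewrite r_odd // normr0 mulr_ge0 ?exprn_ge0.
case: s s0 s1 s2 es E1 => // k _ k1 k2 /= /negbNE ok _.
have k3 : (3 <= k)%N by case: k k1 k2 ok => [|[|[|k]]].
have rE : (`|r k.+1| `^ (k.+1%:R^-1)) ^+ k.+1 = `|r k.+1|.
  by rewrite -powR_mulrn ?powR_ge0 // -powRrM mulVf ?pnatr_eq0 // powRr1.
rewrite -rE; apply: le_trans (_ : (K0 * k.+1%:R) ^+ k.+1 <= _).
  by rewrite lerXn2r ?nnegrE ?powR_ge0 ?gr // mulr_ge0 // ltW.
rewrite exprMn; apply: le_trans (ler_wpM2l _ (natX_le_fact _)) _.
  by rewrite exprn_ge0 // ltW.
rewrite mulrA -exprMn ler_wpM2r // lerXn2r ?nnegrE ?mulr_ge0 ?(ltW K00) //.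
by rewrite /L mulrC lerDl.
Qed.

Variable mu : R -> probability (measurableTypeR R) R.
Hypothesis mu_cumulants : forall t, 0 <= t -> free_cumulants (mu t) (limit_cumulant r m t).

Lemma moment_nc t j : 0 <= t -> moment (mu t) j = nc_moment (K t) j.
Proof.
move=> t0; case: j => [|j]; last by rewrite (mu_cumulants t0).2 // nc_moment_sum.
rewrite /moment (_ : (fun x => _) = cst 1); last by apply/funext => x; rewrite expr0.
rewrite Rintegral_cst; last exact: measurableT.
have mu1 : mu t setT = 1%E by exact: probability_setT.
by rewrite (_ : fine _ = 1) ?mulr1 // -[1]/(fine 1%E); congr fine; exact: mu1.
Qed.

Lemma limit_moment_growth : exists2 L : R, 1 <= L &
  forall t, 0 <= t -> moment_growth L (mu t).
Proof.
have [L L1 HL] := limit_cumulant_growth.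
exists (3 * L); first by lra.
move=> t t0; split; first exact: (mu_cumulants t0).1.
move=> j; rewrite moment_nc //; apply: nc_moment_bound; first by apply: le_trans L1.
by move=> s s0; apply: HL.
Qed.

Lemma nc_moment_tame : exists dM : nat -> R -> R,
  forall n, tame (fun u => nc_moment (K u) n) (dM n).
Proof.
by have [dM [H _]] := moment_equation limit_cumulant_tame limit_cumulant_deriv; exists dM.
Qed.

Lemma cauchy_coef_tame n : exists dq, tame (fun u => cauchy_coef (nc_moment (K u)) n) dq.
Proof.
have [dM dMP] := nc_moment_tame; case: n => [|n]; last by exists (dM n); apply: dMP.
by exists (fun=> 0); apply: (tame_cst 0).
Qed.

Lemma cauchy_deriv_coef_tame n :
  exists dq, tame (fun u => cauchy_deriv_coef (nc_moment (K u)) n) dq.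
Proof.
have [dM dMP] := nc_moment_tame.
case: n => [|[|n]]; try by exists (fun=> 0); apply: (tame_cst 0).
by eexists; apply: tameN; apply: tameZ; apply: dMP.
Qed.

Lemma cauchy_prod_tame (a b : R -> nat -> R) :
  (forall n, exists dq, tame (a ^~ n) dq) -> (forall n, exists dq, tame (b ^~ n) dq) ->
  forall n, exists dq, tame (fun u => cauchy_prod (a u) (b u) n) dq.
Proof.
move=> /choice[da daP] /choice[db dbP] n.
eexists; apply: (@tame_sum R n.+1 (fun i u => a u i * b u (n - i)%N)) => i _.
exact: (tameM (daP i) (dbP (n - i)%N)).
Qed.

Let q2 (n : nat) (u : R) := m / 2 *
  cauchy_prod (cauchy_coef (nc_moment (K u))) (cauchy_coef (nc_moment (K u))) n.
Let p2 (n : nat) (u : R) :=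
  - cauchy_prod (cauchy_prod (cauchy_coef (nc_moment (K u))) (cauchy_coef (nc_moment (K u))))
      (cauchy_deriv_coef (nc_moment (K u))) n
  + cauchy_prod (cauchy_coef (nc_moment (K u))) (cauchy_coef (nc_moment (K u))) n
  + cauchy_deriv_coef (nc_moment (K u)) n.

Lemma p2_tame n : exists dq, tame (p2 n) dq.
Proof.
have gg := cauchy_prod_tame cauchy_coef_tame cauchy_coef_tame.
have ggh := cauchy_prod_tame gg cauchy_deriv_coef_tame.
have [d1 D1] := ggh n; have [d2 D2] := gg n; have [d3 D3] := cauchy_deriv_coef_tame n.
by eexists; apply: tameD (tameD (tameN D1) D2) D3.
Qed.

Lemma RtoC_cauchy_prod (a b : nat -> R) n :
  RtoC (cauchy_prod a b n) = cauchy_prod (fun i => RtoC (a i)) (fun i => RtoC (b i)) n.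
Proof. by rewrite /cauchy_prod RtoC_sum; apply: eq_bigr => i _; rewrite RtoCM. Qed.

Definition half_square (t : R) (z : C) : C :=
  RtoC (m / 2) * (stieltjes (mu t) z * stieltjes (mu t) z).
Definition burgers_rhs (t : R) (z : C) : C :=
  -1 * (stieltjes (mu t) z * stieltjes (mu t) z * stieltjes_deriv (mu t) z)
  + stieltjes (mu t) z * stieltjes (mu t) z + stieltjes_deriv (mu t) z.

(** [L] is doubled twice because [G^2 G'] is a product of a product. [B2] is a common constant for
    its factors [G^2] and [G']; the final constant dominates those of all three families. *)
Lemma limit_gevrey_families eta : 0 < eta -> exists B L : R, [/\ 0 <= B, 0 < L,
  gevrey_family B L eta (fun t => stieltjes (mu t))
    (fun n u => cauchy_coef (nc_moment (K u)) n),
  gevrey_family B L eta half_square q2 & gevrey_family B L eta burgers_rhs p2].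
Proof.
move=> eta0; have [L3 L31 HL3] := limit_moment_growth.
have [B1 [L1 [B10 L10 H]]] := cauchy_gevrey L31 eta0.
have L10' := ltW L10.
pose B2 := B1 + B1 ^+ 2.
have B12 : 0 <= B1 ^+ 2 by rewrite exprn_ge0.
have B20 : 0 <= B2 by rewrite addr_ge0.
have B22 : 0 <= B2 ^+ 2 by rewrite exprn_ge0.
pose cm := absC (RtoC (m / 2) : C).
have cm0 : 0 <= cm by exact: absC_ge0.
have cB : 0 <= cm * B1 ^+ 2 by rewrite mulr_ge0.
exists (B1 + cm * B1 ^+ 2 + (absC (-1 : C) * B2 ^+ 2 + B1 ^+ 2 + B1)), (4 * L1).
have L2 : 0 <= 2 * L1 by rewrite mulr_ge0.
have e1 : absC (-1 : C) = 1 by rewrite absCN absC1.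
have LL1 : L1 <= 4 * L1 by lra.
have LL2 : 2 * L1 <= 4 * L1 by lra.
have LL3 : L1 <= 2 * L1 by lra.
have cls t : 0 <= t ->
   gevrey_class eta B1 L1 (stieltjes (mu t)) (fun n => RtoC (cauchy_coef (nc_moment (K t)) n)) /\
   gevrey_class eta B1 L1 (stieltjes_deriv (mu t)) (fun n => RtoC (cauchy_deriv_coef (nc_moment (K t)) n)).
  move=> t0; have [h1 h2] := H (mu t) (HL3 t t0).
  have mE : moment (mu t) = nc_moment (K t) by apply/funext => j; apply: moment_nc.
  by rewrite mE in h1 h2.
have Im0 z : eta <= `|ImC z| -> ImC z != 0.
  by move=> zeta; rewrite -normr_gt0; apply: lt_le_trans zeta.
have tG t z : 0 <= t -> eta <= `|ImC z| -> taylor2 (stieltjes (mu t)) z.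
  by move=> t0 zeta; apply: stieltjes_taylor2; [exact: (mu_cumulants t0).1|exact: Im0].
have tH t z : 0 <= t -> eta <= `|ImC z| -> taylor2 (stieltjes_deriv (mu t)) z.
  by move=> t0 zeta; apply: stieltjes_deriv_taylor2; [exact: (mu_cumulants t0).1|exact: Im0].
have gg t : 0 <= t -> gevrey_class eta (B1 ^+ 2) (2 * L1)
    (fun z => stieltjes (mu t) z * stieltjes (mu t) z)
    (cauchy_prod (fun n => RtoC (cauchy_coef (nc_moment (K t)) n))
                 (fun n => RtoC (cauchy_coef (nc_moment (K t)) n))).
  by move=> t0; have [h1 _] := cls t t0; apply: gevrey_classM.
split; [| |split|split|split] => [||t t0|//|t t0|t z t0 zeta|t t0|t z t0 zeta].
- by rewrite e1 !addr_ge0 ?mul1r.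
- by rewrite mulr_gt0.
- apply: gevrey_class_mono (cls t t0).1 => //.
  by rewrite -addrA lerDl e1 mul1r !addr_ge0.
- have := gevrey_classZ (RtoC (m / 2)) (gg t t0).
  move=> /(gevrey_class_mono (B' := B1 + cm * B1 ^+ 2 + (absC (-1 : C) * B2 ^+ 2 + B1 ^+ 2 + B1))
    cB L2 _ LL2) H1.
  apply: gevrey_class_ext (H1 _) => // [n|]; last by rewrite e1 mul1r; lra.
  by rewrite /q2 (RtoCM (m / 2)) RtoC_cauchy_prod.
- by apply: taylor2Z; apply: taylor2M; apply: tG.
- have h1 : gevrey_class eta B2 (2 * L1) _ _ := gevrey_class_mono B12 L2 (_ : _ <= B2) (lexx _) (gg t t0).
  have h2 : gevrey_class eta B2 (2 * L1) _ _ := gevrey_class_mono B10 L10' (_ : _ <= B2) LL3 (cls t t0).2.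
  have BB2 : B1 ^+ 2 <= B2 by rewrite lerDr.
  have BB1 : B1 <= B2 by rewrite lerDl.
  have h3 := gevrey_classM eta0 B20 L2 (h1 BB2) (h2 BB1).
  have h4 := gevrey_classZ (-1) h3.
  rewrite (_ : 2 * (2 * L1) = 4 * L1) in h4; last by ring.
  have h5 := gevrey_class_mono B12 L2 (lexx _) LL2 (gg t t0).
  have h6 := gevrey_class_mono B10 L10' (lexx _) LL1 (cls t t0).2.
  have L4 : 0 <= 4 * L1 by rewrite mulr_ge0.
  have BB : 0 <= absC (-1 : C) * B2 ^+ 2 + B1 ^+ 2 + B1 by rewrite e1 mul1r !addr_ge0.
  have := gevrey_classD (gevrey_classD h4 h5) h6.
  move=> /(gevrey_class_mono (B' := B1 + cm * B1 ^+ 2 + (absC (-1 : C) * B2 ^+ 2 + B1 ^+ 2 + B1))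
    BB L4 _ (lexx _)) H1.
  apply: gevrey_class_ext (H1 _) => // [n|]; last by rewrite lerDr addr_ge0.
  rewrite /p2 !RtoCD RtoCN mulN1r !RtoC_cauchy_prod.
  congr (- cauchy_prod _ _ _ + _ + _).
  by apply/funext => i; rewrite RtoC_cauchy_prod.
- apply: taylor2D; last exact: tH.
  apply: taylor2D; last by apply: taylor2M; apply: tG.
  by apply: taylor2Z; apply: taylor2M; [apply: taylor2M; apply: tG|apply: tH].
Qed.

Lemma half_square_derivative t z eps : 0 <= t -> ImC z != 0 -> 0 < eps ->
  exists2 e : R, 0 < e & forall s, 0 <= s -> `|s - t| <= e ->
    absC (half_square s z - half_square t z - RtoC (s - t) * burgers_rhs t z)
      <= eps * `|s - t| /\
    absC (stieltjes (mu s) z - stieltjes (mu t) z) <= eps.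
Proof.
move=> t0 z0 eps0; have y0 : 0 < `|ImC z| by rewrite normr_gt0.
(* Half the height puts [z] strictly inside the region of uniform expansions, as [flat_small]
   requires. *)
have eta0 : 0 < `|ImC z| / 2 by rewrite divr_gt0.
have zeta : `|ImC z| / 2 < `|ImC z| by lra.
have [B [L [B0 L0 fG fS fP]]] := limit_gevrey_families eta0.
have tq j : tame (q2 j) (p2 j).
  exact: (square_coef_tame limit_cumulant_tame limit_cumulant_deriv).
have [e1 e10 H1] := gevrey_family_derivative B0 L0 eta0 fS fP tq p2_tame zeta eps0 t0.
have [e2 e20 H2] := gevrey_family_continuous B0 L0 eta0 fG cauchy_coef_tame zeta eps0.
exists (Num.min e1 e2); first by rewrite lt_min e10.
by move=> s s0; rewrite le_min => /andP[st1 st2]; split; [apply: H1|apply: H2].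
Qed.

End LimitCumulants.

(** * Limits of difference quotients and the differential equation *)

Section ComplexLimits.
Variable R : realType.
Local Notation C := (Cplx R).
Local Open Scope classical_set_scope.

Lemma cvg_absC (T : Type) (F : set_system T) (FF : Filter F) (f : T -> C) (l : C) :
  (forall e : R, 0 < e -> \forall x \near F, absC (f x - l) <= e) -> f x @[x --> F] --> l.
Proof.
move=> H; apply/cvgrPdist_le => e e0.
have eE : e = RtoC (ReC e).
  by move: e0; case: e => a b; rewrite ltcE /= => /andP[/eqP -> _].
have e0' : 0 < ReC e by move: e0; rewrite eE -RtoC0 RtoC_lt.
near=> x.
rewrite eE norm_absC RtoC_le absC_dist.
by near: x; exact: H.
Unshelve. all: by end_near.
Qed.

End ComplexLimits.

Local Open Scope classical_set_scope.
Local Open Scope ring_scope.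

Lemma stieltjes_is_derive (R : realType) (mu : probability (measurableTypeR R) R) :
  (forall j, mu.-integrable setT (fun x => (x ^+ j)%:E)) ->
  forall z : Cplx R, ImC z != 0 -> is_derive z 1 (stieltjes mu) (stieltjes_deriv mu z).
Proof.
move=> mom z z0; have [K HK] := stieltjes_taylor1 mom z0.
have y0 : 0 < `|ImC z| / 2 by rewrite divr_gt0 // normr_gt0.
have lim : h^-1 *: ((stieltjes mu \o shift z) (h *: (1 : Cplx R)) - stieltjes mu z)
    @[h --> 0^'] --> stieltjes_deriv mu z.
  apply: cvg_absC => e e0.
  pose d := Num.min (`|ImC z| / 4) (e / (`|K| + 1)).
  have K1 : 0 < `|K| + 1 by rewrite ltr_wpDl.
  have d0 : 0 < d by rewrite lt_min !divr_gt0 // normr_gt0.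
  have d0' : 0 < RtoC d by rewrite -RtoC0 RtoC_lt.
  near=> h.
  have h0 : h != 0 by near: h; exact: nbhs_dnbhs_neq.
  have hd : absC h <= d.
    rewrite -RtoC_le -norm_absC; near: h; exact: dnbhs0_le.
  move: hd; rewrite le_min => /andP[h1 h2].
  have ha : 0 < absC h by rewrite absC_gt0.
  have hy : absC h < `|ImC z| / 2 by lra.
  have -> : h^-1 *: ((stieltjes mu \o shift z) (h *: (1 : Cplx R)) - stieltjes mu z)
      - stieltjes_deriv mu z
      = h^-1 * (stieltjes mu (z + h) - stieltjes mu z - h * stieltjes_deriv mu z).
    rewrite /= [h *: 1]mulr1 [h + z]addrC [_ *: _]/(h^-1 * _) mulrBr.
    by rewrite mulrBr mulKf // -mulrBr.
  rewrite absCM absCV mulrC ler_pdivrMr //; apply: le_trans (HK h hy) _.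
  rewrite expr2 mulrA ler_pM2r //.
  apply: le_trans (_ : (`|K| + 1) * absC h <= _).
    by rewrite ler_pM2r // ler_wpDr // ler_norm.
  by rewrite mulrC -ler_pdivlMr.
split; first exact: cvgP lim.
exact: cvg_lim lim.
Unshelve. all: by end_near.
Qed.

Lemma cvg_sqr_quotient (C : numFieldType) (T : Type) (F : set_system T)
    (FF : Filter F) (a g : T -> C) (c p g0 : C) :
  g0 != 0 -> g x @[x --> F] --> g0 -> a x @[x --> F] --> p ->
  c^-1 * (a x * (g x + g0)^-1) @[x --> F] --> c^-1 * (p * (g0 + g0)^-1)
  /\ \forall x \near F, g x + g0 != 0.
Proof.
move=> g00 limg lima.
have g20 : g0 + g0 != 0 by rewrite -mulr2n mulrn_eq0.
have limD : g x + g0 @[x --> F] --> g0 + g0 by apply: cvgD => //; apply: cvg_cst.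
split; last exact: cvgr_neq0 limD g20.
by apply: cvgM; [exact: cvg_cst|apply: cvgM => //; exact: cvgV].
Qed.

(** The difference quotient of [g] is that of [c g^2] divided by [c (g (t + h) + g t)], which stays
    away from 0 by continuity and [g t != 0]. *)
Lemma has_time_derivative_sqr (R : realType) (g : R -> Cplx R) (c p : Cplx R) (t : R) :
  c != 0 -> g t != 0 -> g (t + h) @[h --> 0^'] --> g t ->
  (RtoC h)^-1 * (c * (g (t + h) * g (t + h)) - c * (g t * g t)) @[h --> 0^'] --> p ->
  has_time_derivative g t (p / (c * (g t + g t))).
Proof.
move=> c0 g0 limg limS.
have [lim2 near0] := cvg_sqr_quotient _ c g0 limg limS.
rewrite /has_time_derivative.
have g20 : g t + g t != 0 by rewrite -mulr2n mulrn_eq0.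
have -> : p / (c * (g t + g t)) = c^-1 * (p * (g t + g t)^-1).
  by move: g20; set x := g t + g t => x0; field; rewrite c0 x0.
apply: cvg_trans lim2; apply: near_eq_cvg; near=> h.
have h0 : h != 0 by near: h; exact: nbhs_dnbhs_neq.
have hC : RtoC h != 0 :> Cplx R by rewrite RtoC_eq0.
have s0 : g (t + h) + g t != 0 by near: h; exact: near0.
by field; rewrite hC c0 s0.
Unshelve. all: by end_near.
Qed.

Theorem corollary1p5 (R : realType)
    (M0 : forall n, spin_dual R n -> R)
    (f0 : forall n, spin_sym n -> Cplx R)
    (hM0 : forall n, (0 < n)%N -> is_prob_mass (M0 n))
    (hf0 : forall n, (0 < n)%N -> spin_central_pd (f0 n))
    (hf0M : forall n, (0 < n)%N -> forall x, f0 n x = spin_mixture (M0 n) x)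
    (hfactor : approx_factorization f0)
    (r : nat -> R)
    (hr : forall k, odd k -> (3 <= k)%N ->
       (fun n => RtoC (n%:R `^ (k.-1%:R / 2)) * f0 n (spin_cycle n (iota 1 k)))
         @ \oo --> RtoC (r k.+1))
    (hr_odd : forall j, odd j -> r j = 0)
    (hr_two : r 2%N = 1)
    (hr_growth : exists2 K : R, 0 < K &
       (forall k, odd k -> (3 <= k)%N ->
          `|r k.+1| `^ (k.+1%:R^-1) <= K)
       \/ (forall k, odd k -> (3 <= k)%N ->
          `|r k.+1| `^ (k.+1%:R^-1) <= K * k.+1%:R))
    (psi : probability (measurableTypeR R) R)
    (hpsi_nonneg : psi `[0%R, +oo[%classic = 1%E)
    (hpsi_pos : (0 < psi `]0%R, +oo[%classic)%E)
    (m : R)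
    (hmean_int : psi.-integrable setT (fun x => x%:E))
    (hmean : \int[psi]_x x = m)
    (hchar : exists2 a : R, 0 < a &
       (\int[@lebesgue_measure R]_(u in [set u : R | a <= `|u|]%R)
          (absC (char_fun psi u / RtoC u))%:E < +oo)%E)
    (d : nat -> measure_display)
    (Om : forall n, measurableType (d n))
    (P : forall n, probability (Om n) R)
    (Z : forall n, nat -> Om n -> spin_dual R n)
    (tau : forall n, nat -> Om n -> measurableTypeR R)
    (hZ : forall n, (1 < n)%N ->
       markov_chain (P n) (M0 n) (@res_ind R n) (Z n))
    (htau : forall n, (1 < n)%N -> iid_pauses (P n) psi (tau n))
    (hindep : forall n, (1 < n)%N ->
       independent_families (P n) (Z n) (tau n))
    (omega : R -> R -> R)
    (homega_diagram : forall t, 0 <= t ->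
       continuous_diagram (omega t) /\ normalized_diagram (omega t))
    (homega : forall t, 0 <= t ->
       concentrates_on
         (fun n => law (P n) (walk (Z n) (tau n) (t * n%:R))) (omega t))
    (mu : R -> probability (measurableTypeR R) R)
    (hmu : forall t, 0 <= t -> is_transition_measure (omega t) (mu t))
    (hmu_cumulants : forall t, 0 <= t ->
       free_cumulants (mu t) (limit_cumulant r m t) /\
       forall nu : probability (measurableTypeR R) R,
         free_cumulants nu (limit_cumulant r m t) ->
         forall A : set (measurableTypeR R), measurable A -> nu A = mu t A)
    (hmu_free : forall t, 0 < t ->
       exists gam nu0 nu1 : probability (measurableTypeR R) R,
         [/\ is_semicircle gam,
             free_compression (expR (- (t / m))) (mu 0) nu0,
             free_compression (1 - expR (- (t / m))) gam nu1
           & free_convolution nu0 nu1 (mu t)]) :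
  let G (t : R) (z : Cplx R) := stieltjes (mu t) z in
  forall (t : R) (z : Cplx R), 0 < t -> ImC z != 0 ->
    G t z != 0 /\
    exists Gt Gz : Cplx R,
      [/\ has_time_derivative (fun s => G s z) t Gt,
          is_derive z 1 (G t) Gz
        & RtoC m * Gt = - (G t z * Gz) + G t z + (G t z)^-1 * Gz].

Proof.
move=> G t z t0 z0.
have m0 : 0 < m by rewrite -hmean; apply: mean_gt0.
have t0' := ltW t0.
have cum u : 0 <= u -> free_cumulants (mu u) (limit_cumulant r m u).
  by move=> u0; have [] := hmu_cumulants u u0.
have mom u : 0 <= u -> forall j, (mu u).-integrable setT (fun x => (x ^+ j)%:E).
  by move=> /cum[].
have G0 : G t z != 0 by apply: stieltjes_neq0 => //; apply: mom.
split=> //.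
set H := stieltjes_deriv (mu t) z.
set Psi := burgers_rhs mu t z.
have mC : RtoC m != 0 :> Cplx R by rewrite RtoC_eq0 gt_eqF.
(* [Psi] will be the time derivative of [(m / 2) G^2], that is, [m G] times that of [G]. *)
exists (Psi / (RtoC m * G t z)), H; split; last 2 first.
- by apply: stieltjes_is_derive => //; apply: mom.
- by rewrite /Psi /burgers_rhs -/(G t z) -/H; field; rewrite ?G0 ?mC.
have limG : G (t + h) z @[h --> 0^'] --> G t z.
  apply: cvg_absC => e e0.
  have [dl dl0 Hd] := half_square_derivative m0 hr_odd hr_growth cum t0' z0 e0.
  near=> h.
  (* The bound by [t] keeps [t + h >= 0], where the cumulants are known. *)
  have hd : `|h| <= Num.min dl t.
    by near: h; apply: dnbhs0_le; rewrite lt_min dl0.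
  move: hd; rewrite le_min => /andP[h1]; rewrite ler_norml => /andP[h2 h3].
  apply: (Hd _ _ _).2; first lra.
  by rewrite addrC addKr.
have limS : (RtoC h)^-1 * (half_square m mu (t + h) z - half_square m mu t z) @[h --> 0^'] --> Psi.
  apply: cvg_absC => e e0.
  have [dl dl0 Hd] := half_square_derivative m0 hr_odd hr_growth cum t0' z0 e0.
  near=> h.
  have h0 : h != 0 by near: h; exact: nbhs_dnbhs_neq.
  have hd : `|h| <= Num.min dl t.
    by near: h; apply: dnbhs0_le; rewrite lt_min dl0.
  move: hd; rewrite le_min => /andP[h1]; rewrite ler_norml => /andP[h2 h3].
  have hC : RtoC h != 0 :> Cplx R by rewrite RtoC_eq0.
  have th : t + h - t = h by rewrite addrC addKr.
  have := (Hd (t + h) _ _).1; rewrite th => /(_ _ h1) => H1.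
  have {}H1 := H1 ltac:(lra).
  rewrite -[Psi](mulKf hC) -mulrBr absCM absCV absC_RtoC mulrC ler_pdivrMr ?normr_gt0 //.
rewrite (_ : Psi / _ = Psi / (RtoC (m / 2) * (G t z + G t z))); last first.
  by congr (_ / _); rewrite RtoCM RtoCV RtoC_nat; field.
apply: has_time_derivative_sqr limG limS => //.
by rewrite RtoC_eq0 gt_eqF // divr_gt0.
Unshelve. all: by end_near.
Qed.
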